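(* Let $g,h:[0,\infty)\to[0,\infty)$ be integrable with $\|h\|_{L^1}\|g\|_{L^1}<1$, and let $\mu=(\mu_1,\mu_2,\mu_3,\mu_4)\in[0,\infty)^4$ with $\mu_1=\mu_2$ and $\mu_3=\mu_4$. Let $N=(N_1,N_2,N_3,N_4)$ be the $4$-dimensional Hawkes process with parameters $\mu$ and $$\boldsymbol\varphi=\begin{pmatrix} 0 & 0 & h & 0 \\ 0 & 0 & 0 & h \\ g & 0 & 0 & 0 \\ 0 & g & 0 & 0 \end{pmatrix},$$ and let $(S_1,S_2)=(N_1-N_2,\,N_3-N_4)$. Set $\nu_1=\mu_1+\|h\|_{L^1}\mu_3$ and $\nu_2=\mu_3+\|g\|_{L^1}\mu_1$. Extend $g,h$ to $\mathbb R$ by $g(t)=h(t)=0$ for $t<0$, let $F=\sum_{n\ge1}(h\star g)^{\star n}$ (the series converges in $L^1(\mathbb R,dt)$), and let $\gamma_\Delta(x)=(1-|x|/\Delta)^+$. Let $(\Delta_T)_{T>0}$ and $(\tau_T)_{T>0}$ be two families of real numbers with $\Delta_T>0$, such that $\Delta_T/T\to0$ and $\tau_T/T\to0$ as $T\to\infty$. Then, as $T\to\infty$, in $L^2(P)$: $$V_{\Delta_T,T}(S_1,S_{1,\tau_T+\cdot})-C_{11}(\Delta_T,\tau_T)\to0,$$ $$V_{\Delta_T,T}(S_1,S_{2,\tau_T+\cdot})-C_{12}(\Delta_T,\tau_T)\to0,$$ $$V_{\Delta_T,T}(S_2,S_{1,\tau_T+\cdot})-C_{12}(\Delta_T,-\tau_T)\to0,$$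 where $$C_{11}(\Delta,\tau)=\frac{2}{1-\|h\|_{L^1}\|g\|_{L^1}}\;\gamma_\Delta\star\bigl(\delta_0+F+\check F+F\star\check F\bigr)\star\bigl(\nu_1\delta_0+\nu_2\,h\star\check h\bigr)(\tau),$$ $$C_{12}(\Delta,\tau)=\frac{2}{1-\|h\|_{L^1}\|g\|_{L^1}}\;\gamma_\Delta\star\bigl(\delta_0+F+\check F+F\star\check F\bigr)\star\bigl(\nu_2\check h+\nu_1g\bigr)(\tau).$$
   Context: A $d$-dimensional Hawkes process with parameters $(\mu,\boldsymbol\varphi)$, $\boldsymbol\varphi=(\varphi_{ij})$, is defined as follows. Let $(T_n)_{n\ge1}$ be a non-decreasing sequence of random variables with values in $(0,\infty]$ with $T_n<T_{n+1}$ on $\{T_n<\infty\}$, and $(Z_n)_{n\ge1}$ random variables with values in $\{1,\dots,d\}$. Put $N_{i,t}=\sum_{n\ge1}\mathbf 1_{\{T_n\le t\}\cap\{Z_n=i\}}$ for $t\ge0$ (so $N_{i,0}=0$ and no two components jump simultaneously) and $\mathscr F_t=\sigma(N_{i,s}:s\le t,\,1\le i\le d)$. Under $P$, for all $n\ge1$ and $i$, the process $N_{i,t\wedge T_n}-\int_0^{t\wedge T_n}\lambda_{i,s}\,ds$ is an $(\mathscr F_t)$-martingale, where $$\lambda_{i,t}=\mu_i+\int_{(0,t)}\sum_{j=1}^d\varphi_{ij}(t-s)\,dN_{j,s},$$ with $\mu_i\ge0$ and Borel kernels $\varphi_{ij}:[0,\infty)\to[0,\infty)$. No stationarity is assumed.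 Here $d=4$, and $\|f\|_{L^1}=\int_0^\infty f(t)\,dt$ for $f\ge0$. For real-valued processes $Z,Z'$ indexed by $\mathbb R$ and $\Delta,T>0$, $$V_{\Delta,T}(Z,Z')=\frac1T\sum_{i=1}^{\lfloor T/\Delta\rfloor}(Z_{i\Delta}-Z_{(i-1)\Delta})(Z'_{i\Delta}-Z'_{(i-1)\Delta}),$$ and $Z_{\tau+\cdot}$ is the process $t\mapsto Z_{\tau+t}$; $S_1,S_2$ are extended by $S_{i,t}=0$ for $t\le0$. (Here $E(S_{i,t})=0$ by symmetry, so the processes need no centring.) $\star$ is convolution on $\mathbb R$ (of functions and finite measures), $f^{\star n}$ the $n$-fold convolution power, $\delta_0$ the Dirac mass at $0$, $\check f(t)=f(-t)$, $x^+=\max(x,0)$. *)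

(* Defs.v *)
From HB Require Import structures.
From mathcomp Require Import all_boot all_order all_algebra.
From mathcomp Require Import all_classical all_reals all_analysis.
From mathcomp Require Import measurable_realfun.

Set Implicit Arguments.
Unset Strict Implicit.
Unset Printing Implicit Defensive.

Import Order.TTheory GRing.Theory Num.Theory.
Import numFieldNormedType.Exports.

Local Open Scope classical_set_scope.
Local Open Scope ring_scope.

Section conditional_expectation.
Context d (Omega : measurableType d) (R : realType) (P : probability Omega R).
Local Open Scope ereal_scope.

Definition measurable_wrt (G : set (set Omega)) (X : Omega -> \bar R) :=
  forall B : set (\bar R), measurable B -> G (X @^-1` B).

Definition is_cond_exp (G : set (set Omega)) (X Y : Omega -> \bar R) :=
  [/\ measurable_wrt G Y, P.-integrable setT Y &
      forall A, G A -> \int[P]_(w in A) Y w = \int[P]_(w in A) X w].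

(* time set [0, +oo[ *)
Definition is_martingale (F : R -> set (set Omega)) (X : R -> Omega -> \bar R) :=
  [/\ forall t, (0 <= t)%R -> measurable_wrt (F t) (X t),
      forall t, (0 <= t)%R -> P.-integrable setT (X t) &
      forall s t, (0 <= s <= t)%R -> is_cond_exp (F s) (X t) (X s)].

End conditional_expectation.

Section hawkes.
Context d (Omega : measurableType d) (R : realType) (P : probability Omega R).
Variable dim : nat.
(* [tm n] and [mk n] are the time and the mark of the (n+1)-st point; a point
   with time +oo is absent. *)
Variables (tm : nat -> Omega -> \bar R) (mk : nat -> Omega -> 'I_dim).
Local Open Scope ereal_scope.

Definition marked_points :=
  [/\ forall n, measurable_fun setT (tm n),
      forall n i, measurable (mk n @^-1` [set i]),
      forall n w, 0 < tm n w,
      forall n w, tm n w <= tm n.+1 w &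
      forall n w, tm n w < +oo -> tm n w < tm n.+1 w].

(* Accumulation of the points is not excluded a priori, hence \bar R. *)
Definition counting_process (i : 'I_dim) (t : R) (w : Omega) : \bar R :=
  \sum_(0 <= n <oo) (if (tm n w <= t%:E) && (mk n w == i) then 1 else 0).

Definition natural_filtration (t : R) : set (set Omega) :=
  <<s [set A | exists i s B, [/\ (0 <= s <= t)%R, measurable B &
                                 A = counting_process i s @^-1` B] ]>>.

(* The measure dN_{i,s}(w) on R. *)
Definition jump_measure (i : 'I_dim) (w : Omega) : {measure set R -> \bar R} :=
  mseries (fun n => if (tm n w < +oo) && (mk n w == i)
                    then \d_(fine (tm n w)) : {measure set R -> \bar R}
                    else mzero) 0.

Definition intensity (mu : 'I_dim -> R) (phi : 'I_dim -> 'I_dim -> R -> R)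
    (i : 'I_dim) (t : R) (w : Omega) : \bar R :=
  (mu i)%:E +
  \sum_(j < dim) \int[jump_measure j w]_(s in `]0%R, t[) (phi i j (t - s)%R)%:E.

(* t /\ T_n, which is finite for t real *)
Definition stopped_time (n : nat) (t : R) (w : Omega) : R :=
  fine (Order.min t%:E (tm n w)).

Definition compensated (mu : 'I_dim -> R) (phi : 'I_dim -> 'I_dim -> R -> R)
    (n : nat) (i : 'I_dim) (t : R) (w : Omega) : \bar R :=
  counting_process i (stopped_time n t w) w -
  \int[lebesgue_measure]_(s in `[0%R, stopped_time n t w]) intensity mu phi i s w.

Definition is_hawkes (mu : 'I_dim -> R) (phi : 'I_dim -> 'I_dim -> R -> R) :=
  marked_points /\
  forall n i, is_martingale P natural_filtration (compensated mu phi n i).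

End hawkes.

Section symmetric_model.
Context d (Omega : measurableType d) (R : realType).

Definition comp1 : 'I_4 := @Ordinal 4 0 isT.
Definition comp2 : 'I_4 := @Ordinal 4 1 isT.
Definition comp3 : 'I_4 := @Ordinal 4 2 isT.
Definition comp4 : 'I_4 := @Ordinal 4 3 isT.

Definition kernel4 (g h : R -> R) (i j : 'I_4) : R -> R :=
  match val i, val j with
  | 0%N, 2%N | 1%N, 3%N => h
  | 2%N, 0%N | 3%N, 1%N => g
  | _, _ => fun=> 0
  end.

(* N_i - N_j, set to 0 on ]-oo, 0]; [fine] acts only on the event where the
   points accumulate before t. *)
Definition difference_process (tm : nat -> Omega -> \bar R)
    (mk : nat -> Omega -> 'I_4) (i j : 'I_4) (t : R) (w : Omega) : R :=
  if 0 < t then fine (counting_process tm mk i t w) -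
                fine (counting_process tm mk j t w)
  else 0.

Definition time_shift (tau : R) (Z : R -> Omega -> R) : R -> Omega -> R :=
  fun t => Z (tau + t).

Definition realized_cov (Delta T : R) (Z Z' : R -> Omega -> R) (w : Omega) : R :=
  T^-1 * \sum_(1 <= i < (Num.truncn (T / Delta)).+1)
    (Z (i%:R * Delta) w - Z (i.-1%:R * Delta) w) *
    (Z' (i%:R * Delta) w - Z' (i.-1%:R * Delta) w).

Definition cvg0_L2 (P : probability Omega R) (X : R -> Omega -> R) :=
  (\forall T \near +oo, X T \in Lfun P 2%:E) /\
  ('N[P]_(2%:E) [EFin \o X T])%E @[T --> +oo] --> 0%E.

End symmetric_model.

(* Measures on R are handled as plain set functions, and nonnegative densities
   take values in \bar R, so that convolutions and series of nonnegative
   functions are defined everywhere. *)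
Section convolution.
Context (R : realType).
Local Open Scope ereal_scope.

Definition dens (f : R -> \bar R) : set R -> \bar R :=
  fun A => \int[lebesgue_measure]_(x in A) f x.

Definition convol (f k : R -> \bar R) : R -> \bar R :=
  fun t => \int[lebesgue_measure]_s (f (t - s)%R * k s).

Definition convol_measure (m n : set R -> \bar R) : set R -> \bar R :=
  fun A => \int[m]_x n [set y | A (x + y)%R].

Definition convol_fun_measure (f : R -> R) (m : set R -> \bar R) : R -> \bar R :=
  fun t => \int[m]_s (f (t - s)%R)%:E.

Definition reflect_fun (f : R -> \bar R) : R -> \bar R := fun t => f (- t)%R.

Definition ext0 (f : R -> R) : R -> \bar R :=
  fun t => if (0 <= t)%R then (f t)%:E else 0.

(* [iter n (convol f) f] is the (n+1)-st convolution power of f. For f >= 0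
   with norm < 1 in L^1, the pointwise sum is a version of the L^1 limit. *)
Definition convol_powers_sum (f : R -> \bar R) : R -> \bar R :=
  fun t => \sum_(0 <= n <oo) iter n (convol f) f t.

End convolution.

Section limits.
Context (R : realType).

(* norm of a nonnegative function on [0, +oo[ *)
Definition normL1 (f : R -> R) : R :=
  \int[lebesgue_measure]_(t in `[0, +oo[) f t.

Definition triangle (Delta x : R) : R := Num.max (1 - `|x| / Delta) 0.

Variables g h : R -> R.

Definition Fker : R -> \bar R := convol_powers_sum (convol (ext0 h) (ext0 g)).

Definition resolvent : set R -> \bar R :=
  (\d_(0%R : R) \+ dens Fker \+ dens (reflect_fun Fker)
   \+ dens (convol Fker (reflect_fun Fker)))%E.

Variable mu : 'I_4 -> R.

Definition nu1 : R := mu comp1 + normL1 h * mu comp3.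
Definition nu2 : R := mu comp3 + normL1 g * mu comp1.

Definition C11 (Delta tau : R) : R :=
  2 / (1 - normL1 h * normL1 g) *
  fine (convol_fun_measure (triangle Delta)
    (convol_measure resolvent
       (fun A => nu1%:E * \d_(0%R : R) A +
                 nu2%:E * dens (convol (ext0 h) (reflect_fun (ext0 h))) A)%E)
    tau).

Definition C12 (Delta tau : R) : R :=
  2 / (1 - normL1 h * normL1 g) *
  fine (convol_fun_measure (triangle Delta)
    (convol_measure resolvent
       (fun A => nu2%:E * dens (reflect_fun (ext0 h)) A +
                 nu1%:E * dens (ext0 g) A)%E)
    tau).

End limits.

(* Main.v *)
(* Let M_i be N_i minus its compensator, X_1 = M_1 - M_2 and X_2 = M_3 - M_4.
   By symmetry the baselines cancel, so that S_1 = X_1 + h * S_2 and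
   S_2 = X_2 + g * S_1 pathwise, and every functional which is linear in the
   increments of S_1, S_2 inherits this pair of renewal equations. As
   |h| |g| < 1, an error family solving the pair up to a forcing which is small
   in L^2, uniformly for meshes and shifts o(T), is itself small: it suffices
   that it is bounded for each fixed T, and this comes from fourth moments of
   increments. The principle is applied three times, with
   - the law of large numbers for N_i over the cells of the mesh, whose forcing
     is a martingale;
   - the covariation of X_k with S_l. Its forcing is the covariation of X_k with
     X_l, which is computed from the orthogonality of the M_i, whose bracket is
     N_i, and from the law of large numbers;
   - the covariation of S_l with S_k, whose forcing is the previous one.
   The last two limits solve the corresponding deterministic equations
   x_kl = 1_{k=l} 2 m_k gamma + x_kl' * K_l and c_lk = x_lk + c_l'k * K_l(-.),
   with m_k the stationary rates and K the kernels; their explicit solution is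
   C_11, C_12. Moments are bounded for the process stopped at T_n, uniformly in
   n; this excludes explosion, and Fatou's lemma removes the stopping. *)
Require Import Defs.
From HB Require Import structures.
From mathcomp Require Import all_boot all_order all_algebra.
From mathcomp Require Import all_classical all_reals all_analysis.
From mathcomp Require Import measurable_realfun.
From mathcomp Require Import ring lra.
Import Order.TTheory GRing.Theory Num.Theory.
Import numFieldNormedType.Exports.
Local Open Scope classical_set_scope.
Local Open Scope ring_scope.
Set Implicit Arguments.
Unset Strict Implicit.
Unset Printing Implicit Defensive.

(** * Renewal inequalities in mean square *)

Section contraction.
Context (R : realType).

(** Only the product of the two masses is below one, so a single renewal equation need not contract;
    bounds are pushed once around the loop, through the partner and back. In mean square each
    passage costs a factor 1 + eps, from (x + y)^2 <= (1 + 1/eps) x^2 + (1 + eps) y^2, and eps is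
    chosen small against 1 - |h| |g|. The contraction turns a bound K into c + q K, which says
    nothing unless some finite bound is known beforehand: hence the bounds for fixed T, and for the
    moments the trivial bound n + 1 on a process stopped at the point of index n. The renewal
    equation evaluates the error at shifts b - s with s unbounded, whereas smallness holds only for
    shifts small against T. The kernel is therefore cut at a level A: below A the shifts stay
    admissible, beyond A a bound uniform in all shifts is multiplied by a small tail mass. On the
    deterministic side, the measures in C_11 and C_12 are bare set functions; integrals against them
    are computed by recognising each one as a countably additive functional evaluated at
    indicators. *)

Lemma geometric_le (q K e : R) : 0 <= q < 1 -> 0 <= K -> 0 < e ->
  exists n : nat, q ^+ n * K <= e.
Proof.
move=> /andP[q0 q1] K0 e0.
have : (fun n => q ^+ n * K) @ \oo --> (0 * K : R).
  by apply: cvgM; [apply: cvg_expr; rewrite ger0_norm|exact: cvg_cst].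
rewrite mul0r => /cvgrPdist_le /(_ e e0)[n _ /(_ n (leqnn n))].
by rewrite sub0r normrN => nle; exists n; apply: le_trans nle; rewrite ler_norm.
Qed.

(** Iterating K -> c + q K from [K0] gives c / (1 - q) + q^n K0, and the factor 2 absorbs the
    remainder, as [P] is not assumed closed under limits. The property is kept abstract because it
    is used both for bounds holding for all shifts and for eventual bounds. *)
Lemma contraction_bound (P : R -> Prop) (c q K0 : R) :
  (forall K L, K <= L -> P K -> P L) -> 0 < c -> 0 <= q < 1 -> 0 <= K0 ->
  (forall K, 0 <= K -> P K -> P (c + q * K)) -> P K0 ->
  P (2 * c / (1 - q)).
Proof.
move=> mono c0 q01 K00 step PK0.
have /andP[q0 q1] := q01.
have d0 : 0 < 1 - q by rewrite subr_gt0.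
have cd0 : 0 < c / (1 - q) by rewrite divr_gt0.
have [n nle] := geometric_le q01 K00 cd0.
suff Pn : P (c / (1 - q) + q ^+ n * K0).
  by apply: mono Pn; rewrite -mulrA mulr_natl mulr2n lerD2l.
elim: {nle} n => [|n IH].
  by apply: mono PK0; rewrite expr0 mul1r lerDr ltW.
have -> : c / (1 - q) + q ^+ n.+1 * K0 = c + q * (c / (1 - q) + q ^+ n * K0).
  rewrite exprS; field; lra.
apply: step => //; apply: addr_ge0; first exact: ltW.
by rewrite mulr_ge0 // exprn_ge0.
Qed.

End contraction.

(** * Integrals of nonnegative functions and a perturbed Jensen inequality *)

Section integral_setT.
Local Open Scope ereal_scope.
Context d (T : measurableType d) (R : realType) (m : {measure set T -> \bar R}).
Implicit Types f g : T -> \bar R.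

Lemma integralT_le f g : measurable_fun setT f -> measurable_fun setT g ->
  (forall x, 0 <= f x) -> (forall x, f x <= g x) ->
  \int[m]_x f x <= \int[m]_x g x.
Proof. by move=> mf mg f0 fg; apply: ge0_le_integral. Qed.

Lemma integralT_ge0 f : (forall x, 0 <= f x) -> 0 <= \int[m]_x f x.
Proof. by move=> f0; exact: integral_ge0. Qed.

Lemma integralT_D f g : measurable_fun setT f -> measurable_fun setT g ->
  (forall x, 0 <= f x) -> (forall x, 0 <= g x) ->
  \int[m]_x (f x + g x) = \int[m]_x f x + \int[m]_x g x.
Proof. by move=> mf mg f0 g0; rewrite ge0_integralD. Qed.

Lemma integralT_Zl f k : measurable_fun setT f -> (forall x, 0 <= f x) ->
  0 <= k -> \int[m]_x (k * f x) = k * \int[m]_x f x.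
Proof. by move=> mf f0 k0; rewrite ge0_integralZl. Qed.

Lemma integralT_Zr f k : measurable_fun setT f -> (forall x, 0 <= f x) ->
  0 <= k -> \int[m]_x (f x * k) = (\int[m]_x f x) * k.
Proof. by move=> mf f0 k0; rewrite ge0_integralZr. Qed.

Lemma measurable_EFinT (f : T -> R) : measurable_fun setT f ->
  measurable_fun setT (fun x => (f x)%:E).
Proof. by move=> mf; apply/measurable_EFinP. Qed.

End integral_setT.

Section iterated_integrals.
Local Open Scope ereal_scope.
Context d1 d2 (T1 : measurableType d1) (T2 : measurableType d2) (R : realType).
Variables (m1 : {sigma_finite_measure set T1 -> \bar R}).
Variables (m2 : {sigma_finite_measure set T2 -> \bar R}).
Variable f : T1 -> T2 -> \bar R.
Hypotheses (mf : measurable_fun setT (fun z : T1 * T2 => f z.1 z.2)).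
Hypothesis (f0 : forall x y, 0 <= f x y).

Lemma measurable_integral_r : measurable_fun setT (fun x => \int[m2]_y f x y).
Proof.
by apply: (measurable_fun_fubini_tonelli_F (fun z : T1 * T2 => f z.1 z.2)).
Qed.

Lemma measurable_integral_l : measurable_fun setT (fun y => \int[m1]_x f x y).
Proof.
by apply: (measurable_fun_fubini_tonelli_G (fun z : T1 * T2 => f z.1 z.2)).
Qed.

Lemma tonelli_swap :
  \int[m1]_x \int[m2]_y f x y = \int[m2]_y \int[m1]_x f x y.
Proof. by apply: (fubini_tonelli (fun z : T1 * T2 => f z.1 z.2)). Qed.

End iterated_integrals.

Section weighted_jensen.
Context (R : realType).
Local Notation leb := (@lebesgue_measure R).
Local Open Scope ereal_scope.

Lemma integral_mul_separate (f h : R -> R) :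
  (forall s, 0 <= f s)%R -> (forall s, 0 <= h s)%R ->
  measurable_fun setT f -> measurable_fun setT h ->
  \int[leb]_s \int[leb]_u (f s * h u)%:E =
  (\int[leb]_s (f s)%:E) * (\int[leb]_s (h s)%:E).
Proof.
move=> f0 h0 mf mh.
under eq_integral => s _.
  under eq_integral do rewrite EFinM.
  rewrite integralT_Zl; [|exact: measurable_EFinT|by move=> x; rewrite lee_fin|
    by rewrite lee_fin].
  over.
rewrite integralT_Zr//; first exact: measurable_EFinT.
by apply: integralT_ge0 => x; rewrite lee_fin.
Qed.

Variables (k : R -> R).
Hypotheses (k0 : forall s, (0 <= k s)%R) (mk : measurable_fun setT k).

(** Integrate 2 z(s) z(u) <= z(s)^2 + z(u)^2 against k(s) k(u) over pairs. Dividing by the mass is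
    avoided, so the inequality also holds when integrals are zero or infinite. *)
Lemma jensen_sqr (z : R -> R) : (forall s, (0 <= z s)%R) ->
  measurable_fun setT z ->
  (\int[leb]_s (k s * z s)%:E) * (\int[leb]_s (k s * z s)%:E) <=
  (\int[leb]_s (k s)%:E) * (\int[leb]_s (k s * z s ^+ 2)%:E).
Proof.
move=> z0 mz.
pose a s u : R := (k s * z s * (k u * z u))%R.
pose b s u : R := (k s * (k u * z u ^+ 2))%R.
pose c s u : R := (k s * z s ^+ 2 * k u)%R.
have mkz : measurable_fun setT (fun s => k s * z s)%R by exact: measurable_funM.
have mkz2 : measurable_fun setT (fun s => k s * z s ^+ 2)%R.
  by apply: measurable_funM => //; exact: measurable_funX.
have kz0 s : (0 <= k s * z s)%R by rewrite mulr_ge0.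
have kz20 s : (0 <= k s * z s ^+ 2)%R by rewrite mulr_ge0 ?exprn_ge0.
have a0 s u : 0 <= (a s u)%:E by rewrite lee_fin mulr_ge0.
have b0 s u : 0 <= (b s u)%:E by rewrite lee_fin mulr_ge0.
have c0 s u : 0 <= (c s u)%:E by rewrite lee_fin mulr_ge0.
have m1 (f : R -> R) : measurable_fun setT f ->
  measurable_fun setT (fun x : R * R => f x.1) by move=> mf; exact: (measurableT_comp mf measurable_fst).
have m2 (f : R -> R) : measurable_fun setT f ->
  measurable_fun setT (fun x : R * R => f x.2) by move=> mf; exact: (measurableT_comp mf measurable_snd).
have ma : measurable_fun setT (fun x : R * R => (a x.1 x.2)%:E).
  by apply: measurable_EFinT; apply: measurable_funM; [exact: m1 mkz|exact: m2 mkz].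
have mb : measurable_fun setT (fun x : R * R => (b x.1 x.2)%:E).
  by apply: measurable_EFinT; apply: measurable_funM; [exact: m1 mk|exact: m2 mkz2].
have mc : measurable_fun setT (fun x : R * R => (c x.1 x.2)%:E).
  by apply: measurable_EFinT; apply: measurable_funM; [exact: m1 mkz2|exact: m2 mk].
have sec (f : R -> R -> R) s : measurable_fun setT (fun x : R * R => (f x.1 x.2)%:E) ->
    measurable_fun setT (fun u => (f s u)%:E).
  by move=> mf; exact: (measurableT_comp mf (pair1_measurable s)).
have ia := measurable_integral_r leb ma a0.
have ib := measurable_integral_r leb mb b0.
have ic := measurable_integral_r leb mc c0.
have le2 : 2%:E * (\int[leb]_s \int[leb]_u (a s u)%:E) <=
    (\int[leb]_s \int[leb]_u (b s u)%:E) + (\int[leb]_s \int[leb]_u (c s u)%:E).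
  rewrite -integralT_D//; [|by move=> s; exact: integralT_ge0..].
  rewrite -integralT_Zl//; last by move=> s; exact: integralT_ge0.
  apply: integralT_le.
  - exact: measurable_funeM.
  - exact: emeasurable_funD.
  - by move=> s; rewrite mule_ge0//; exact: integralT_ge0.
  move=> s; rewrite -integralT_D//; [|exact: sec..].
  rewrite -integralT_Zl//; last exact: sec.
  apply: integralT_le.
  - by apply: measurable_funeM; exact: sec.
  - by apply: emeasurable_funD; exact: sec.
  - by move=> u; rewrite mule_ge0.
  move=> u; rewrite -EFinM -EFinD lee_fin /a /b /c.
  rewrite -subr_ge0 (_ : _ - _ = k s * k u * (z s - z u) ^+ 2)%R; last by ring.
  by apply: mulr_ge0; [exact: mulr_ge0|exact: sqr_ge0].
move: le2; rewrite /a /b /c !integral_mul_separate// (muleC (\int[leb]_s (k s * z s ^+ 2)%:E)).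
set A := (X in 2%:E * X); set B := (X in _ <= X + _).
by rewrite -[B + B]mule2n -mule_natl lee_pmul2l.
Qed.

End weighted_jensen.

Lemma ecvg0_le (R : realType) (u : nat -> \bar R) (e : R) :
  u @ \oo --> 0%E -> 0 < e -> exists n : nat, (u n <= e%:E)%E.
Proof.
move=> u0 e0; have /fine_cvgP[fin cvg] : u @ \oo --> (0 : R)%:E by [].
move/cvgrPdist_le : cvg => /(_ e e0) cvg.
have [n _ nle] := filterI fin cvg.
have [fn] := nle n (leqnn n).
rewrite /= sub0r normrN => le; exists n; rewrite -[leLHS]fineK//.
by rewrite lee_fin; apply: le_trans le; rewrite ler_norm.
Qed.

Section jensen_perturbed.
Context (R : realType).
Local Notation leb := (@lebesgue_measure R).
Local Open Scope ereal_scope.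
Variables (k : R -> R) (H : R).
Hypotheses (k0 : forall s, (0 <= k s)%R) (mk : measurable_fun setT k).
Hypothesis (kH : \int[leb]_s (k s)%:E = H%:E).

Lemma mass_ge0 : (0 <= H)%R.
Proof. by rewrite -lee_fin -kH; apply: integralT_ge0 => s; rewrite lee_fin. Qed.

Lemma integral_tail_le (rho : R) : (0 < rho)%R -> exists2 A : R, (0 <= A)%R &
  \int[leb]_s ((A < s)%R%:R * k s)%:E <= rho%:E.
Proof.
move=> rho0.
pose f n s := ((n%:R < s)%R%:R * k s)%:E : \bar R.
have mb n : measurable_fun setT (fun s : R => (n%:R < s)%R%:R : R).
  rewrite (_ : (fun s : R => _) = \1_(`]n%:R, +oo[%classic : set R)).
    exact: measurable_indic.
  apply/funext => s; rewrite indicE; congr ((nat_of_bool _)%:R).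
  by apply/idP/idP; rewrite inE/= in_itv/= andbT.
have mf n : measurable_fun setT (f n).
  by apply: measurable_EFinT; exact: measurable_funM.
have ik : leb.-integrable setT (fun s => (k s)%:E).
  apply/integrableP; split; first exact: measurable_EFinT.
  under eq_integral do rewrite gee0_abs ?lee_fin//.
  by rewrite kH ltry.
have f0 s : f ^~ s @ \oo --> 0.
  apply: cvg_near_cst; near=> n; rewrite /f ltNge.
  have -> : (s <= n%:R)%R by near: n; exact: nbhs_infty_ger.
  by rewrite mul0r.
have fk n s : `|f n s| <= (k s)%:E.
  rewrite /f gee0_abs ?lee_fin ?mulr_ge0//.
  by case: (n%:R < s)%R; rewrite ?mul1r ?mul0r.
have [_ _ cvg] := @dominated_convergence _ _ R leb setT measurableT f (cst 0)
  (fun s => (k s)%:E) mf (measurable_cst _) (aeW leb (fun s _ => f0 s)) ik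
  (aeW leb (fun s n _ => fk n s)).
move: cvg; rewrite integral0 => cvg.
have [n nle] := ecvg0_le cvg rho0.
by exists n%:R.
Unshelve. all: by end_near.
Qed.

Variable (eps : R).
Hypothesis eps0 : (0 < eps)%R.

(** Young's inequality (x + i)^2 <= (1 + 1/eps) x^2 + (1 + eps) i^2, where i is the weighted mean
    and i^2 is bounded by Jensen. All the loss on the feedback term is the factor 1 + eps. *)
Lemma perturbed_sqr_le (u x : R) (z : R -> R) : measurable_fun setT z ->
  `|u|%:E <= `|x|%:E + \int[leb]_s (k s * `|z s|)%:E ->
  (u ^+ 2)%:E <= ((1 + eps^-1) * x ^+ 2)%:E +
                 \int[leb]_s (k s * ((1 + eps) * H * z s ^+ 2))%:E.
Proof.
move=> mz ule.
have H0 := mass_ge0.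
have mz2 : measurable_fun setT (fun s => z s ^+ 2)%R by exact: measurable_funX.
have mkz2 : measurable_fun setT (fun s => k s * z s ^+ 2)%R.
  exact: measurable_funM.
have mnz : measurable_fun setT (fun s => `|z s|)%R by exact: measurableT_comp.
have c0 : (0 <= (1 + eps) * H)%R by apply: mulr_ge0 => //; apply: addr_ge0 => //; exact: ltW.
have := jensen_sqr k0 mk (fun s => normr_ge0 (z s)) mnz.
under [X in _ <= _ * X -> _]eq_integral do rewrite real_normK ?num_real//.
have -> : \int[leb]_s (k s * ((1 + eps) * H * z s ^+ 2))%:E =
    ((1 + eps) * H)%:E * \int[leb]_s (k s * z s ^+ 2)%:E.
  rewrite -integralT_Zl//; last 2 first.
  - exact: measurable_EFinT.
  - by move=> s; rewrite lee_fin mulr_ge0// sqr_ge0.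
  by apply: eq_integral => s _; rewrite -EFinM; congr EFin; ring.
rewrite kH.
have I0 : 0 <= \int[leb]_s (k s * `|z s|)%:E.
  by apply: integralT_ge0 => s; rewrite lee_fin mulr_ge0.
have J0 : 0 <= \int[leb]_s (k s * z s ^+ 2)%:E.
  by apply: integralT_ge0 => s; rewrite lee_fin mulr_ge0 ?sqr_ge0.
move: ule I0 J0.
case: (\int[leb]_s (k s * `|z s|)%:E) => [i| |//].
- case: (\int[leb]_s (k s * z s ^+ 2)%:E) => [j| |//].
  + rewrite -!EFinM -!EFinD !lee_fin => ule i0 j0 ij.
    have u2 : (u ^+ 2 <= (`|x| + i) ^+ 2)%R.
      by rewrite -[(u ^+ 2)%R]real_normK ?num_real// lerXn2r// nnegrE ?addr_ge0.
    apply: (le_trans u2).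
    have x2 : (`|x| ^+ 2 = x ^+ 2)%R by rewrite real_normK ?num_real.
    have hh : (0 <= eps^-1 * (`|x| - eps * i) ^+ 2)%R.
      by rewrite mulr_ge0 ?sqr_ge0// invr_ge0 ltW.
    have e1 : (eps^-1 * (`|x| - eps * i) ^+ 2 =
      eps^-1 * x ^+ 2 - 2 * `|x| * i + eps * i ^+ 2)%R.
      by rewrite sqrrB x2; field; rewrite gt_eqF.
    have e2 : ((1 + eps) * (i * i) <= (1 + eps) * (H * j))%R.
      by rewrite ler_pM2l // addr_gt0.
    have -> : ((`|x| + i) ^+ 2 = x ^+ 2 + 2 * `|x| * i + i ^+ 2)%R.
      by rewrite sqrrD x2; ring.
    move: hh; rewrite e1 => hh.
    have : (i * i = i ^+ 2)%R by rewrite expr2.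
    lra.
  (* The second moment is infinite. If H = 0 the convention 0 * oo = 0 makes the right-hand side
     finite, and Jensen then forces the mean [i] to vanish. *)
  + move=> ule i0 _; case: (ltgtP H 0%R) (H0) => // [Hgt|->] _.
      by rewrite !gt0_muley ?lte_fin ?mulr_gt0 ?addr_gt0// addey// !leey.
    rewrite mul0e mulr0 mul0e adde0 -EFinM !lee_fin => ii.
    have i00 : i = 0%R.
      by apply/eqP; rewrite -sqrf_eq0 eq_le sqr_ge0 andbT expr2.
    move: ule; rewrite i00 adde0 lee_fin => ux.
    have : (u ^+ 2 <= x ^+ 2)%R.
      by rewrite -[(u ^+ 2)%R]real_normK ?num_real// -[(x ^+ 2)%R]real_normK ?num_real// lerXn2r// nnegrE.
    have : (0 <= eps^-1 * x ^+ 2)%R by rewrite mulr_ge0 ?sqr_ge0// invr_ge0 ltW.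
    lra.
- case: (\int[leb]_s (k s * z s ^+ 2)%:E) => [j| |//] _ _ j0.
    by rewrite -EFinM mulyy.
  case: (ltgtP H 0%R) (H0) => // [Hgt|->] _.
    by rewrite !gt0_muley ?lte_fin ?mulr_gt0 ?addr_gt0// addey// !leey.
  by rewrite mul0e mulyy.
Qed.

Context d (T : measurableType d) (P : {sigma_finite_measure set T -> \bar R}).

Lemma perturbed_integral_le (U X : T -> R) (Z : R -> T -> R) :
  measurable_fun setT U -> measurable_fun setT X ->
  measurable_fun setT (fun p : R * T => Z p.1 p.2) ->
  {ae P, forall w, `|U w|%:E <= `|X w|%:E + \int[leb]_s (k s * `|Z s w|)%:E} ->
  \int[P]_w (U w ^+ 2)%:E <= (1 + eps^-1)%:E * \int[P]_w (X w ^+ 2)%:E +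
    \int[leb]_s ((k s)%:E * (((1 + eps) * H)%:E * \int[P]_w (Z s w ^+ 2)%:E)).
Proof.
move=> mU mX mZ ae_le.
have H0 := mass_ge0.
have c0 : (0 <= (1 + eps) * H)%R by apply: mulr_ge0 => //; apply: addr_ge0 => //; exact: ltW.
have mZ2 : measurable_fun setT
    (fun p : R * T => (k p.1 * ((1 + eps) * H * Z p.1 p.2 ^+ 2))%:E).
  apply: measurable_EFinT; apply: measurable_funM.
    exact: (measurableT_comp mk measurable_fst).
  by apply: measurable_funM; [exact: measurable_cst|exact: measurable_funX].
have Z20 s w : 0 <= (k s * ((1 + eps) * H * Z s w ^+ 2))%:E.
  by rewrite lee_fin; apply: mulr_ge0 => //; apply: mulr_ge0 => //; exact: sqr_ge0.
have mZs s : measurable_fun setT (Z s).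
  exact: (measurableT_comp mZ (pair1_measurable s)).
have mZw w : measurable_fun setT (fun s => Z s w).
  exact: (measurableT_comp mZ (pair2_measurable w)).
have mX2 : measurable_fun setT (fun w => (X w ^+ 2)%:E).
  by apply: measurable_EFinT; exact: measurable_funX.
have e0 : (0 <= 1 + eps^-1)%R by apply: addr_ge0 => //; rewrite invr_ge0 ltW.
have -> : \int[leb]_s ((k s)%:E * (((1 + eps) * H)%:E * \int[P]_w (Z s w ^+ 2)%:E)) =
    \int[P]_w \int[leb]_s (k s * ((1 + eps) * H * Z s w ^+ 2))%:E.
  rewrite -(tonelli_swap leb P mZ2 Z20); apply: eq_integral => s _.
  have mZ2s : measurable_fun setT (fun w => (Z s w ^+ 2)%:E).
    by apply: measurable_EFinT; exact: measurable_funX.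
  rewrite -integralT_Zl//; last by move=> w; rewrite lee_fin sqr_ge0.
  rewrite -integralT_Zl; last 3 first.
  - exact: measurable_funeM.
  - by move=> w; rewrite mule_ge0// lee_fin sqr_ge0.
  - by rewrite lee_fin.
  by apply: eq_integral => w _; rewrite -!EFinM.
have mI := measurable_integral_l leb mZ2 Z20.
rewrite -integralT_Zl//; last by move=> w; rewrite lee_fin sqr_ge0.
rewrite -integralT_D//; last 3 first.
- exact: measurable_funeM.
- by move=> w; rewrite mule_ge0 ?lee_fin// sqr_ge0.
- by move=> w; exact: integralT_ge0.
apply: ae_ge0_le_integral => //.
- by move=> w _; rewrite lee_fin sqr_ge0.
- by apply: measurable_EFinT; exact: measurable_funX.
- move=> w _; apply: adde_ge0; last exact: integralT_ge0.
  by rewrite mule_ge0 ?lee_fin// sqr_ge0.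
- by apply: emeasurable_funD => //; exact: measurable_funeM.
by apply: filterS ae_le => w wle _; exact: perturbed_sqr_le.
Qed.

Lemma perturbed_integral_const (U X : T -> R) (Z : R -> T -> R) (K : R) :
  measurable_fun setT U -> measurable_fun setT X ->
  measurable_fun setT (fun p : R * T => Z p.1 p.2) ->
  {ae P, forall w, `|U w|%:E <= `|X w|%:E + \int[leb]_s (k s * `|Z s w|)%:E} ->
  (forall s, \int[P]_w (Z s w ^+ 2)%:E <= K%:E) ->
  \int[P]_w (U w ^+ 2)%:E <= (1 + eps^-1)%:E * \int[P]_w (X w ^+ 2)%:E +
    ((1 + eps) * H ^+ 2 * K)%:E.
Proof.
move=> mU mX mZ ae_le ZK.
have H0 := mass_ge0.
have c0 : (0 <= (1 + eps) * H)%R by apply: mulr_ge0 => //; apply: addr_ge0 => //; exact: ltW.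
apply: (le_trans (perturbed_integral_le mU mX mZ ae_le)); rewrite leeD2l//.
have K0 : (0 <= K)%R.
  rewrite -lee_fin; apply: le_trans (ZK 0%R).
  by apply: integralT_ge0 => w; rewrite lee_fin sqr_ge0.
have mZ2 : measurable_fun setT (fun p : R * T => (Z p.1 p.2 ^+ 2)%:E).
  by apply: measurable_EFinT; exact: measurable_funX.
have mI := measurable_integral_r P mZ2
  (fun s w => sqr_ge0 (Z s w) : 0 <= (Z s w ^+ 2)%:E).
have Z0 s : 0 <= \int[P]_w (Z s w ^+ 2)%:E.
  by apply: integralT_ge0 => w; rewrite lee_fin sqr_ge0.
apply: (@le_trans _ _ (\int[leb]_s (((1 + eps) * H * K)%:E * (k s)%:E))).
  apply: integralT_le.
  - by apply: emeasurable_funM; [exact: measurable_EFinT|exact: measurable_funeM].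
  - by apply: measurable_funeM; exact: measurable_EFinT.
  - by move=> s; rewrite !mule_ge0// ?lee_fin.
  move=> s; rewrite [leRHS]muleC lee_wpmul2l ?lee_fin// [leRHS]EFinM.
  by rewrite lee_wpmul2l ?lee_fin.
rewrite integralT_Zl//; [|exact: measurable_EFinT|by rewrite lee_fin mulr_ge0].
by rewrite kH -EFinM lee_fin le_eqVlt (_ : _ == _)//; apply/eqP; ring.
Qed.

(** The lags up to [A] carry the good bound [dl] with at most the full mass H, the lags beyond [A]
    only the crude bound [B] but with the small mass [rho]. Negative lags have no weight. *)
Lemma perturbed_integral_split (U X : T -> R) (Z : R -> T -> R) (A dl B rho : R) :
  (forall s, s < 0 -> k s = 0)%R -> (0 <= dl)%R -> (0 <= B)%R ->
  measurable_fun setT U -> measurable_fun setT X ->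
  measurable_fun setT (fun p : R * T => Z p.1 p.2) ->
  {ae P, forall w, `|U w|%:E <= `|X w|%:E + \int[leb]_s (k s * `|Z s w|)%:E} ->
  (forall s, (0 <= s <= A)%R -> \int[P]_w (Z s w ^+ 2)%:E <= dl%:E) ->
  (forall s, (A < s)%R -> \int[P]_w (Z s w ^+ 2)%:E <= B%:E) ->
  \int[leb]_s ((A < s)%R%:R * k s)%:E <= rho%:E ->
  \int[P]_w (U w ^+ 2)%:E <= (1 + eps^-1)%:E * \int[P]_w (X w ^+ 2)%:E +
    ((1 + eps) * H * (H * dl + B * rho))%:E.
Proof.
move=> kneg dl0 B0 mU mX mZ ae_le Zdl ZB kA.
have H0 := mass_ge0.
have c0 : (0 <= (1 + eps) * H)%R by apply: mulr_ge0 => //; apply: addr_ge0 => //; exact: ltW.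
apply: (le_trans (perturbed_integral_le mU mX mZ ae_le)); rewrite leeD2l//.
have mb : measurable_fun setT (fun s : R => (A < s)%R%:R : R).
  rewrite (_ : (fun s : R => _) = \1_(`]A, +oo[%classic : set R)).
    exact: measurable_indic.
  apply/funext => s; rewrite indicE; congr ((nat_of_bool _)%:R).
  by apply/idP/idP; rewrite inE/= in_itv/= andbT.
have mbk : measurable_fun setT (fun s => ((A < s)%R%:R * k s)%:E).
  by apply: measurable_EFinT; exact: measurable_funM.
have bk0 s : 0 <= ((A < s)%R%:R * k s)%:E by rewrite lee_fin mulr_ge0.
have mZ2 : measurable_fun setT (fun p : R * T => (Z p.1 p.2 ^+ 2)%:E).
  by apply: measurable_EFinT; exact: measurable_funX.
have mI := measurable_integral_r P mZ2
  (fun s w => sqr_ge0 (Z s w) : 0 <= (Z s w ^+ 2)%:E).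
apply: (@le_trans _ _ (\int[leb]_s (((1 + eps) * H)%:E *
    (dl%:E * (k s)%:E + B%:E * ((A < s)%R%:R * k s)%:E)))).
  apply: integralT_le.
  - by apply: emeasurable_funM; [exact: measurable_EFinT|exact: measurable_funeM].
  - apply: measurable_funeM; apply: emeasurable_funD; apply: measurable_funeM => //.
    exact: measurable_EFinT.
  - move=> s; rewrite !mule_ge0// ?lee_fin//.
    by apply: integralT_ge0 => w; rewrite lee_fin sqr_ge0.
  move=> s; rewrite muleCA; apply: lee_pmul => //.
    by rewrite mule_ge0 ?lee_fin//; apply: integralT_ge0 => w; rewrite lee_fin sqr_ge0.
  have [s0|s0] := ltP s 0%R.
    by rewrite kneg// !mulr0 !mule0 mul0e adde0.
  have [As|sA] := ltP A s.
    rewrite mul1r -ge0_muleDl ?lee_fin// [leLHS]muleC lee_pmul ?lee_fin//.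
      by apply: integralT_ge0 => w; rewrite lee_fin sqr_ge0.
    by apply: (le_trans (ZB _ As)); rewrite -EFinD lee_fin lerDr.
  rewrite mul0r mule0 adde0 [leLHS]muleC lee_pmul ?lee_fin//.
    by apply: integralT_ge0 => w; rewrite lee_fin sqr_ge0.
  by apply: Zdl; rewrite s0.
rewrite integralT_Zl//; last 2 first.
- apply: emeasurable_funD; apply: measurable_funeM => //.
  exact: measurable_EFinT.
- by move=> s; apply: adde_ge0; apply: mule_ge0; rewrite ?bk0 ?lee_fin.
rewrite [leRHS]EFinM; apply: lee_wpmul2l; first by rewrite lee_fin.
rewrite integralT_D//; last 4 first.
- by apply: measurable_funeM; exact: measurable_EFinT.
- exact: measurable_funeM.
- by move=> s; rewrite mule_ge0 ?lee_fin.
- by move=> s; rewrite mule_ge0 ?bk0 ?lee_fin.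
rewrite !integralT_Zl ?lee_fin//; last exact: measurable_EFinT.
by rewrite kH EFinD (mulrC H) !EFinM leeD2l// lee_wpmul2l ?lee_fin.
Qed.

End jensen_perturbed.

(** * Families small in mean square when the mesh and the shifts are o(T) *)

Section small_families.
Context d (Omega : measurableType d) (R : realType) (P : probability Omega R).
Local Notation leb := (@lebesgue_measure R).

Definition msq (Y : Omega -> R) : \bar R := (\int[P]_w (Y w ^+ 2)%:E)%E.

(* A family is indexed by the horizon T, the mesh D and two time shifts. *)
Definition family := R -> R -> R -> R -> Omega -> R.

(** Smallness is uniform over all meshes and shifts below a fraction of T, and not along one given
    choice of them: the renewal equation replaces b by b - s, and the class of shifts has to survive
    this. *)
Definition ms_eventually_le (Y : family) (dl : R) :=
  exists eta T0 : R, [/\ 0 < eta <= 1, 1 <= T0 &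
    forall T D x b, T0 <= T -> 0 < D <= eta * T ->
      `|x| <= eta * T -> `|b| <= eta * T -> (msq (Y T D x b) <= dl%:E)%E].

Definition ms_small (Y : family) := forall dl, 0 < dl -> ms_eventually_le Y dl.

(** No restriction on the shifts here: this bound is paired with the tail of the kernel, which
    reaches arbitrarily far into the past. *)
Definition ms_bounded (Y : family) := exists2 B : R, 0 <= B &
  forall T D x b, 1 <= T -> 0 < D <= T -> (msq (Y T D x b) <= B%:E)%E.

(** The finite starting value of the contraction. It may depend on T, D and x, but not on b, the
    variable on which the renewal equation acts. *)
Definition ms_loc_bounded (Y : family) := forall T D x, 1 <= T -> 0 < D <= T ->
  exists2 K : R, 0 <= K & forall b, (msq (Y T D x b) <= K%:E)%E.

Lemma msq_ge0 Y : (0 <= msq Y)%E.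
Proof. by apply: integralT_ge0 => w; rewrite lee_fin sqr_ge0. Qed.

Lemma ms_eventually_le_mono Y dl dl' :
  dl <= dl' -> ms_eventually_le Y dl -> ms_eventually_le Y dl'.
Proof.
move=> dldl' [eta [T0 [h1 h2 h3]]]; exists eta, T0; split => //.
by move=> T D x b *; apply: le_trans (h3 _ _ _ _ _ _ _ _) _; rewrite ?lee_fin.
Qed.

Section one_step.
Variables (k : R -> R) (H eps : R).
Hypotheses (k0 : forall s, 0 <= k s) (mk : measurable_fun setT k).
Hypothesis (kneg : forall s, s < 0 -> k s = 0).
Hypothesis (kH : (\int[leb]_s (k s)%:E = H%:E)%E).
Hypothesis eps0 : 0 < eps.
Variables X Y Y' : family.
Hypothesis mY : forall T D x b, measurable_fun setT (Y T D x b).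
Hypothesis mX : forall T D x b, measurable_fun setT (X T D x b).
Hypothesis mY' : forall T D x,
  measurable_fun setT (fun p : R * Omega => Y' T D x p.1 p.2).
Hypothesis rel : forall T D x b, 1 <= T -> 0 < D <= T ->
  {ae P, forall w, (`|Y T D x b w|%:E <= `|X T D x b w|%:E +
     \int[leb]_s (k s * `|Y' T D x (b - s)%R w|)%:E)%E}.

Let mYs T D x b :
  measurable_fun setT (fun p : R * Omega => Y' T D x (b - p.1) p.2).
Proof.
have mg : measurable_fun setT (fun p : R * Omega => (b - p.1, p.2)).
  apply: measurable_fun_pair; last exact: measurable_snd.
  by apply: measurable_funB; [exact: measurable_cst|exact: measurable_fst].
exact: (measurableT_comp (mY' T D x) mg).
Qed.

Lemma step_bounded C K T D x : 0 <= C -> 1 <= T -> 0 < D <= T ->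
  (forall b, (msq (X T D x b) <= C%:E)%E) ->
  (forall b, (msq (Y' T D x b) <= K%:E)%E) ->
  forall b, (msq (Y T D x b) <= ((1 + eps^-1) * C + (1 + eps) * H ^+ 2 * K)%:E)%E.
Proof.
move=> C0 T1 D0 XC YK b.
apply: le_trans (perturbed_integral_const k0 mk kH eps0 (mY T D x b) (mX T D x b)
  (mYs T D x b) (rel x b T1 D0) (fun s => YK _)) _.
rewrite [leRHS]EFinD leeD2r// [leRHS]EFinM; apply: lee_wpmul2l; last exact: XC.
by rewrite lee_fin addr_ge0// invr_ge0 ltW.
Qed.

Lemma step_small dl rho : 0 <= dl -> 0 < rho -> ms_small X -> ms_bounded Y' ->
  ms_eventually_le Y' dl ->
  ms_eventually_le Y ((1 + eps) * H ^+ 2 * dl + rho).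
Proof.
move=> dl0 rho0 sX [B B0 YB] [eta [T0 [eta01 T01 Ydl]]].
have H0 := mass_ge0 k0 kH.
pose c := (1 + eps) * H.
have c0 : 0 <= c by apply: mulr_ge0 => //; apply: addr_ge0 => //; exact: ltW.
have e0 : 0 < 1 + eps^-1 by rewrite addr_gt0// invr_gt0.
(* Half of [rho] pays for the tail of the kernel and half for the forcing; the 1 in the denominator
   avoids a division by zero. *)
pose rho1 := rho / 2 / (c * B + 1).
have cB : 0 < c * B + 1 by rewrite ltr_wpDl// mulr_ge0.
have rho10 : 0 < rho1 by rewrite !divr_gt0.
have [A A0 kA] := integral_tail_le k0 mk kH rho10.
pose dlX := rho / 2 / (1 + eps^-1).
have dlX0 : 0 < dlX by rewrite !divr_gt0.
have [eta' [T0' [/andP[eta'0 eta'1] T0'1 Xdl]]] := sX _ dlX0.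
have /andP[eta0 eta1] := eta01.
(* Since T >= 2 A / eta, a lag s <= A is at most eta T / 2, so |b| <= eta T / 2 gives |b - s| <= eta
   T and the hypothesis on [Y'] applies. *)
exists (Num.min eta' (eta / 2)), (Num.max (Num.max T0 T0') (2 * A / eta)); split.
- by rewrite lt_min eta'0 divr_gt0//= ge_min eta'1.
- by rewrite !le_max T01.
move=> T D x b; rewrite !ge_max => /andP[/andP[T0T T0'T] AT] /andP[D0].
have T1 : 1 <= T by exact: le_trans T0T.
have Tp : 0 < T by exact: lt_le_trans T1.
set m := Num.min _ _ => Dm xm bm.
have me' : m * T <= eta' * T by rewrite ler_wpM2r ?(ltW Tp)// ge_min lexx.
have me : m * T <= eta / 2 * T by rewrite ler_wpM2r ?(ltW Tp)// ge_min lexx orbT.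
have AT' : A <= eta / 2 * T.
  by move: AT; rewrite ler_pdivrMr// => AT; rewrite -(ler_pM2l (_ : 0 < 2 :> R))//; lra.
have eT : eta / 2 * T <= eta * T by rewrite ler_wpM2r ?ltW//; lra.
have eT1 : eta * T <= T by rewrite ler_piMl ?(ltW Tp).
have DT : 0 < D <= T by rewrite D0 /=; lra.
have Xle := Xdl T D x b T0'T.
have Z1 s : 0 <= s <= A -> (msq (Y' T D x (b - s)%R) <= dl%:E)%E.
  move=> /andP[s0 sA]; apply: Ydl => //; first by rewrite D0 /=; lra.
    by lra.
  apply: le_trans (ler_normB _ _) _; rewrite (ger0_norm s0).
  by lra.
have Z2 s : A < s -> (msq (Y' T D x (b - s)%R) <= B%:E)%E by move=> _; exact: YB.
apply: le_trans (perturbed_integral_split k0 mk kH eps0 kneg dl0 B0 (mY T D x b)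
  (mX T D x b) (mYs T D x b) (rel x b T1 DT) Z1 Z2 kA) _.
apply: (@le_trans _ _ (((1 + eps^-1) * dlX)%:E + (c * (H * dl + B * rho1))%:E)%E).
  rewrite leeD2r// [leRHS]EFinM; apply: lee_wpmul2l; first by rewrite lee_fin ltW.
  by apply: Xle; rewrite ?D0 /=; lra.
rewrite -EFinD lee_fin.
have -> : (1 + eps^-1) * dlX = rho / 2 by rewrite /dlX mulrC divfK// gt_eqF.
have : c * B * rho1 <= rho / 2.
  rewrite /rho1 mulrA ler_pdivrMr// mulrC ler_pM2l ?divr_gt0//.
  by rewrite lerDl.
rewrite /c; lra.
Qed.

End one_step.

Section coupled.
Variables (k1 k2 : R -> R) (H1 H2 : R).
Hypotheses (k10 : forall s, 0 <= k1 s) (mk1 : measurable_fun setT k1).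
Hypothesis (k1neg : forall s, s < 0 -> k1 s = 0).
Hypothesis (k1H : (\int[leb]_s (k1 s)%:E = H1%:E)%E).
Hypotheses (k20 : forall s, 0 <= k2 s) (mk2 : measurable_fun setT k2).
Hypothesis (k2neg : forall s, s < 0 -> k2 s = 0).
Hypothesis (k2H : (\int[leb]_s (k2 s)%:E = H2%:E)%E).
Hypothesis (H12 : H1 * H2 < 1).
Variables X1 X2 Y1 Y2 : family.
Hypothesis mX1 : forall T D x b, measurable_fun setT (X1 T D x b).
Hypothesis mX2 : forall T D x b, measurable_fun setT (X2 T D x b).
Hypothesis mY1 : forall T D x,
  measurable_fun setT (fun p : R * Omega => Y1 T D x p.1 p.2).
Hypothesis mY2 : forall T D x,
  measurable_fun setT (fun p : R * Omega => Y2 T D x p.1 p.2).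
Hypothesis rel1 : forall T D x b, 1 <= T -> 0 < D <= T ->
  {ae P, forall w, (`|Y1 T D x b w|%:E <= `|X1 T D x b w|%:E +
     \int[leb]_s (k1 s * `|Y2 T D x (b - s)%R w|)%:E)%E}.
Hypothesis rel2 : forall T D x b, 1 <= T -> 0 < D <= T ->
  {ae P, forall w, (`|Y2 T D x b w|%:E <= `|X2 T D x b w|%:E +
     \int[leb]_s (k2 s * `|Y1 T D x (b - s)%R w|)%:E)%E}.

(** The square of 1 + eps would do for second moments; the cube serves the fourth moments, whose
    loop factor is the square of (1 + eps)^3 r^2. *)
Lemma exists_contraction_eps (r : R) : 0 <= r < 1 ->
  exists2 eps : R, 0 < eps & (1 + eps) ^+ 3 * r ^+ 2 < 1.
Proof.
move=> /andP[r0 r1]; exists ((1 - r ^+ 2) / 8).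
  by rewrite divr_gt0// subr_gt0 expr_lt1.
set e := _ / 8.
have r2 : 0 <= r ^+ 2 < 1 by rewrite exprn_ge0// expr_lt1.
have e01 : 0 < e <= 1 by rewrite /e; lra.
have e3 : (1 + e) ^+ 3 <= 1 + 7 * e.
  rewrite -subr_ge0 (_ : _ - _ = e * ((1 - e) * (4 + e))); last by ring.
  by rewrite !mulr_ge0//; lra.
apply: (@le_lt_trans _ _ ((1 + 7 * e) * r ^+ 2)).
  by rewrite ler_wpM2r//; lra.
have : 7 * e * r ^+ 2 <= 7 * e by rewrite ler_piMr//; lra.
rewrite /e; lra.
Qed.

Lemma contraction_factor (eps r : R) : 0 < eps -> (1 + eps) ^+ 3 * r ^+ 2 < 1 ->
  (1 + eps) ^+ 2 * r ^+ 2 < 1.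
Proof.
move=> e0; apply: le_lt_trans; rewrite ler_wpM2r ?sqr_ge0// exprS.
by rewrite ler_peMl ?sqr_ge0//; lra.
Qed.

Hypothesis bX1 : ms_bounded X1.
Hypothesis bX2 : ms_bounded X2.
Hypothesis lY1 : ms_loc_bounded Y1.

Let sec (Y : family) :
  (forall T D x, measurable_fun setT (fun p : R * Omega => Y T D x p.1 p.2)) ->
  forall T D x b, measurable_fun setT (Y T D x b).
Proof.
by move=> mY T D x b; exact: (measurableT_comp (mY T D x) (pair1_measurable b)).
Qed.

(** For fixed T, D and x, two steps lead from [Y1] to [Y2] and back with factor (1 + eps)^2 (H1
    H2)^2 < 1. The limit constant depends on the bounds of the forcings only, so the starting bound,
    however large, disappears. *)
Lemma coupled_bounded : ms_bounded Y1.
Proof.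
have H10 := mass_ge0 k10 k1H; have H20 := mass_ge0 k20 k2H.
have r01 : 0 <= H1 * H2 < 1 by rewrite mulr_ge0.
have [eps eps0 /(contraction_factor eps0) q1] := exists_contraction_eps r01.
have [B1 B10 XB1] := bX1; have [B2 B20 XB2] := bX2.
have e0 : 0 < eps^-1 by rewrite invr_gt0.
pose q := (1 + eps) ^+ 2 * (H1 * H2) ^+ 2.
have q01 : 0 <= q < 1 by rewrite q1 mulr_ge0 ?sqr_ge0.
pose c := (1 + eps^-1) * B1 + (1 + eps) * H1 ^+ 2 * ((1 + eps^-1) * B2) + 1.
have c0 : 0 < c.
  rewrite ltr_wpDl// addr_ge0// ?mulr_ge0 ?sqr_ge0//; lra.
exists (2 * c / (1 - q)).
  by rewrite divr_ge0 ?mulr_ge0//; [exact: ltW|lra].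
move=> T D x b T1 DT.
have [K0 K00 YK0] := lY1 x T1 DT.
suff : forall b, (msq (Y1 T D x b) <= (2 * c / (1 - q))%:E)%E by [].
apply: (contraction_bound (P := fun K => forall b, (msq (Y1 T D x b) <= K%:E)%E)
  _ c0 q01 K00 _ YK0).
  by move=> K L KL YK b'; apply: le_trans (YK b') _; rewrite lee_fin.
move=> K K0' YK b'.
have := step_bounded k20 mk2 k2H eps0 (sec mY2) mX2 mY1 rel2 B20 T1 DT
  (fun b => XB2 _ _ _ b T1 DT) YK.
move=> /(step_bounded k10 mk1 k1H eps0 (sec mY1) mX1 mY2 rel1 B10 T1 DT
  (fun b => XB1 _ _ _ b T1 DT)) /(_ b')/le_trans; apply.
by rewrite lee_fin /c /q -subr_ge0 (_ : _ - _ = 1)//; ring.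
Qed.

Hypothesis bY1 : ms_bounded Y1.
Hypothesis bY2 : ms_bounded Y2.
Hypothesis sX1 : ms_small X1.
Hypothesis sX2 : ms_small X2.

(** The same contraction, now applied to the property of being eventually below K and started from
    the global bound. The target [dl] is written as 2 c / (1 - q), and [rho] is chosen so that the
    errors of the two steps add up to exactly c. *)
Lemma coupled_small : ms_small Y1.
Proof.
have H10 := mass_ge0 k10 k1H; have H20 := mass_ge0 k20 k2H.
have r01 : 0 <= H1 * H2 < 1 by rewrite mulr_ge0.
have [eps eps0 /(contraction_factor eps0) q1] := exists_contraction_eps r01.
pose q := (1 + eps) ^+ 2 * (H1 * H2) ^+ 2.
have q01 : 0 <= q < 1 by rewrite q1 mulr_ge0 ?sqr_ge0.
have qp : 0 < 1 - q by lra.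
pose q2 := (1 + eps) * H1 ^+ 2.
have q20 : 0 <= q2 by rewrite mulr_ge0 ?sqr_ge0//; lra.
move=> dl dl0.
pose c := dl * (1 - q) / 2.
have c0 : 0 < c by rewrite divr_gt0// mulr_gt0.
pose rho := c / (q2 + 1).
have q2p : 0 < q2 + 1 by lra.
have rho0 : 0 < rho by rewrite divr_gt0.
have -> : dl = 2 * c / (1 - q) by rewrite /c; field; lra.
have [B B0 YB] := bY1.
apply: (contraction_bound (P := ms_eventually_le Y1) _ c0 q01 B0).
- by move=> K L KL; exact: ms_eventually_le_mono.
- move=> K K0 YK.
  have := step_small k20 mk2 k2neg k2H eps0 (sec mY2) mX2 mY1 rel2 K0 rho0 sX2 bY1 YK.
  have e0 : 0 <= (1 + eps) * H2 ^+ 2 * K + rho.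
    by rewrite addr_ge0 ?(ltW rho0)// !mulr_ge0 ?sqr_ge0//; lra.
  move=> /(step_small k10 mk1 k1neg k1H eps0 (sec mY1) mX1 mY2 rel1 e0 rho0 sX1 bY2).
  apply: ms_eventually_le_mono.
  have -> : c = rho * (q2 + 1) by rewrite /rho divfK// gt_eqF.
  by rewrite /q /q2 -subr_ge0 (_ : _ - _ = 0)//; ring.
exists 1, 1; split; rewrite ?ltr01 ?lexx// => T D x b T1 DT _ _.
by apply: YB; rewrite // -[leRHS]mul1r.
Qed.

End coupled.

Lemma msq_add (X Y : Omega -> R) : measurable_fun setT X -> measurable_fun setT Y ->
  (msq (fun w => X w + Y w)%R <= 2%:E * msq X + 2%:E * msq Y)%E.
Proof.
move=> mX mY.
have mX2 : measurable_fun setT (fun w => (X w ^+ 2)%:E).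
  by apply: measurable_EFinT; exact: measurable_funX.
have mY2 : measurable_fun setT (fun w => (Y w ^+ 2)%:E).
  by apply: measurable_EFinT; exact: measurable_funX.
rewrite /msq -!integralT_Zl//; [|by move=> w; rewrite lee_fin sqr_ge0..].
rewrite -integralT_D//; [|exact: measurable_funeM..
  |by move=> w; rewrite mule_ge0// lee_fin sqr_ge0
  |by move=> w; rewrite mule_ge0// lee_fin sqr_ge0].
apply: integralT_le.
- by apply: measurable_EFinT; apply: measurable_funX; exact: measurable_funD.
- by apply: emeasurable_funD; exact: measurable_funeM.
- by move=> w; rewrite lee_fin sqr_ge0.
move=> w; rewrite -!EFinM -EFinD lee_fin -subr_ge0.
by rewrite (_ : _ - _ = (X w - Y w) ^+ 2)%R ?sqr_ge0//; ring.
Qed.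

Lemma msq_scale (c : R) (X : Omega -> R) : measurable_fun setT X ->
  msq (fun w => c * X w) = ((c ^+ 2)%:E * msq X)%E.
Proof.
move=> mX; rewrite /msq -integralT_Zl ?lee_fin ?sqr_ge0//.
- by apply: eq_integral => w _; rewrite -EFinM exprMn.
- by apply: measurable_EFinT; exact: measurable_funX.
- by move=> w; rewrite lee_fin sqr_ge0.
Qed.

Definition measurable_family (Y : family) :=
  forall T D x b, measurable_fun setT (Y T D x b).

Lemma ms_smallD (X Y : family) : measurable_family X -> measurable_family Y ->
  ms_small X -> ms_small Y -> ms_small (fun T D x b w => X T D x b w + Y T D x b w).
Proof.
move=> mX mY sX sY dl dl0.
have dl4 : 0 < dl / 4 by rewrite divr_gt0.
have [e [T0 [/andP[e0 e1] T01 Xdl]]] := sX _ dl4.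
have [e' [T0' [/andP[e'0 e'1] T0'1 Ydl]]] := sY _ dl4.
exists (Num.min e e'), (Num.max T0 T0'); split.
- by rewrite lt_min e0 e'0 ge_min e1.
- by rewrite le_max T01.
move=> T D x b; rewrite ge_max => /andP[TT TT'].
have T0p : 0 <= T by apply: le_trans TT; apply: le_trans T01.
have m1 : Num.min e e' * T <= e * T by rewrite ler_wpM2r// ge_min lexx.
have m2 : Num.min e e' * T <= e' * T by rewrite ler_wpM2r// ge_min lexx orbT.
move=> /andP[D0 De] xe be.
apply: le_trans (msq_add (mX T D x b) (mY T D x b)) _.
apply: (@le_trans _ _ (2%:E * (dl / 4)%:E + 2%:E * (dl / 4)%:E)%E).
  apply: leeD; apply: lee_wpmul2l => //.
    by apply: Xdl; rewrite ?D0 /=; lra.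
  by apply: Ydl; rewrite ?D0 /=; lra.
by rewrite -!EFinM -EFinD lee_fin; lra.
Qed.

Lemma ms_boundedD (X Y : family) : measurable_family X -> measurable_family Y ->
  ms_bounded X -> ms_bounded Y ->
  ms_bounded (fun T D x b w => X T D x b w + Y T D x b w).
Proof.
move=> mX mY [B B0 XB] [B' B'0 YB]; exists (2 * B + 2 * B').
  by rewrite addr_ge0// mulr_ge0.
move=> T D x b T1 DT; apply: le_trans (msq_add (mX T D x b) (mY T D x b)) _.
by rewrite [leRHS]EFinD ![in leRHS]EFinM; apply: leeD; apply: lee_wpmul2l => //;
  [exact: XB|exact: YB].
Qed.

Lemma ms_smallZ (c : R) (X : family) : measurable_family X ->
  ms_small X -> ms_small (fun T D x b w => c * X T D x b w).
Proof.
move=> mX sX dl dl0.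
have c1 : 0 < c ^+ 2 + 1 by rewrite ltr_wpDl ?sqr_ge0.
have [e [T0 [e01 T01 Xdl]]] := sX _ (divr_gt0 dl0 c1).
exists e, T0; split => // T D x b *; rewrite msq_scale//.
apply: (@le_trans _ _ ((c ^+ 2)%:E * (dl / (c ^+ 2 + 1))%:E)%E).
  by apply: lee_wpmul2l; [rewrite lee_fin sqr_ge0|exact: Xdl].
rewrite -EFinM lee_fin mulrA ler_pdivrMr// mulrC ler_pM2l//.
by rewrite lerDl.
Qed.

Lemma ms_boundedZ (c : R) (X : family) : measurable_family X ->
  ms_bounded X -> ms_bounded (fun T D x b w => c * X T D x b w).
Proof.
move=> mX [B B0 XB]; exists (c ^+ 2 * B); first by rewrite mulr_ge0 ?sqr_ge0.
move=> T D x b T1 DT; rewrite msq_scale// [leRHS]EFinM; apply: lee_wpmul2l; last exact: XB.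
by rewrite lee_fin sqr_ge0.
Qed.

Lemma eq_ms_small (X Y : family) : (forall T D x b, 1 <= T -> 0 < D <= T ->
    X T D x b = Y T D x b) -> ms_small X -> ms_small Y.
Proof.
move=> XY sX dl dl0; have [e [T0 [e01 T01 Xdl]]] := sX _ dl0.
exists e, T0; split => // T D x b T0T /andP[D0 DeT] xe be; rewrite -XY.
- by apply: Xdl => //; rewrite D0.
- exact: le_trans T0T.
- rewrite D0 /=; apply: le_trans DeT _; rewrite ler_piMl//; last by case/andP: e01.
  by apply: le_trans T0T; exact: le_trans T01.
Qed.

Lemma eq_ms_bounded (X Y : family) : (forall T D x b, 1 <= T -> 0 < D <= T ->
    X T D x b = Y T D x b) -> ms_bounded X -> ms_bounded Y.
Proof.
by move=> XY [B B0 XB]; exists B => // T D x b T1 DT; rewrite -XY//; exact: XB.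
Qed.

Lemma ms_small_swap (X : family) : ms_small X -> ms_small (fun T D x b => X T D b x).
Proof.
move=> sX dl dl0; have [e [T0 [e01 T01 Xdl]]] := sX _ dl0.
by exists e, T0; split => // T D x b *; exact: Xdl.
Qed.

End small_families.

(** * Orthogonal martingales and their brackets *)

Section bounded_measurable.
Context d (T : measurableType d) (R : realType).
Implicit Types (X Y Z : T -> R).

(** The stopped processes are bounded at each time, so that expectations of all polynomials in them
    are real numbers and need no integrability argument. *)
Definition bmeas X := measurable_fun setT X /\ exists K : R, forall w, `|X w| <= K.

Lemma bmeas_cst (c : R) : bmeas (fun=> c).
Proof. by split; [exact: measurable_cst|exists `|c|]. Qed.

Lemma bmeasD X Y : bmeas X -> bmeas Y -> bmeas (fun w => X w + Y w).
Proof.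
move=> [mX [K XK]] [mY [L YL]]; split; first exact: measurable_funD.
by exists (K + L) => w; rewrite (le_trans (ler_normD _ _))// lerD.
Qed.

Lemma bmeasM X Y : bmeas X -> bmeas Y -> bmeas (fun w => X w * Y w).
Proof.
move=> [mX [K XK]] [mY [L YL]]; split; first exact: measurable_funM.
by exists (K * L) => w; rewrite normrM ler_pM.
Qed.

Lemma bmeasB X Y : bmeas X -> bmeas Y -> bmeas (fun w => X w - Y w).
Proof.
move=> [mX [K XK]] [mY [L YL]]; split; first exact: measurable_funB.
by exists (K + L) => w; rewrite (le_trans (ler_normB _ _))// lerD.
Qed.

Lemma bmeasX X n : bmeas X -> bmeas (fun w => X w ^+ n).
Proof.
move=> bX; elim: n => [|n IH].
  by under eq_fun do rewrite expr0; exact: bmeas_cst.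
by under eq_fun do rewrite exprS; exact: bmeasM.
Qed.

Lemma bmeas_sum (I : Type) (r : seq I) (F : I -> T -> R) :
  (forall i, bmeas (F i)) -> bmeas (fun w => \sum_(i <- r) F i w).
Proof.
move=> bF; elim: r => [|i r IH].
  by under eq_fun do rewrite big_nil; exact: bmeas_cst.
by under eq_fun do rewrite big_cons; exact: bmeasD.
Qed.

End bounded_measurable.

Section bounded_expectation.
Context d (T : measurableType d) (R : realType) (P : probability T R).
Implicit Types (X Y Z : T -> R).

Definition Ex X : R := (\int[P]_w X w)%R.

Lemma bmeas_integrable X : bmeas X -> P.-integrable setT (EFin \o X).
Proof.
move=> [mX [K XK]]; apply: (measurable_bounded_integrable measurableT _ mX).
  by rewrite ltey_eq fin_num_measure.
exists K; split; first exact: num_real.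
by move=> M KM w _ /=; apply: le_trans (XK w) (ltW KM).
Qed.

Lemma Ex_EFin X : bmeas X -> (Ex X)%:E = (\int[P]_w (X w)%:E)%E.
Proof.
by move=> bX; rewrite fineK//; exact: (integrable_fin_num measurableT (bmeas_integrable bX)).
Qed.

Lemma ExD X Y : bmeas X -> bmeas Y -> Ex (fun w => X w + Y w) = Ex X + Ex Y.
Proof. by move=> bX bY; apply: RintegralD => //; exact: bmeas_integrable. Qed.

Lemma ExB X Y : bmeas X -> bmeas Y -> Ex (fun w => X w - Y w) = Ex X - Ex Y.
Proof. by move=> bX bY; apply: RintegralB => //; exact: bmeas_integrable. Qed.

Lemma ExZ c X : bmeas X -> Ex (fun w => c * X w) = c * Ex X.
Proof. by move=> bX; apply: RintegralZl => //; exact: bmeas_integrable. Qed.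

Lemma Ex_cst c : Ex (fun=> c) = c.
Proof.
have PT : P setT = 1%E := probability_setT P.
by rewrite /Ex Rintegral_cst// [X in fine X]PT mulr1.
Qed.

Lemma Ex_le X Y : bmeas X -> bmeas Y -> (forall w, X w <= Y w) -> Ex X <= Ex Y.
Proof. by move=> bX bY XY; apply: le_Rintegral => //; exact: bmeas_integrable. Qed.

Lemma Ex_ge0 X : (forall w, 0 <= X w) -> 0 <= Ex X.
Proof. by move=> X0; apply: Rintegral_ge0. Qed.

Lemma Ex_sum (I : Type) (r : seq I) (F : I -> T -> R) : (forall i, bmeas (F i)) ->
  Ex (fun w => \sum_(i <- r) F i w) = \sum_(i <- r) Ex (F i).
Proof.
move=> bF; elim: r => [|i r IH].
  by rewrite big_nil -[RHS](Ex_cst 0); apply: eq_Rintegral => w _; rewrite big_nil.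
rewrite big_cons -IH -ExD//; last exact: bmeas_sum.
by apply: eq_Rintegral => w _; rewrite big_cons.
Qed.

Lemma Ex_cvg (X_ : nat -> T -> R) X (K : R) : (forall n, measurable_fun setT (X_ n)) ->
  (forall n w, `|X_ n w| <= K) -> (forall w, X_ ^~ w @ \oo --> X w) ->
  (fun n => Ex (X_ n)) @ \oo --> Ex X.
Proof.
move=> mX XK XX.
have mXl : measurable_fun setT X by apply: (measurable_fun_cvg mX) => w _; exact: XX.
have cvgE w : (fun n => (X_ n w)%:E) @ \oo --> (X w)%:E.
  apply: cvg_EFin; last exact: XX.
  by apply: nearW.
have iK : P.-integrable setT (fun=> K%:E).
  by apply: finite_measure_integrable_cst.
have [_ _] := @dominated_convergence _ _ R P setT measurableT
  (fun n w => (X_ n w)%:E) (fun w => (X w)%:E) (fun=> K%:E)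
  (fun n => measurable_EFinT (mX n)) (measurable_EFinT mXl)
  (aeW P (fun w _ => cvgE w)) iK (aeW P (fun w n _ => XK n w)).
have bX : bmeas X.
  split => //; exists K => w.
  have h : (fun n => `|X_ n w|) @ \oo --> `|X w| by apply: cvg_norm; exact: XX.
  by apply: (cvgr_to_le h); apply: nearW => n; exact: XK.
rewrite -(Ex_EFin bX) => /fine_cvg; apply: cvg_trans.
exact: cvg_id.
Qed.

Lemma Ex_eq X Y : (forall w, X w = Y w) -> Ex X = Ex Y.
Proof. by move=> XY; apply: eq_Rintegral => w _; exact: XY. Qed.

End bounded_expectation.

Section filtered.
Context d (Omega : measurableType d) (R : realType) (P : probability Omega R).
Local Notation Ex := (Ex P).

(** Boundedness together with measurability for the sigma-algebra generated by [C]; a filtration is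
    handled through its generators. *)
Definition adapted (C : set (set Omega)) (Z : Omega -> R) :=
  @bmeas _ (g_sigma_algebraType C) R Z.

Lemma adapted_mono (C C' : set (set Omega)) Z : C `<=` C' -> adapted C Z -> adapted C' Z.
Proof.
move=> CC' [mZ bZ]; split => // mT B mB.
by have := mZ measurableT B mB; exact: sub_sigma_algebra2.
Qed.

Lemma adapted_bmeas (C : set (set Omega)) Z : C `<=` measurable -> adapted C Z -> bmeas Z.
Proof.
move=> Cm [mZ bZ]; split => // mT B mB; have := mZ measurableT B mB.
by apply: smallest_sub => //; exact: sigma_algebra_measurable.
Qed.

(* Layer-cake approximation of Z by sums of indicators of {k / n <= Z}. *)
Lemma floor_sum (x : R) (N : nat) : 0 <= x <= N%:R ->
  x - 1 <= \sum_(k < N) ((k.+1)%:R <= x)%R%:R <= x.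
Proof.
move=> /andP[x0 xN].
have up n : \sum_(k < n) ((k.+1)%:R <= x)%R%:R <= (n%:R : R).
  elim: n => [|n IH]; first by rewrite big_ord0.
  by rewrite big_ord_recr/= -natr1 lerD//; case: (_ <= x).
have full n : n%:R <= x -> \sum_(k < n) ((k.+1)%:R <= x)%R%:R = (n%:R : R).
  elim: n => [|n IH] nx; first by rewrite big_ord0.
  by rewrite big_ord_recr/= nx -natr1 IH//; apply: le_trans nx; rewrite ler_nat.
apply/andP; split; last first.
  clear xN; elim: N => [|n IH]; first by rewrite big_ord0.
  rewrite big_ord_recr/=; have [nx|xn] := leP (n.+1%:R) x; last by rewrite addr0.
  by rewrite -natr1 in nx; apply: le_trans nx; rewrite lerD2r; exact: up.
elim: N xN => [|n IH] xn; first by rewrite big_ord0; lra.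
rewrite big_ord_recr/=; have [xn'|nx] := leP x n%:R.
  by rewrite (le_trans (IH xn'))// lerDl.
move: xn; rewrite full ?(ltW nx)// -natr1 => xn.
by apply: (@le_trans _ _ n%:R); [lra|rewrite lerDl].
Qed.

(** The martingale hypothesis speaks of integrals over events; products with bounded adapted factors
    are what the bracket computations require. Indicators, then layer-cake sums, then bounded
    convergence. *)
Lemma ortho_adapted (C : set (set Omega)) (Y Z : Omega -> R) :
  C `<=` measurable -> bmeas Y ->
  (forall A, <<s C >> A -> (\int[P]_(w in A) Y w)%R = 0) ->
  adapted C Z -> Ex (fun w => Y w * Z w) = 0.
Proof.
move=> Cm bY Y0 aZ.
have bZ := adapted_bmeas Cm aZ.
have [mZ [K ZK]] := bZ.
have K0 : 0 <= K by apply: le_trans (ZK point).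
have Fm A : <<s C >> A -> measurable A.
  by apply: smallest_sub => //; exact: sigma_algebra_measurable.
have ind A : <<s C >> A -> Ex (fun w => Y w * \1_A w) = 0.
  move=> CA; rewrite -(Y0 A CA) /Ex [RHS]Rintegral_mkcond; apply: eq_Rintegral => w _.
  by rewrite patchE indicE; case: ifPn => _; rewrite ?mulr1 ?mulr0.
pose N n := (Num.truncn (2 * K * n.+1%:R)).+1.
pose A n k : set Omega := [set w | k.+1%:R <= n.+1%:R * (Z w + K)].
have CA n k : <<s C >> (A n k).
  have mf : measurable_fun [set: g_sigma_algebraType C] (fun w => n.+1%:R * (Z w + K)).
    apply: measurable_funM; first exact: measurable_cst.
    by apply: measurable_funD; [exact: aZ.1|exact: measurable_cst].
  have := mf measurableT `[k.+1%:R, +oo[%classic (measurable_itv _).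
  rewrite setTI; congr (<<s C >> _); apply/seteqP; split => w;
    by rewrite /A /= in_itv/= andbT.
(* Z + K takes values in [0, 2K] and is rounded down to a multiple of 1 / (n + 1), so [Zn] differs
   from Z by at most 1 / (n + 1). *)
pose Zn n w := n.+1%:R^-1 * (\sum_(k < N n) \1_(A n k) w) - K : R.
have bA n k : bmeas (\1_(A n k) : Omega -> R).
  split; first by apply: measurable_indic; exact: Fm.
  by exists 1 => w; rewrite indicE ger0_norm//; case: (_ \in _).
have EK : Ex (fun w => Y w * K) = 0.
  have CT : <<s C >> setT by exact: (@measurableT _ (g_sigma_algebraType C)).
  rewrite -[RHS](mulr0 K) -[in RHS](ind setT CT) -ExZ; last first.
    apply: bmeasM => //; split; first exact: measurable_indic.
    by exists 1 => w; rewrite indicE ger0_norm//; case: (_ \in _).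
  by apply: Ex_eq => w; rewrite indicE in_setT mulr1 mulrC.
have EZn n : Ex (fun w => Y w * Zn n w) = 0.
  have -> : (fun w => Y w * Zn n w) = (fun w => (\sum_(k < N n)
      n.+1%:R^-1 * (Y w * \1_(A n k) w)) - Y w * K).
    apply/funext => w; rewrite /Zn mulrBr mulrCA mulr_sumr mulr_sumr; congr (_ - _).
  rewrite ExB; last 2 first.
  - by apply: bmeas_sum => k; apply: bmeasM; [exact: bmeas_cst|exact: bmeasM].
  - by apply: bmeasM => //; exact: bmeas_cst.
  rewrite EK subr0 Ex_sum; last first.
    by move=> k; apply: bmeasM; [exact: bmeas_cst|exact: bmeasM].
  apply: big1 => k _; rewrite ExZ; last exact: bmeasM.
  by rewrite ind ?mulr0.
have [_ [L YL]] := bY.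
have L0 : 0 <= L by apply: le_trans (YL point).
have Zle n w : `|Z w - Zn n w| <= n.+1%:R^-1.
  have n0 : 0 < n.+1%:R :> R by rewrite ltr0n.
  have ZKw : 0 <= Z w + K <= 2 * K.
    by have := ZK w; rewrite ler_norml => /andP[? ?]; apply/andP; split; lra.
  have xN : 0 <= n.+1%:R * (Z w + K) <= (N n)%:R.
    case/andP: ZKw => z0 z1; rewrite mulr_ge0//= /N mulrC.
    apply: le_trans (ltW (truncnS_gt _)); by rewrite ler_wpM2r// ltW.
  have := floor_sum xN; have -> : \sum_(k < N n) (k.+1%:R <= n.+1%:R * (Z w + K))%R%:R
      = \sum_(k < N n) \1_(A n k) w :> R.
    apply: eq_bigr => k _; rewrite indicE; congr ((nat_of_bool _)%:R).
    by apply/idP/idP; rewrite inE.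
  rewrite /Zn; set S := \sum_(k < N n) _ => /andP[S1 S2].
  have -> : Z w - (n.+1%:R^-1 * S - K) = n.+1%:R^-1 * (n.+1%:R * (Z w + K) - S).
    by field; rewrite gt_eqF.
  rewrite normrM ger0_norm ?invr_ge0 ?(ltW n0)//.
  rewrite -[leRHS]mulr1 ler_wpM2l ?invr_ge0 ?(ltW n0)// ger0_norm; lra.
have bZn n : bmeas (Zn n).
  apply: bmeasB; last exact: bmeas_cst.
  by apply: bmeasM; [exact: bmeas_cst|exact: bmeas_sum].
have cvgZ : (fun n => Ex (fun w => Y w * Zn n w)) @ \oo --> Ex (fun w => Y w * Z w).
  apply: (Ex_cvg (K := L * (K + 1))).
  - by move=> n; apply: measurable_funM; [exact: bY.1|exact: (bZn n).1].
  - move=> n w; rewrite normrM ler_pM//.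
    have -> : Zn n w = Z w - (Z w - Zn n w) by ring.
    apply: le_trans (ler_normB _ _) _; apply: lerD => //.
    by apply: le_trans (Zle n w) _; rewrite invf_le1 ?ler1n ?ltr0n.
  - move=> w; apply: cvgM; first exact: cvg_cst.
    apply/cvgrPdist_le => e e0.
    have hh : \forall n \near \oo, n.+1%:R^-1 <= e.
      move/cvgrPdist_le : (@cvg_harmonic R) => /(_ e e0); apply: filterS => n.
      by rewrite sub0r normrN ger0_norm// invr_ge0.
    near=> n.
    apply: le_trans (Zle n w) _; near: n.
    exact: hh.
move: cvgZ; under eq_fun do rewrite EZn.
by move/cvg_unique => /(_ (@Rhausdorff R) _ (cvg_cst _)) ->.
Unshelve. all: by end_near.
Qed.

End filtered.

(** * Bounded martingales: discrete brackets and fourth moments *)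

Section bounded_martingales.
Context d (Omega : measurableType d) (R : realType) (P : probability Omega R).
Variable C : R -> set (set Omega).
Hypothesis Cm : forall t, C t `<=` measurable.
Hypothesis Cmono : forall s t, s <= t -> C s `<=` C t.
Local Notation Ex := (Ex P).
Local Notation adp t Z := (adapted (C t) Z).

Definition inc (X : R -> Omega -> R) s t (w : Omega) : R := X t w - X s w.

(** The martingale property as orthogonality of increments to the bounded past. Time runs over all
    of R, as shifted meshes may start before 0, where the processes vanish. *)
Definition bmart (M : R -> Omega -> R) := (forall t, adp t (M t)) /\
  forall s t Z, s <= t -> adp s Z -> Ex (fun w => inc M s t w * Z w) = 0.

Lemma adp_le s t (Z : Omega -> R) : s <= t -> adp s Z -> adp t Z.
Proof. by move=> st; apply: adapted_mono; exact: Cmono. Qed.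

Lemma adp_bmeas t (Z : Omega -> R) : adp t Z -> bmeas Z.
Proof. exact: adapted_bmeas. Qed.

Lemma inc_adp (M : R -> Omega -> R) s t : (forall t, adp t (M t)) -> s <= t -> adp t (inc M s t).
Proof. by move=> aM st; apply: bmeasB; [exact: (aM t)|exact: (adp_le st (aM s))]. Qed.

Section discrete.
Variable t_ : nat -> R.
Hypothesis t_S : forall k, t_ k <= t_ k.+1.
Variables M M' : R -> Omega -> R.
Hypotheses (bM : bmart M) (bM' : bmart M').

Let t_0 n : t_ 0 <= t_ n.
Proof. by elim: n => // n; move=> /le_trans; apply. Qed.

Let U n := inc M (t_ 0) (t_ n).
Let V n := inc M' (t_ 0) (t_ n).
Let dU n := inc M (t_ n) (t_ n.+1).
Let dV n := inc M' (t_ n) (t_ n.+1).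

Let aU n : adp (t_ n) (U n). Proof. exact: inc_adp bM.1 _. Qed.
Let aV n : adp (t_ n) (V n). Proof. exact: inc_adp bM'.1 _. Qed.
Let adU n : adp (t_ n.+1) (dU n). Proof. exact: inc_adp bM.1 _. Qed.
Let adV n : adp (t_ n.+1) (dV n). Proof. exact: inc_adp bM'.1 _. Qed.

(** In the product of two sums of increments the cross terms pair a new increment with the past, and
    have mean zero even after multiplication by Z. *)
Lemma discrete_bracket Z n : adp (t_ 0) Z ->
  Ex (fun w => U n w * V n w * Z w) = Ex (fun w => (\sum_(k < n) dU k w * dV k w) * Z w).
Proof.
move=> aZ; elim: n => [|n IH].
  by apply: Ex_eq => w; rewrite big_ord0 /U /inc subrr !mul0r.
have aZn m := adp_le (t_0 m) aZ.
have bS m : bmeas (fun w => \sum_(k < m) dU k w * dV k w).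
  by apply: bmeas_sum => k; apply: bmeasM; [exact: adp_bmeas (adU k)|exact: adp_bmeas (adV k)].
have bZ := adp_bmeas aZ.
have bU := adp_bmeas (aU n); have bV := adp_bmeas (aV n).
have bdU := adp_bmeas (adU n); have bdV := adp_bmeas (adV n).
have -> : (fun w => (\sum_(k < n.+1) dU k w * dV k w) * Z w) =
    (fun w => (\sum_(k < n) dU k w * dV k w) * Z w + dU n w * dV n w * Z w).
  by apply/funext => w; rewrite big_ord_recr/= mulrDl.
have bUVZ : bmeas (fun w => U n w * V n w * Z w) by apply: bmeasM => //; exact: bmeasM.
have bdUdVZ : bmeas (fun w => dU n w * dV n w * Z w) by apply: bmeasM => //; exact: bmeasM.
have bVZ : bmeas (fun w => V n w * Z w) by exact: bmeasM.
have bUZ : bmeas (fun w => U n w * Z w) by exact: bmeasM.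
rewrite ExD//; last exact: bmeasM.
have -> : (fun w => U n.+1 w * V n.+1 w * Z w) = (fun w => (U n w * V n w * Z w +
   dU n w * dV n w * Z w) + (dU n w * (V n w * Z w) + dV n w * (U n w * Z w))).
  by apply/funext => w; rewrite /U /V /dU /dV /inc; ring.
rewrite ExD; last 2 first.
- exact: bmeasD.
- by apply: bmeasD; exact: bmeasM.
rewrite ExD// IH; rewrite [X in _ + X]ExD; [|exact: bmeasM..].
rewrite (bM.2 _ _ _ (t_S n)); last by apply: bmeasM; [exact: aV|exact: aZn].
rewrite (bM'.2 _ _ _ (t_S n)); last by apply: bmeasM; [exact: aU|exact: aZn].
by rewrite !addr0.
Qed.

(* 16 U^2 Q + 19 Q^2 - U^4 is a submartingale, Q being the sum of the squared
   increments; its increment is a multiple of d plus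
   10 U^2 d^2 + 28 U d^3 + 34 d^4 + 54 Q d^2 >= 0. *)
Lemma discrete_fourth n :
  Ex (fun w => U n w ^+ 4) <= 294 * Ex (fun w => (\sum_(k < n) dU k w ^+ 2) ^+ 2).
Proof.
pose Q n w := \sum_(k < n) dU k w ^+ 2.
have Q0 m w : 0 <= Q m w by apply: sumr_ge0 => k _; exact: sqr_ge0.
have aQ m : adp (t_ m) (Q m).
  rewrite /Q; elim: m => [|m IH].
    by under eq_fun do rewrite big_ord0; exact: bmeas_cst.
  under eq_fun do rewrite big_ord_recr/=.
  by apply: bmeasD; [exact: adp_le (t_S m) IH|apply: bmeasX; exact: adU].
pose Phi m w := 16 * (U m w ^+ 2 * Q m w) + 19 * Q m w ^+ 2 - U m w ^+ 4.
have bPhi m : bmeas (Phi m).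
  have bU := adp_bmeas (aU m); have bQ := adp_bmeas (aQ m).
  apply: bmeasB; last exact: bmeasX.
  apply: bmeasD; (apply: bmeasM; first exact: bmeas_cst); last exact: bmeasX.
  by apply: bmeasM => //; exact: bmeasX.
have Phi0 m : 0 <= Ex (Phi m).
  elim: m => [|m IH].
    by apply: Ex_ge0 => w; rewrite /Phi /Q big_ord0 /U /inc subrr; lra.
  apply: (le_trans IH); rewrite -subr_ge0 -ExB//.
  have bU := aU m; have bQ := aQ m; have bdU := adp_bmeas (adU m).
  pose G w := 32 * (U m w * Q m w) - 4 * U m w ^+ 3.
  have aG : adp (t_ m) G.
    by apply: bmeasB; (apply: bmeasM; first exact: bmeas_cst); [exact: bmeasM|exact: bmeasX].
  have := bM.2 _ _ _ (t_S m) aG; rewrite -/(dU m) => dG0.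
  have bdG : bmeas (fun w => dU m w * G w).
    by apply: bmeasM => //; exact: adp_bmeas aG.
  rewrite -[leRHS]subr0 -[X in _ - X]dG0 -ExB//; last exact: bmeasB.
  apply: Ex_ge0 => w; rewrite /Phi /G.
  have -> : U m.+1 w = U m w + dU m w by rewrite /U /dU /inc; ring.
  have -> : Q m.+1 w = Q m w + dU m w ^+ 2 by rewrite /Q big_ord_recr.
  move: (U m w) (dU m w) (Q m w) (Q0 m w) => u e q q0.
  rewrite [X in 0 <= X](_ : _ = e ^+ 2 * (10 * (u + 7 / 5 * e) ^+ 2 + (72 / 5) * e ^+ 2 + 54 * q)); last by field.
  by rewrite mulr_ge0 ?sqr_ge0// !addr_ge0// mulr_ge0 ?sqr_ge0.
have bU := adp_bmeas (aU n); have bQ := adp_bmeas (aQ n).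
have bU4 : bmeas (fun w => U n w ^+ 4) by exact: bmeasX.
have bQ2 : bmeas (fun w => Q n w ^+ 2) by exact: bmeasX.
(* By 16 U^2 Q <= U^4 / 2 + 128 Q^2 the submartingale is at most 147 Q^2 - U^4 / 2, with 147 = 128 +
   19; hence the constant 294. *)
suff : 0 <= Ex (fun w => 147 * Q n w ^+ 2 - 2^-1 * U n w ^+ 4).
  rewrite ExB; [|by apply: bmeasM => //; exact: bmeas_cst..].
  by rewrite !ExZ//; set A := Ex _; set B := Ex _; lra.
apply: (le_trans (Phi0 n)); apply: Ex_le => //.
  by apply: bmeasB; apply: bmeasM => //; exact: bmeas_cst.
move=> w; rewrite /Phi -subr_ge0.
rewrite [X in 0 <= X](_ : _ = 2^-1 * (U n w ^+ 2 - 16 * Q n w) ^+ 2); last by field.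
by rewrite mulr_ge0// sqr_ge0.
Qed.

End discrete.

(** The intervals [s_r, t_r] follow one another, so each term is orthogonal to the sum of the
    earlier ones, which is known at time s_r. *)
Lemma Ex_sqr_sum_ortho (xi : nat -> Omega -> R) (s_ t_ : nat -> R) n :
  (forall r, adp (t_ r) (xi r)) ->
  (forall r Z, adp (s_ r) Z -> Ex (fun w => xi r w * Z w) = 0) ->
  (forall r, s_ r <= t_ r) -> (forall r, t_ r <= s_ r.+1) ->
  Ex (fun w => (\sum_(r < n) xi r w) ^+ 2) = \sum_(r < n) Ex (fun w => xi r w ^+ 2).
Proof.
move=> axi xi0 st ts.
have aS m : adp (s_ m) (fun w => \sum_(r < m) xi r w).
  elim: m => [|m IH].
    by under eq_fun do rewrite big_ord0; exact: bmeas_cst.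
  under eq_fun do rewrite big_ord_recr/=.
  by apply: bmeasD; [exact: adp_le (le_trans (st m) (ts m)) IH|exact: adp_le (ts m) (axi m)].
elim: n => [|n IH].
  by rewrite big_ord0 -[RHS](Ex_cst P 0); apply: Ex_eq => w; rewrite big_ord0 expr0n.
rewrite big_ord_recr/= -IH.
have bS := adp_bmeas (aS n); have bx := adp_bmeas (axi n).
have -> : (fun w => (\sum_(r < n.+1) xi r w) ^+ 2) = (fun w =>
  ((\sum_(r < n) xi r w) ^+ 2 + xi n w ^+ 2) + 2 * (xi n w * \sum_(r < n) xi r w)).
  by apply/funext => w; rewrite big_ord_recr/=; ring.
have bSx : bmeas (fun w => xi n w * \sum_(r < n) xi r w) by exact: bmeasM.
rewrite ExD; last 2 first.
- by apply: bmeasD; exact: bmeasX.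
- by apply: bmeasM => //; exact: bmeas_cst.
rewrite ExZ// xi0; last exact: aS.
by rewrite mulr0 addr0 ExD//; exact: bmeasX.
Qed.

Definition mesh s t (n k : nat) : R := s + (t - s) * (k%:R / n.+1%:R).

Lemma mesh0 s t n : mesh s t n 0 = s.
Proof. by rewrite /mesh mul0r mulr0 addr0. Qed.

Lemma meshn s t n : mesh s t n n.+1 = t.
Proof. by rewrite /mesh divff ?pnatr_eq0// mulr1 addrC subrK. Qed.

Lemma meshS s t n k : mesh s t n k.+1 - mesh s t n k = (t - s) / n.+1%:R.
Proof.
by rewrite /mesh -(natr1 k); move: (n.+1%:R^-1) => c; ring.
Qed.

Lemma mesh_le s t n k : s <= t -> mesh s t n k <= mesh s t n k.+1.
Proof. by move=> st; rewrite -subr_ge0 meshS divr_ge0// subr_ge0. Qed.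

(** * Brackets in continuous time as limits along refined meshes *)

Section point_process.
Variables (I : eqType) (M N : I -> R -> Omega -> R).
Hypothesis bM : forall i, bmart (M i).

Definition mesh_bracket i j s t n w : R := \sum_(k < n.+1)
  inc (M i) (mesh s t n k) (mesh s t n k.+1) w *
  inc (M j) (mesh s t n k) (mesh s t n k.+1) w.

Hypothesis bracket_cvg : forall i j s t w, s <= t ->
  mesh_bracket i j s t ^~ w @ \oo --> ((i == j)%:R * inc (N i) s t w : R).
Hypothesis bracket_bounded : forall i j s t, s <= t ->
  exists K : R, forall n w, `|mesh_bracket i j s t n w| <= K.

Let mesh_adp i s t n k : s <= t -> adp (mesh s t n k.+1) (inc (M i) (mesh s t n k) (mesh s t n k.+1)).
Proof. by move=> st; apply: inc_adp; [exact: (bM i).1|exact: mesh_le]. Qed.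

Let mesh_let s t n k : s <= t -> (k <= n.+1)%N -> mesh s t n k <= t.
Proof.
move=> st kn; rewrite /mesh -lerBrDl -[leRHS]mulr1 ler_wpM2l ?subr_ge0//.
by rewrite ler_pdivrMr ?ltr0n// mul1r ler_nat.
Qed.

Lemma mesh_bracket_adp i j s t n : s <= t -> adp t (mesh_bracket i j s t n).
Proof.
move=> st; apply: bmeas_sum => k; apply: bmeasM;
  apply: adp_le (mesh_adp _ _ _ st); exact: mesh_let.
Qed.

(** The jump process is the pathwise limit of the quadratic variations of the adapted process [M i],
    which is how its adaptedness is obtained. *)
Lemma point_inc_adp i s t : s <= t -> adp t (inc (N i) s t).
Proof.
move=> st; have [K HK] := @bracket_bounded i i s t st.
have cvg w := @bracket_cvg i i s t w st.
split.
  apply: (measurable_fun_cvg (fun n => (mesh_bracket_adp i i n st).1)) => w _.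
  by have := cvg w; rewrite eqxx mul1r.
exists K => w.
have h : (fun n => `|mesh_bracket i i s t n w|) @ \oo --> `|inc (N i) s t w|.
  by apply: cvg_norm; have := cvg w; rewrite eqxx mul1r.
by apply: (cvgr_to_le h); apply: nearW => n; exact: HK.
Qed.

(** By [discrete_bracket] the expectation of [mesh_bracket] times Z is the same for every mesh,
    while bounded convergence along refined meshes replaces the mesh bracket by its pathwise
    limit. *)
Lemma bracketE i j s t Z : s <= t -> adp s Z ->
  Ex (fun w => (inc (M i) s t w * inc (M j) s t w - (i == j)%:R * inc (N i) s t w) * Z w) = 0.
Proof.
move=> st aZ; have [K HK] := @bracket_bounded i j s t st.
have bZ := adp_bmeas aZ; have [_ [L ZL]] := bZ.
have bMi k : bmeas (inc (M k) s t).
  by apply: (@adp_bmeas t); apply: inc_adp => //; exact: (bM k).1.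
have bN : bmeas (inc (N i) s t) by apply: (@adp_bmeas t); exact: point_inc_adp.
have h : (fun n => Ex (fun w => mesh_bracket i j s t n w * Z w)) @ \oo -->
    Ex (fun w => (i == j)%:R * inc (N i) s t w * Z w).
  apply: (Ex_cvg (K := K * L)).
  - by move=> n; apply: measurable_funM; [exact: (adp_bmeas (mesh_bracket_adp i j n st)).1|exact: bZ.1].
  - by move=> n w; rewrite normrM ler_pM.
  - by move=> w; apply: cvgM; [exact: bracket_cvg|exact: cvg_cst].
have e n : Ex (fun w => mesh_bracket i j s t n w * Z w) =
    Ex (fun w => inc (M i) s t w * inc (M j) s t w * Z w).
  have aZ0 : adp (mesh s t n 0) Z by rewrite mesh0.
  have := discrete_bracket (fun k => mesh_le n k st) (bM i) (bM j) n.+1 aZ0.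
  by rewrite mesh0 meshn => ->.
move: h; under eq_fun do rewrite e.
move=> /cvg_unique => /(_ (@Rhausdorff R) _ (cvg_cst _)) ee.
under Ex_eq do rewrite mulrBl.
rewrite ExB; first by rewrite ee subrr.
  by apply: bmeasM => //; exact: bmeasM.
by apply: bmeasM; [apply: bmeasM; [exact: bmeas_cst|exact: bN]|exact: bZ].
Qed.

(** A Burkholder inequality of exponent 4: the squared increments in [discrete_fourth] add up, in
    the limit of fine meshes, to the number of points. *)
Lemma fourth_moment_le i s t : s <= t ->
  Ex (fun w => inc (M i) s t w ^+ 4) <= 294 * Ex (fun w => inc (N i) s t w ^+ 2).
Proof.
move=> st; have [K HK] := @bracket_bounded i i s t st.
have h : (fun n => Ex (fun w => mesh_bracket i i s t n w ^+ 2)) @ \oo -->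
    Ex (fun w => inc (N i) s t w ^+ 2).
  apply: (Ex_cvg (K := K ^+ 2)).
  - by move=> n; apply: measurable_funX; exact: (adp_bmeas (mesh_bracket_adp i i n st)).1.
  - move=> n w; rewrite normrX lerXn2r ?nnegrE//.
    by apply: le_trans (HK n w).
  - move=> w; have := @bracket_cvg i i s t w st; rewrite eqxx mul1r => c.
    by rewrite expr2; under eq_fun do rewrite expr2; exact: cvgM.
have h' : (fun n => 294 * Ex (fun w => mesh_bracket i i s t n w ^+ 2)) @ \oo -->
    294 * Ex (fun w => inc (N i) s t w ^+ 2).
  by apply: cvgM => //; exact: cvg_cst.
apply: (cvgr_to_ge h'); apply: nearW => n.
have := discrete_fourth (fun k => mesh_le n k st) (bM i) n.+1.
by rewrite mesh0 meshn => /le_trans; apply; apply: ler_wpM2l => //; exact: ler0n.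
Qed.

End point_process.

End bounded_martingales.

(** * Sums over mesh cells of products of martingale increments *)

Section product_sums.
Context d (Omega : measurableType d) (R : realType) (P : probability Omega R).
Variable C : R -> set (set Omega).
Hypothesis Cm : forall t, C t `<=` measurable.
Hypothesis Cmono : forall s t, s <= t -> C s `<=` C t.
Local Notation Ex := (Ex P).
Local Notation adp t Z := (adapted (C t) Z).
Variables (I : eqType) (M N : I -> R -> Omega -> R).

(* The M i are orthogonal martingales, and the bracket of M i is N i. *)
Definition orthogonal_system := [/\ forall i, bmart P C (M i),
  forall i s t, s <= t -> adp t (inc (N i) s t),
  forall i j s t Z, s <= t -> adp s Z ->
    Ex (fun w => (inc (M i) s t w * inc (M j) s t w - (i == j)%:R * inc (N i) s t w) * Z w) = 0 &
  forall i s t, s <= t ->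
    Ex (fun w => inc (M i) s t w ^+ 4) <= 294 * Ex (fun w => inc (N i) s t w ^+ 2)].

Hypothesis orth : orthogonal_system.

Let bM i : bmart P C (M i). Proof. by case: orth. Qed.
Let aN i s t : s <= t -> adp t (inc (N i) s t). Proof. by case: orth => _ h _ _; exact: h. Qed.
Let aM i s t : s <= t -> adp t (inc (M i) s t).
Proof. by move=> st; apply: inc_adp => //; exact: (bM i).1. Qed.
Let bN i s t : s <= t -> bmeas (inc (N i) s t).
Proof. by move=> st; apply: (adapted_bmeas (@Cm t)); exact: aN. Qed.
Let bMi i s t : s <= t -> bmeas (inc (M i) s t).
Proof. by move=> st; apply: (adapted_bmeas (@Cm t)); exact: aM. Qed.

Lemma sum_inc_sqr i (D lo hi : R) p : lo <= hi -> hi <= lo + D ->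
  Ex (fun w => (\sum_(r < p) inc (M i) (lo + r%:R * D) (hi + r%:R * D) w) ^+ 2) =
  \sum_(r < p) Ex (fun w => inc (N i) (lo + r%:R * D) (hi + r%:R * D) w).
Proof.
move=> lohi hiD.
have le r : lo + r%:R * D <= hi + r%:R * D :> R by rewrite lerD2r.
pose xi (r : nat) := inc (M i) (lo + r%:R * D) (hi + r%:R * D).
rewrite (@Ex_sqr_sum_ortho _ _ _ P C Cm Cmono xi (fun r => lo + r%:R * D)
  (fun r => hi + r%:R * D)).
- apply: eq_bigr => r _; have [_ _ br _] := orth.
  have := br i i _ _ (fun=> 1) (le r) (bmeas_cst _ 1); rewrite eqxx.
  under Ex_eq do rewrite mulr1 mul1r -expr2.
  rewrite ExB; [|exact/bmeasX/bMi|exact: bN].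
  by move/eqP; rewrite subr_eq0 => /eqP.
- by move=> r; exact: aM.
- by move=> r Z; apply: (bM i).2.
- exact: le.
- by move=> r; rewrite -(natr1 r) mulrDl mul1r; lra.
Qed.

Variables (D kappa : R).
Hypothesis N2 : forall i s t, s <= t -> t <= s + D ->
  Ex (fun w => inc (N i) s t w ^+ 2) <= kappa.

Let M4 i s t : s <= t -> t <= s + D -> Ex (fun w => inc (M i) s t w ^+ 4) <= 294 * kappa.
Proof.
move=> st tD; have [_ _ _ four] := orth; apply: le_trans (four i _ _ st) _.
by apply: ler_wpM2l; [exact: ler0n|exact: N2].
Qed.

Let shift_le (x y : R) (r : nat) : x <= y -> x + r%:R * D <= y + r%:R * D.
Proof. by move=> xy; rewrite lerD2r. Qed.

Let shift_leD (x y : R) (r : nat) : x <= y + D -> x + r%:R * D <= y + r%:R * D + D.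
Proof. by move=> xy; rewrite addrAC lerD2r. Qed.

Let shift_leS (x y : R) (r : nat) : x <= y + D -> x + r%:R * D <= y + r.+1%:R * D.
Proof. by move=> xy; rewrite -(natr1 r) mulrDl mul1r; lra. Qed.

(** In each cell the first factor is known before the second interval starts, so the products are
    themselves orthogonal to the past and their variances add. Each variance is controlled by (x
    y)^2 <= (x^4 + y^4) / 2. *)
Lemma prod_sum_ordered i j u1 u2 v1 v2 p : u1 <= u2 -> u2 <= u1 + D -> u2 <= v1 ->
  v1 <= v2 -> v2 <= v1 + D ->
  Ex (fun w => (\sum_(r < p) inc (M i) (u1 + r%:R * D) (u2 + r%:R * D) w *
      inc (M j) (v1 + r%:R * D) (v2 + r%:R * D) w) ^+ 2) <= p%:R * (294 * kappa).
Proof.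
move=> u12 u2D uv v12 v2D.
pose xi (r : nat) w := inc (M i) (u1 + r%:R * D) (u2 + r%:R * D) w *
      inc (M j) (v1 + r%:R * D) (v2 + r%:R * D) w.
rewrite (@Ex_sqr_sum_ortho _ _ _ P C Cm Cmono xi (fun r => v1 + r%:R * D)
  (fun r => v2 + r%:R * D)).
- rewrite mulr_natl -[X in _ *+ X](card_ord p) -sumr_const; apply: ler_sum => r _.
  have bm := bMi i (shift_le r u12); have bm' := bMi j (shift_le r v12).
  apply: (@le_trans _ _ (Ex (fun w => 2^-1 * inc (M i) (u1 + r%:R * D) (u2 + r%:R * D) w ^+ 4
     + 2^-1 * inc (M j) (v1 + r%:R * D) (v2 + r%:R * D) w ^+ 4))).
    apply: Ex_le.
    - by apply: bmeasX; exact: bmeasM.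
    - by apply: bmeasD; (apply: bmeasM; first exact: bmeas_cst); exact: bmeasX.
    move=> w; rewrite /xi -subr_ge0; set x := inc _ _ _ _; set y := inc _ _ _ _.
    rewrite [X in 0 <= X](_ : _ = 2^-1 * (x ^+ 2 - y ^+ 2) ^+ 2); last by field.
    by rewrite mulr_ge0// sqr_ge0.
  rewrite ExD; [|by apply: bmeasM; [exact: bmeas_cst|exact: bmeasX]..].
  rewrite !ExZ; [|exact: bmeasX..].
  have := M4 i (shift_le r u12) (shift_leD r u2D).
  have := M4 j (shift_le r v12) (shift_leD r v2D).
  by lra.
- move=> r; apply: bmeasM; last exact/aM/shift_le.
  apply: (adp_le Cmono _ (aM i (shift_le r u12))); apply: shift_le.
  exact: le_trans uv v12.
- move=> r Z aZ; rewrite -[RHS]((bM j).2 (v1 + r%:R * D) (v2 + r%:R * D)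
    (fun w => inc (M i) (u1 + r%:R * D) (u2 + r%:R * D) w * Z w)).
  + by apply: Ex_eq => w; rewrite /xi; ring.
  + exact: shift_le.
  + apply: bmeasM => //; apply: (adp_le Cmono _ (aM i (shift_le r u12))).
    exact: shift_le.
- by move=> r; exact: shift_le.
- by move=> r; exact: shift_leS.
Qed.

(** Over a common interval the product becomes orthogonal to the past once the bracket is
    subtracted. The bound (x y - n)^2 <= x^4 + y^4 + 2 n^2 gives 294 + 294 + 2 = 590. *)
Lemma prod_sum_diag i j lo hi p : lo <= hi -> hi <= lo + D ->
  Ex (fun w => (\sum_(r < p) (inc (M i) (lo + r%:R * D) (hi + r%:R * D) w *
      inc (M j) (lo + r%:R * D) (hi + r%:R * D) w -
      (i == j)%:R * inc (N i) (lo + r%:R * D) (hi + r%:R * D) w)) ^+ 2)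
  <= p%:R * (590 * kappa).
Proof.
move=> lohi hiD.
pose xi (r : nat) w := inc (M i) (lo + r%:R * D) (hi + r%:R * D) w *
      inc (M j) (lo + r%:R * D) (hi + r%:R * D) w -
      (i == j)%:R * inc (N i) (lo + r%:R * D) (hi + r%:R * D) w.
rewrite (@Ex_sqr_sum_ortho _ _ _ P C Cm Cmono xi (fun r => lo + r%:R * D)
  (fun r => hi + r%:R * D)).
- rewrite mulr_natl -[X in _ *+ X](card_ord p) -sumr_const; apply: ler_sum => r _.
  have bm := bMi i (shift_le r lohi); have bm' := bMi j (shift_le r lohi).
  have bn := bN i (shift_le r lohi).
  apply: (@le_trans _ _ (Ex (fun w => (inc (M i) (lo + r%:R * D) (hi + r%:R * D) w ^+ 4
     + inc (M j) (lo + r%:R * D) (hi + r%:R * D) w ^+ 4)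
     + 2 * inc (N i) (lo + r%:R * D) (hi + r%:R * D) w ^+ 2))).
    apply: Ex_le.
    - apply: bmeasX; apply: bmeasB; first exact: bmeasM.
      by apply: bmeasM; [exact: bmeas_cst|].
    - apply: bmeasD; first by apply: bmeasD; exact: bmeasX.
      by apply: bmeasM; [exact: bmeas_cst|exact: bmeasX].
    move=> w; rewrite /xi; set x := inc (M i) _ _ _; set y := inc (M j) _ _ _.
    set n := inc (N i) _ _ _.
    have h1 : (x * y - n) ^+ 2 <= 2 * (x * y) ^+ 2 + 2 * n ^+ 2.
      by rewrite -subr_ge0 [X in 0 <= X](_ : _ = (x * y + n) ^+ 2) ?sqr_ge0//; ring.
    have h2 : 2 * (x * y) ^+ 2 <= x ^+ 4 + y ^+ 4.
      by rewrite -subr_ge0 [X in 0 <= X](_ : _ = (x ^+ 2 - y ^+ 2) ^+ 2) ?sqr_ge0//; ring.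
    have h3 : 0 <= n ^+ 2 by exact: sqr_ge0.
    have h4 : 0 <= (x * y) ^+ 2 by exact: sqr_ge0.
    by case: (i == j); rewrite ?mul1r ?mul0r ?subr0; lra.
  rewrite ExD; last 2 first.
  - by apply: bmeasD; exact: bmeasX.
  - by apply: bmeasM; [exact: bmeas_cst|exact: bmeasX].
  rewrite ExD; [|exact: bmeasX..]; rewrite ExZ; last exact: bmeasX.
  have := M4 i (shift_le r lohi) (shift_leD r hiD).
  have := M4 j (shift_le r lohi) (shift_leD r hiD).
  have := N2 i (shift_le r lohi) (shift_leD r hiD).
  by lra.
- move=> r; apply: bmeasB; first by apply: bmeasM; exact/aM/shift_le.
  by apply: bmeasM; [exact: bmeas_cst|exact/aN/shift_le].
- move=> r Z aZ; have [_ _ br _] := orth; apply: br => //; exact: shift_le.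
- by move=> r; exact: shift_le.
- by move=> r; exact: shift_leS.
Qed.

(** The cells (a, a + D] and (b, b + D] overlap in (max a b, min a b + D]. The outer maximum makes
    this interval empty when the shifts are more than D apart. *)
Definition prod_sum_error i j (a b : R) p w : R :=
  \sum_(r < p) (inc (M i) (a + r%:R * D) (a + D + r%:R * D) w *
                inc (M j) (b + r%:R * D) (b + D + r%:R * D) w -
    (i == j)%:R * inc (N i) (Num.max a b + r%:R * D)
                 (Num.max (Num.max a b) (Num.min a b + D) + r%:R * D) w).

Hypothesis D0 : 0 < D.

(* With a <= b, cut (a, a + D] at min(b, a + D) into A and O, and (b, b + D]
   at max(b, a + D) into O' and B. Either O = O' or both are empty, A precedes
   (b, b + D] and O precedes B. *)
Lemma prod_sum_error_le_ordered i j a b p : a <= b ->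
  Ex (fun w => prod_sum_error i j a b p w ^+ 2) <= p%:R * (4000 * kappa).
Proof.
move=> ab.
pose c := Num.min b (a + D); pose e := Num.max b (a + D).
have cb : c <= b by rewrite ge_min lexx.
have ac : a <= c by rewrite le_min ab lerDl ltW.
have caD : c <= a + D by rewrite ge_min lexx orbT.
have be : b <= e by rewrite le_max lexx.
have aDe : a + D <= e by rewrite le_max lexx orbT.
have ebD : e <= b + D by rewrite ge_max lerDl (ltW D0) lerD2r.
pose S1 w := \sum_(r < p) inc (M i) (a + r%:R * D) (c + r%:R * D) w *
      inc (M j) (b + r%:R * D) (b + D + r%:R * D) w.
pose S2 w := \sum_(r < p) (inc (M i) (b + r%:R * D) (e + r%:R * D) w *
      inc (M j) (b + r%:R * D) (e + r%:R * D) w -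
      (i == j)%:R * inc (N i) (b + r%:R * D) (e + r%:R * D) w).
pose S3 w := \sum_(r < p) inc (M i) (c + r%:R * D) (a + D + r%:R * D) w *
      inc (M j) (e + r%:R * D) (b + D + r%:R * D) w.
have E1 : Ex (fun w => S1 w ^+ 2) <= p%:R * (294 * kappa).
  by apply: prod_sum_ordered => //; lra.
have E2 : Ex (fun w => S2 w ^+ 2) <= p%:R * (590 * kappa).
  by apply: prod_sum_diag.
have E3 : Ex (fun w => S3 w ^+ 2) <= p%:R * (294 * kappa).
  by apply: prod_sum_ordered => //; lra.
have split w : prod_sum_error i j a b p w = S1 w + S2 w + S3 w.
  rewrite /prod_sum_error /S1 /S2 /S3 -!big_split/=; apply: eq_bigr => r _.
  rewrite (max_r ab) (min_l ab) -/e.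
  rewrite /c /e; have [baD|aDb] := leP b (a + D); rewrite /inc; ring.
have bS1 : bmeas S1.
  by apply: bmeas_sum => r; apply: bmeasM; apply/bMi/shift_le => //; lra.
have bS3 : bmeas S3.
  by apply: bmeas_sum => r; apply: bmeasM; apply/bMi/shift_le => //; lra.
have bS2 : bmeas S2.
  apply: bmeas_sum => r; apply: bmeasB; first by apply: bmeasM; exact/bMi/shift_le.
  by apply: bmeasM; [exact: bmeas_cst|exact/bN/shift_le].
(* (x + y + z)^2 <= 3 (x^2 + y^2 + z^2), and 3 (294 + 590 + 294) = 3534, rounded up to 4000. *)
apply: (@le_trans _ _ (Ex (fun w => 3 * S1 w ^+ 2 + 3 * S2 w ^+ 2 + 3 * S3 w ^+ 2))).
  apply: Ex_le.
  - by under eq_fun do rewrite split; apply: bmeasX; apply: bmeasD => //; exact: bmeasD.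
  - apply: bmeasD; [apply: bmeasD|]; by apply: bmeasM; [exact: bmeas_cst|exact: bmeasX].
  move=> w; rewrite split; move: (S1 w) (S2 w) (S3 w) => x y z.
  rewrite -subr_ge0 [X in 0 <= X](_ : _ =
    (x - y) ^+ 2 + (y - z) ^+ 2 + (x - z) ^+ 2); last by ring.
  by rewrite !addr_ge0// sqr_ge0.
rewrite ExD; last 2 first.
- by apply: bmeasD; apply: bmeasM; [exact: bmeas_cst|exact: bmeasX|exact: bmeas_cst|exact: bmeasX].
- by apply: bmeasM; [exact: bmeas_cst|exact: bmeasX].
rewrite ExD; [|by apply: bmeasM; [exact: bmeas_cst|exact: bmeasX]..].
rewrite !ExZ; [|exact: bmeasX..].
have k0 : 0 <= p%:R * kappa.
  rewrite mulr_ge0//; apply: le_trans (N2 i (lexx 0) _); last by rewrite add0r ltW.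
  by apply: Ex_ge0 => w; exact: sqr_ge0.
by move: E1 E2 E3 k0; rewrite !(mulrCA p%:R); move: (p%:R * kappa) => q; lra.
Qed.

End product_sums.

Section product_sums_sym.
Context d (Omega : measurableType d) (R : realType) (P : probability Omega R).
Variable C : R -> set (set Omega).
Hypothesis Cm : forall t, C t `<=` measurable.
Hypothesis Cmono : forall s t, s <= t -> C s `<=` C t.
Variables (I : eqType) (M N : I -> R -> Omega -> R).
Hypothesis orth : orthogonal_system P C M N.

Lemma prod_sum_error_le D kappa i j a b p : 0 < D ->
  (forall i s t, s <= t -> t <= s + D -> Ex P (fun w => inc (N i) s t w ^+ 2) <= kappa) ->
  Ex P (fun w => prod_sum_error M N D i j a b p w ^+ 2) <= p%:R * (4000 * kappa).
Proof.
move=> D0 N2; have [ab|/ltW ba] := leP a b.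
  exact: (prod_sum_error_le_ordered Cm Cmono orth N2).
have := prod_sum_error_le_ordered Cm Cmono orth N2 D0 j i p ba.
congr (_ <= _); apply: Ex_eq => w; congr (_ ^+ 2); apply: eq_bigr => r _.
rewrite maxC minC mulrC; congr (_ - _).
by rewrite (eq_sym i j); have [->//|_] := eqVneq j i; rewrite !mul0r.
Qed.

End product_sums_sym.

(** * Invariance of Lebesgue measure and averages against a kernel *)

Section lebesgue_invariance.
Context (R : realType).
Local Notation leb := (@lebesgue_measure R).
Local Open Scope ereal_scope.

Let preserved (phi : R -> R) : measurable_fun setT (phi : measurableTypeR R -> measurableTypeR R) ->
  (forall A, measurable A -> pushforward leb (phi : _ -> measurableTypeR R) A = leb A) ->
  forall f : R -> \bar R, measurable_fun setT f -> (forall x, 0 <= f x) ->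
  \int[leb]_x f (phi x) = \int[leb]_x f x.
Proof.
move=> mphi pres f mf f0.
rewrite -[RHS](@eq_measure_integral _ _ _ _ _ (pushforward leb (phi : _ -> measurableTypeR R))).
  by rewrite ge0_integral_pushforward.
by move=> A mA _; exact: pres.
Qed.

Lemma integral_shift (f : R -> \bar R) (a : R) : measurable_fun setT f ->
  (forall x, 0 <= f x) -> \int[leb]_x f (x + a)%R = \int[leb]_x f x.
Proof.
have mphi : measurable_fun setT ((fun x => x + a)%R : measurableTypeR R -> measurableTypeR R).
  by apply: measurable_funD => //; exact: measurable_cst.
apply: (preserved mphi) => A mA.
apply/esym/(@lebesgue_measure_unique R (pushforward leb ((fun x => x + a)%R : measurableTypeR R -> measurableTypeR R))) => //= _ [[b c]] _ <-.
rewrite /pushforward (_ : _ @^-1` _ = `](b - a)%R, (c - a)%R]%classic).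
  rewrite !lebesgue_measure_itv/= !lte_fin ltrD2r.
  by case: ifP => // _; rewrite -!EFinB; congr EFin; ring.
by apply/seteqP; split => x /=; rewrite !in_itv/= ltrBlDr lerBrDr.
Qed.

Lemma integral_reflect (f : R -> \bar R) : measurable_fun setT f ->
  (forall x, 0 <= f x) -> \int[leb]_x f (- x)%R = \int[leb]_x f x.
Proof.
apply: preserved; last by move=> A mA; exact: lebesgue_measureN.
exact: measurable_funN.
Qed.

Lemma integral_sub (f : R -> \bar R) (a : R) : measurable_fun setT f ->
  (forall x, 0 <= f x) -> \int[leb]_x f (a - x)%R = \int[leb]_x f x.
Proof.
move=> mf f0; rewrite -[RHS](integral_shift a mf f0).
under eq_integral do rewrite addrC.
rewrite (integral_reflect (f := fun x => f (x + a)%R))//.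
by apply: (measurableT_comp mf); apply: measurable_funD => //; exact: measurable_cst.
Qed.

End lebesgue_invariance.

Section weighted_mean.
Context (R : realType).
Local Notation leb := (@lebesgue_measure R).
Variables (k : R -> R) (H : R).
Hypotheses (k0 : forall s, 0 <= k s) (mk : measurable_fun setT k).
Hypothesis (kH : (\int[leb]_s (k s)%:E = H%:E)%E).

Definition wint (f : R -> R) : R := (\int[leb]_s (k s * f s))%R.

Lemma weight_integrable : leb.-integrable setT (fun s => (k s)%:E).
Proof.
apply/integrableP; split; first exact: measurable_EFinT.
under eq_integral do rewrite gee0_abs ?lee_fin//.
by rewrite kH ltry.
Qed.

Lemma wint_integrable f : bmeas f -> leb.-integrable setT (fun s => (k s * f s)%:E).
Proof.
move=> [mf [K fK]].
have K0 : 0 <= K by apply: le_trans (fK 0).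
have iK : leb.-integrable setT (fun s => (K%:E * (k s)%:E)%E).
  by apply: integrableZl => //; exact: weight_integrable.
apply: (le_integrable _ _ _ iK) => //.
  by apply: measurable_EFinT; exact: measurable_funM.
move=> s _; rewrite -EFinM !abse_EFin lee_fin !normrM mulrC (ger0_norm (k0 s)).
by rewrite ler_wpM2r// (ger0_norm K0).
Qed.

Lemma wint_EFin f : bmeas f -> (wint f)%:E = (\int[leb]_s (k s * f s)%:E)%E.
Proof.
move=> bf; rewrite fineK//.
exact: (integrable_fin_num measurableT (wint_integrable bf)).
Qed.

Lemma wintD f f' : bmeas f -> bmeas f' -> wint (fun s => f s + f' s) = wint f + wint f'.
Proof.
move=> bf bf'; rewrite /wint -RintegralD//; [|exact: wint_integrable..].
by apply: eq_Rintegral => s _; rewrite mulrDr.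
Qed.

Lemma wintB f f' : bmeas f -> bmeas f' -> wint (fun s => f s - f' s) = wint f - wint f'.
Proof.
move=> bf bf'; rewrite /wint -RintegralB//; [|exact: wint_integrable..].
by apply: eq_Rintegral => s _; rewrite mulrBr.
Qed.

Lemma wintZ c f : bmeas f -> wint (fun s => c * f s) = c * wint f.
Proof.
move=> bf; rewrite /wint -RintegralZl//; last exact: wint_integrable.
by apply: eq_Rintegral => s _; rewrite mulrCA.
Qed.

Lemma wint_cst c : wint (fun=> c) = c * H.
Proof.
apply: EFin_inj; rewrite wint_EFin; last exact: bmeas_cst.
rewrite EFinM -kH; under eq_integral do rewrite mulrC EFinM.
by rewrite integralZl//; exact: weight_integrable.
Qed.

Lemma wint_sum (I : Type) (r : seq I) (F : I -> R -> R) : (forall i, bmeas (F i)) ->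
  wint (fun s => \sum_(i <- r) F i s) = \sum_(i <- r) wint (F i).
Proof.
move=> bF; elim: r => [|i r IH].
  rewrite big_nil (_ : (fun s => _) = fun=> 0); first by rewrite wint_cst mul0r.
  by apply/funext => s; rewrite big_nil.
rewrite big_cons -IH -wintD//; last exact: bmeas_sum.
by congr wint; apply/funext => s; rewrite big_cons.
Qed.

(** The comparison is asked only where the kernel charges: the Hawkes kernels vanish outside
    positive lags, so only the past of the integrand has to be controlled. *)
Lemma wint_le f f' : bmeas f -> bmeas f' -> (forall s, k s != 0 -> f s <= f' s) ->
  wint f <= wint f'.
Proof.
move=> bf bf' ff'; apply: le_Rintegral => //; [exact: wint_integrable..|].
move=> s _; have [->|ks] := eqVneq (k s) 0; first by rewrite !mul0r.
by rewrite ler_wpM2l// ff'.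
Qed.

Lemma wint_ge0 f : (forall s, k s != 0 -> 0 <= f s) -> 0 <= wint f.
Proof.
move=> f0; apply: Rintegral_ge0 => s _.
by have [->|ks] := eqVneq (k s) 0; rewrite ?mul0r// mulr_ge0// f0.
Qed.

Lemma wint_norm_le f : bmeas f -> ((`|wint f|)%:E <= \int[leb]_s (k s * `|f s|)%:E)%E.
Proof.
move=> bf; have [mf _] := bf; have ikf := wint_integrable bf.
rewrite -abse_EFin wint_EFin//; apply: le_trans (le_abse_integral _ measurableT _) _.
  by case/integrableP: ikf.
rewrite le_eqVlt; apply/orP; left; apply/eqP; apply: eq_integral => s _.
by rewrite abse_EFin normrM (ger0_norm (k0 s)).
Qed.

(** Absolute continuity of the integral, uniform in the location of the interval. It makes the
    compensators continuous with a modulus independent of the outcome. *)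
Lemma weight_modulus (e : R) : 0 < e -> exists2 dl : R, 0 < dl &
  forall a b, a <= b -> b - a < dl -> wint (fun x => (a < x <= b)%R%:R) <= e.
Proof.
move=> e0; have [dl [dl0 Hdl]] := integral_normr_continuous weight_integrable e0.
exists dl => // a b ab bdl.
have mI : measurable (`]a, b]%classic : set R) by exact: measurable_itv.
have lI : (leb `]a, b]%classic < dl%:E)%E.
  rewrite lebesgue_measure_itv/= lte_fin; case: ifP => _; last by rewrite lte_fin.
  by rewrite -EFinB lte_fin.
apply: ltW; have := Hdl _ mI lI; apply: le_lt_trans.
rewrite [leRHS]Rintegral_mkcond le_eqVlt; apply/orP; left; apply/eqP.
apply: eq_Rintegral => x _; rewrite patchE mem_setE in_itv/= (ger0_norm (k0 x)).
by case: ifP => _; rewrite ?mulr1 ?mulr0.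
Qed.

End weighted_mean.

(** * Cross variations of jump paths minus continuous compensators *)

Section mesh_paths.
Context (R : realType).

Lemma sum_mesh (f : R -> R) s t n :
  \sum_(k < n.+1) (f (mesh s t n k.+1) - f (mesh s t n k)) = f t - f s.
Proof.
rewrite -(big_mkord xpredT (fun k => f (mesh s t n k.+1) - f (mesh s t n k))).
by rewrite telescope_sumr// meshn mesh0.
Qed.

Lemma mesh_fine (s t dl : R) : s <= t -> 0 < dl -> \forall n \near \oo, (t - s) / n.+1%:R < dl.
Proof.
move=> st dl0.
have /cvgrPdist_lt/(_ dl dl0) : (fun n => (t - s) * (@harmonic R n)) @ \oo --> (t - s) * 0.
  by apply: cvgM; [exact: cvg_cst|exact: cvg_harmonic].
apply: filterS => n; rewrite mulr0 sub0r normrN ger0_norm//.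
by rewrite mulr_ge0 ?subr_ge0// invr_ge0.
Qed.

Variables (ni nj ai aj : R -> R).
Hypothesis ni_nd : {homo ni : x y / x <= y}.
Hypothesis nj_nd : {homo nj : x y / x <= y}.
Hypothesis ai_nd : {homo ai : x y / x <= y}.
Hypothesis aj_nd : {homo aj : x y / x <= y}.

Definition mesh_cross s t n : R := \sum_(k < n.+1)
  ((ni (mesh s t n k.+1) - ai (mesh s t n k.+1)) - (ni (mesh s t n k) - ai (mesh s t n k))) *
  ((nj (mesh s t n k.+1) - aj (mesh s t n k.+1)) - (nj (mesh s t n k) - aj (mesh s t n k))).

(** On fine meshes a cell contains at most one point, so the products of jumps sum exactly to c
    (n(t) - n(s)). Every other product has an increment of a compensator as a factor, at most e / K,
    and the remaining factors have total variation at most K. *)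
Lemma mesh_cross_cvg s t c : s <= t ->
  (exists2 dl, 0 < dl & forall u v, u <= v -> v - u < dl ->
    (ni v - ni u) * (nj v - nj u) = c * (ni v - ni u)) ->
  (forall e, 0 < e -> exists2 dl, 0 < dl & forall u v, u <= v -> v - u < dl ->
    ai v - ai u <= e /\ aj v - aj u <= e) ->
  mesh_cross s t @ \oo --> c * (ni t - ni s).
Proof.
move=> st [dl dl0 sep] mod; apply/cvgrPdist_le => e e0.
pose K := (ni t - ni s) + (nj t - nj s) + (aj t - aj s) + 1.
have K0 : 0 < K.
  by rewrite /K; move: (ni_nd st) (nj_nd st) (aj_nd st); lra.
have [dl' dl'0 mode] := mod _ (divr_gt0 e0 K0).
apply: filterS2 (mesh_fine st dl0) (mesh_fine st dl'0) => n ndl ndl'.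
rewrite distrC -(sum_mesh _ _ _ n) mulr_sumr /mesh_cross -sumrB.
apply: le_trans (ler_norm_sum _ _ _) _.
apply: (@le_trans _ _ (\sum_(k < n.+1) (e / K * ((ni (mesh s t n k.+1) - ni (mesh s t n k)) +
  (nj (mesh s t n k.+1) - nj (mesh s t n k)) + (aj (mesh s t n k.+1) - aj (mesh s t n k)))))); last first.
  rewrite -mulr_sumr big_split/= big_split/= !sum_mesh mulrAC ler_pdivrMr// ler_pM2l// /K.
  by rewrite lerDl.
apply: ler_sum => k _; have uv := mesh_le n k st.
have vu : mesh s t n k.+1 - mesh s t n k < dl by rewrite meshS.
have [] := mode _ _ uv (_ : mesh s t n k.+1 - mesh s t n k < dl'); first by rewrite meshS.
have := sep _ _ uv vu.
move: (mesh s t n k) (mesh s t n k.+1) uv {vu} => u v uv.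
have : 0 <= ni v - ni u by rewrite subr_ge0 ni_nd.
have : 0 <= nj v - nj u by rewrite subr_ge0 nj_nd.
have : 0 <= ai v - ai u by rewrite subr_ge0 ai_nd.
have : 0 <= aj v - aj u by rewrite subr_ge0 aj_nd.
rewrite (_ : ni v - ai v - (ni u - ai u) = (ni v - ni u) - (ai v - ai u)); last by ring.
rewrite (_ : nj v - aj v - (nj u - aj u) = (nj v - nj u) - (aj v - aj u)); last by ring.
have e1 : 0 < e / K by exact: divr_gt0.
move: (e / K) e1 (ni v - ni u) (nj v - nj u) (ai v - ai u) (aj v - aj u).
move=> q q0 x y a b b0 a0 y0 x0 xy aq bq.
rewrite mulrBl !mulrBr xy.
have h1 : 0 <= x * b <= q * x by rewrite mulr_ge0// mulrC ler_wpM2r.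
have h2 : 0 <= a * y <= q * y by rewrite mulr_ge0// ler_wpM2r.
have h3 : 0 <= a * b <= q * b by rewrite mulr_ge0// ler_wpM2r.
by rewrite ler_norml; lra.
Qed.

Lemma mesh_cross_bounded s t n : s <= t ->
  `|mesh_cross s t n| <= (ni t - ni s + (ai t - ai s)) * (nj t - nj s + (aj t - aj s)).
Proof.
move=> st; apply: le_trans (ler_norm_sum _ _ _) _.
pose x (k : nat) := ni (mesh s t n k.+1) - ni (mesh s t n k) + (ai (mesh s t n k.+1) - ai (mesh s t n k)).
pose y (k : nat) := nj (mesh s t n k.+1) - nj (mesh s t n k) + (aj (mesh s t n k.+1) - aj (mesh s t n k)).
have uv k : mesh s t n k <= mesh s t n k.+1 by exact: mesh_le.
have x0 k : 0 <= x k by rewrite addr_ge0// subr_ge0; [exact: ni_nd|exact: ai_nd].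
have y0 k : 0 <= y k by rewrite addr_ge0// subr_ge0; [exact: nj_nd|exact: aj_nd].
have -> : ni t - ni s + (ai t - ai s) = \sum_(k < n.+1) x k by rewrite big_split/= !sum_mesh.
have -> : nj t - nj s + (aj t - aj s) = \sum_(k < n.+1) y k by rewrite big_split/= !sum_mesh.
rewrite mulr_suml; apply: ler_sum => k _; rewrite normrM ler_pM//.
  have := uv k; rewrite /x; move: (mesh s t n k) (mesh s t n k.+1) => u v h.
  have : ni u <= ni v by exact: ni_nd.
  have : ai u <= ai v by exact: ai_nd.
  by rewrite ler_norml; lra.
apply: (@le_trans _ _ (y k)); last first.
  by rewrite (bigD1 k)//= lerDl sumr_ge0.
have := uv k; rewrite /y; move: (mesh s t n k) (mesh s t n k.+1) => u v h.
have : nj u <= nj v by exact: nj_nd.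
have : aj u <= aj v by exact: aj_nd.
by rewrite ler_norml; lra.
Qed.

End mesh_paths.

(** * Paths and moments of the Hawkes process *)

Lemma measurable_nneseriesT d (T : measurableType d) (R : realType) (D : set T)
  (f : nat -> T -> \bar R) : (forall n x, (0 <= f n x)%E) ->
  (forall n, measurable_fun D (f n)) ->
  measurable_fun D (fun x => \sum_(0 <= n <oo) f n x)%E.
Proof.
move=> f0 mf.
have := @ge0_emeasurable_sum _ T R D f xpredT (fun k x _ _ => f0 k x) (fun k _ => mf k).
by apply: eq_measurable_fun => x _; apply: eq_eseriesl.
Qed.

Section positive_part.
Context (R : realType).
Local Notation leb := (@lebesgue_measure R).
Variable f : R -> R.
Hypothesis f_ge0 : forall t, 0 <= t -> 0 <= f t.
Hypothesis f_int : leb.-integrable `[0, +oo[ (EFin \o f).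

(** The value at lag 0 is set to 0: the intensity integrates over the open interval (0, t), so that
    a point does not contribute at its own time. *)
Definition kpos (t : R) : R := if 0 < t then f t else 0.

Lemma kpos_ge0 t : 0 <= kpos t.
Proof. by rewrite /kpos; case: ltP => // /ltW; exact: f_ge0. Qed.

Lemma kpos_neg t : t < 0 -> kpos t = 0.
Proof. by move=> t0; rewrite /kpos ltNge (ltW t0). Qed.

Let kposE : kpos = f \_ `]0, +oo[.
Proof. by apply/funext => t; rewrite /kpos patchE mem_setE in_itv/= andbT. Qed.

Let f_int' : leb.-integrable `]0, +oo[ (EFin \o f).
Proof.
apply: integrableS f_int => //.
by move=> t /=; rewrite !in_itv/= !andbT => /ltW.
Qed.

Lemma measurable_kpos : measurable_fun setT kpos.
Proof.
rewrite kposE; apply/(measurable_restrictT _ _).1 => //.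
by apply/measurable_EFinP; exact: (measurable_int _ f_int').
Qed.

Lemma integral_kpos : (\int[leb]_s (kpos s)%:E = (normL1 f)%:E)%E.
Proof.
rewrite /normL1 -Rintegral_itv_obnd_cbnd; last exact: f_int'.
rewrite /Rintegral fineK; last first.
  by apply: integrable_fin_num f_int'; exact: measurable_itv.
rewrite [RHS]integral_mkcond; apply: eq_integral => s _.
by rewrite kposE !patchE; case: ifP.
Qed.

End positive_part.

Section hawkes_paths.
Context d (Omega : measurableType d) (R : realType) (P : probability Omega R).
Local Notation leb := (@lebesgue_measure R).
Variables (g h : R -> R).
Hypothesis g_ge0 : forall t, 0 <= t -> 0 <= g t.
Hypothesis h_ge0 : forall t, 0 <= t -> 0 <= h t.
Hypothesis g_int : leb.-integrable `[0, +oo[ (EFin \o g).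
Hypothesis h_int : leb.-integrable `[0, +oo[ (EFin \o h).
Variables (mu : 'I_4 -> R) (mu_ge0 : forall i, 0 <= mu i).
Variables (tm : nat -> Omega -> \bar R) (mk : nat -> Omega -> 'I_4).

(** Each row of the kernel matrix has one nonzero entry; it sits in column [partner i] and equals
    [kbase i]. The map is an involution, which is the loop of the contraction. *)
Definition partner (i : 'I_4) : 'I_4 :=
  match val i with 0%N => comp3 | 1%N => comp4 | 2%N => comp1 | _ => comp2 end.
Definition kbase (i : 'I_4) : R -> R := if (val i < 2)%N then h else g.
Definition ker i := kpos (kbase i).
Definition mass i : R := normL1 (kbase i).

Lemma kernel4E i j : kernel4 g h i j = if j == partner i then kbase i else fun=> 0.
Proof.
by case: i => [[|[|[|[|//]]]] ?]; case: j => [[|[|[|[|//]]]] ?].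
Qed.

Lemma kbase_ge0 i t : 0 <= t -> 0 <= kbase i t.
Proof. by rewrite /kbase; case: ifP => _; [exact: h_ge0|exact: g_ge0]. Qed.

Lemma kbase_int i : leb.-integrable `[0, +oo[ (EFin \o kbase i).
Proof. by rewrite /kbase; case: ifP. Qed.

Lemma ker_ge0 i t : 0 <= ker i t.
Proof. exact/kpos_ge0/kbase_ge0. Qed.

Lemma measurable_ker i : measurable_fun setT (ker i).
Proof. exact: (measurable_kpos (kbase_int i)). Qed.

Lemma integral_ker i : (\int[leb]_s (ker i s)%:E = (mass i)%:E)%E.
Proof. exact: (integral_kpos (kbase_int i)). Qed.

Lemma ker_neq0 i s : ker i s != 0 -> 0 < s.
Proof. by rewrite /ker /kpos; case: ltP => // _; rewrite eqxx. Qed.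

Hypothesis mpts : marked_points tm mk.

Let tm_meas n : measurable_fun setT (tm n). Proof. by case: mpts. Qed.
Let mk_meas n i : measurable (mk n @^-1` [set i]). Proof. by case: mpts. Qed.
Let tm_gt0 n w : (0 < tm n w)%E. Proof. by case: mpts. Qed.
Let tm_nd n w : (tm n w <= tm n.+1 w)%E. Proof. by case: mpts. Qed.
Let tm_inc n w : (tm n w < +oo)%E -> (tm n w < tm n.+1 w)%E.
Proof. by case: mpts => _ _ _ _ tinc; exact: tinc. Qed.

Lemma tm_le n m w : (n <= m)%N -> (tm n w <= tm m w)%E.
Proof.
by move=> /subnKC <-; elim: (m - n)%N => [|k IH]; rewrite ?addn0// addnS (le_trans IH).
Qed.

Lemma tm_fin n w : (tm n w < +oo)%E -> tm n w = (fine (tm n w))%:E.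
Proof. by move=> tn; rewrite fineK// gt0_fin_numE. Qed.

Local Notation CN := (counting_process tm mk).

Definition point_intensity i w n s : \bar R :=
  if (tm n w < +oo)%E && (mk n w == partner i) then (ker i (s - fine (tm n w)))%:E else 0%E.

Lemma point_intensity_ge0 i w n s : (0 <= point_intensity i w n s)%E.
Proof. by rewrite /point_intensity; case: ifP => // _; rewrite lee_fin ker_ge0. Qed.

(** The jump measure is a series of Dirac masses, hence a sum over points; the restriction to (0, s)
    is absorbed by [kpos] and by the positivity of the times. *)
Lemma intensityE i s w : intensity tm mk mu (kernel4 g h) i s w =
  ((mu i)%:E + \sum_(0 <= n <oo) point_intensity i w n s)%E.
Proof.
rewrite /intensity; congr (_ + _)%E.
rewrite (bigD1 (partner i))//= [X in (_ + X)%E]big1 ?adde0; last first.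
  move=> j /negPf ji; rewrite kernel4E ji.
  by rewrite [LHS]integral0_eq.
rewrite kernel4E eqxx /jump_measure.
have mf : measurable_fun (`]0, s[%classic : set R) (fun u => (kbase i (s - u))%:E).
  have mker : measurable_fun (`]0, s[%classic : set R) (fun u => (ker i (s - u))%:E).
    apply: measurable_funTS; apply: measurable_EFinT.
    apply: (measurableT_comp (measurable_ker i)).
    by apply: measurable_funB; [exact: measurable_cst|exact: measurable_id].
  apply: eq_measurable_fun mker => u; rewrite inE/= in_itv/= => /andP[_ us].
  by rewrite /ker /kpos subr_gt0 us.
have f0 u : (`]0, s[%classic : set R) u -> (0 <= (kbase i (s - u))%:E)%E.
  by rewrite /= in_itv/= => /andP[_ us]; rewrite lee_fin kbase_ge0// subr_ge0 ltW.
rewrite ge0_integral_measure_series//.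
apply: eq_eseriesr => n _; rewrite /point_intensity; case: ifPn => [|_]; last first.
  by rewrite integral_measure_zero.
move=> /andP[tn _]; rewrite integral_dirac//.
rewrite diracE mem_setE in_itv/=.
have t0 : 0 < fine (tm n w) by rewrite -lte_fin -tm_fin.
rewrite t0/= /ker /kpos subr_gt0; case: ifP => _; first by rewrite mul1e.
by rewrite mul0e.
Qed.

Lemma measurable_point_intensity i w n : measurable_fun setT (point_intensity i w n).
Proof.
rewrite /point_intensity; case: ((_ < _)%E && _); last exact: measurable_cst.
apply: measurable_EFinT; apply: (measurableT_comp (measurable_ker i)).
by apply: measurable_funB; [exact: measurable_id|exact: measurable_cst].
Qed.

(** Tonelli and a translation of each term: the kernel integrated over time after a point becomes an
    average over lags of the counting process. This turns the compensator into a convolution, linear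
    in the process. *)
Lemma integral_intensity i w (sigma : R) : 0 <= sigma ->
  (\int[leb]_(s in `[0%R, sigma]) intensity tm mk mu (kernel4 g h) i s w =
   (mu i * sigma)%:E + \int[leb]_x ((ker i x)%:E * CN (partner i) (sigma - x)%R w))%E.
Proof.
move=> s0; under eq_integral do rewrite intensityE.
have mpi n : measurable_fun (`[0, sigma]%classic : set R) (point_intensity i w n).
  by apply: measurable_funTS; exact: measurable_point_intensity.
have pi0 n s : (0 <= point_intensity i w n s)%E by exact: point_intensity_ge0.
rewrite ge0_integralD//=; last 3 first.
- by move=> s _; rewrite lee_fin.
- by move=> s _; apply: nneseries_ge0.
- by apply: (measurable_nneseriesT (f := point_intensity i w)).
congr (_ + _)%E.
  rewrite integral_cst//= lebesgue_measure_itv/= lte_fin.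
  case: ltP => [_|sle]; first by rewrite oppr0 adde0 EFinM.
  have -> : sigma = 0 by apply/eqP; rewrite eq_le s0 sle.
  by rewrite mule0 mulr0.
rewrite integral_nneseries//.
pose b n x : \bar R := if (tm n w <= (sigma - x)%:E)%E && (mk n w == partner i) then 1%E else 0%E.
have b0 n x : (0 <= b n x)%E by rewrite /b; case: ifP.
have mb n : measurable_fun setT (b n).
  rewrite /b; apply: measurable_fun_ifT; [|exact: measurable_cst..].
  apply: measurable_and; last exact: measurable_cst.
  apply: measurable_fun_lee; first exact: measurable_cst.
  apply: measurable_EFinT.
  by apply: measurable_funB; [exact: measurable_cst|exact: measurable_id].
have mkb n : measurable_fun setT (fun x => (ker i x)%:E * b n x)%E.
  by apply: emeasurable_funM => //; apply: measurable_EFinT; exact: measurable_ker.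
transitivity (\sum_(0 <= n <oo) \int[leb]_x ((ker i x)%:E * b n x))%E; last first.
  rewrite -integral_nneseries//; last first.
    by move=> n x _; rewrite mule_ge0// lee_fin ker_ge0.
  apply: eq_integral => x _; rewrite nneseriesZl//.
apply: eq_eseriesr => n _; rewrite integral_mkcond /b /point_intensity.
have [tn|tn] := ltP (tm n w) +oo%E; last first.
  rewrite /= integral0_eq; last by move=> x _; rewrite patchE; case: ifP.
  rewrite integral0_eq// => x _.
  have /lt_geF -> : ((sigma - x)%:E < tm n w)%E by apply: lt_le_trans tn; rewrite ltry.
  by rewrite mule0.
have [mn|mn] := boolP (mk n w == partner i); last first.
  rewrite /= integral0_eq; last by move=> x _; rewrite patchE; case: ifP.
  by rewrite integral0_eq// => x _; rewrite andbF mule0.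
pose f s : \bar R := ((ker i (s - fine (tm n w)))%:E * (s <= sigma)%R%:R%:E)%E.
transitivity (\int[leb]_s f s)%E.
  apply: eq_integral => s _; rewrite patchE mem_setE in_itv/= /f.
  have t0 : 0 < fine (tm n w) by rewrite -lte_fin -tm_fin.
  case: (leP 0 s) => s0' /=; first by case: ifP => _; rewrite ?mule1 ?mule0.
  by rewrite /ker kpos_neg ?mul0e//; lra.
rewrite -(integral_shift (f := f) (fine (tm n w))).
- apply: eq_integral => x _; rewrite /f addrK andbT (tm_fin tn) lee_fin lerBrDr addrC.
  by case: ifP.
- apply: emeasurable_funM.
    apply: measurable_EFinT; apply: (measurableT_comp (measurable_ker i)).
    by apply: measurable_funB; [exact: measurable_id|exact: measurable_cst].
  apply: measurable_EFinT.
  rewrite (_ : (fun s => _) = (fun s => if s <= sigma then 1 else 0 : R)); last first.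
    by apply/funext => s; case: ifP.
  apply: measurable_fun_ifT; [|exact: measurable_cst..].
  by apply: measurable_fun_ler; [exact: measurable_id|exact: measurable_cst].
- by move=> s; rewrite /f mule_ge0// lee_fin ?ker_ge0.
Qed.

End hawkes_paths.

(** * The process stopped at a point, and its compensator *)

Section stopped_processes.
Context d (Omega : measurableType d) (R : realType) (P : probability Omega R).
Local Notation leb := (@lebesgue_measure R).
Variables (g h : R -> R).
Hypothesis g_ge0 : forall t, 0 <= t -> 0 <= g t.
Hypothesis h_ge0 : forall t, 0 <= t -> 0 <= h t.
Hypothesis g_int : leb.-integrable `[0, +oo[ (EFin \o g).
Hypothesis h_int : leb.-integrable `[0, +oo[ (EFin \o h).
Variables (mu : 'I_4 -> R) (mu_ge0 : forall i, 0 <= mu i).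
Variables (tm : nat -> Omega -> \bar R) (mk : nat -> Omega -> 'I_4).
Hypothesis mpts : marked_points tm mk.

Let tm_meas n : measurable_fun setT (tm n). Proof. by case: mpts. Qed.
Let mk_meas n i : measurable (mk n @^-1` [set i]). Proof. by case: mpts. Qed.
Let tm_gt0 n w : (0 < tm n w)%E. Proof. by case: mpts. Qed.
Let tm_inc n w : (tm n w < +oo)%E -> (tm n w < tm n.+1 w)%E.
Proof. by case: mpts => _ _ _ _ tinc; exact: tinc. Qed.
Let tm_leq n m w : (n <= m)%N -> (tm n w <= tm m w)%E.
Proof. exact: (tm_le mpts). Qed.
Let tm_fine n w : (tm n w < +oo)%E -> tm n w = (fine (tm n w))%:E.
Proof. exact: (tm_fin mpts). Qed.

Local Notation CN := (counting_process tm mk).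
Local Notation ker := (ker g h).
Local Notation mass := (mass g h).

Let ker0 i s : 0 <= ker i s. Proof. exact: ker_ge0. Qed.
Let mker i : measurable_fun setT (ker i). Proof. exact: measurable_ker. Qed.
Let kerH i : (\int[leb]_s (ker i s)%:E = (mass i)%:E)%E. Proof. exact: integral_ker. Qed.
Let mass0 i : 0 <= mass i. Proof. exact: (mass_ge0 (ker0 i) (kerH i)). Qed.

Definition pt_before k i t w : R := ((tm k w <= t%:E)%E && (mk k w == i))%:R.

(** The points are indexed from 0, so stopping at [tm n] keeps the n + 1 points of index at most n;
    the process is bounded by n + 1. *)
Definition Nstop n i t w : R := \sum_(k < n.+1) pt_before k i t w.

Lemma pt_before_nd k i w : {homo pt_before k i ^~ w : s t / s <= t}.
Proof.
move=> s t st; rewrite /pt_before ler_nat; case: (mk k w == i); rewrite ?andbF// !andbT.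
by case: leP => // ks; rewrite (le_trans ks)// lee_fin.
Qed.

Lemma measurable_pt_before k i :
  measurable_fun setT (fun p : R * Omega => pt_before k i p.1 p.2).
Proof.
have mb : measurable_fun setT (fun p : R * Omega =>
    ((tm k p.2 <= p.1%:E)%E && (mk k p.2 == i))).
  apply: measurable_and.
    apply: measurable_fun_lee; first exact: (measurableT_comp (tm_meas k) measurable_snd).
    by apply: measurable_EFinT; exact: measurable_fst.
  apply: (measurable_fun_bool true); rewrite setTI.
  rewrite (_ : _ @^-1` _ = snd @^-1` (mk k @^-1` [set i])).
    by rewrite -[X in measurable X]setTI; apply: measurable_snd.
  by apply/seteqP; split => p /= /eqP.
have := measurable_fun_ifT mb (measurable_cst (1 : R)) (measurable_cst (0 : R)).
by apply: eq_measurable_fun => p _; rewrite /pt_before; case: (_ && _).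
Qed.

Lemma Nstop_ge0 n i t w : 0 <= Nstop n i t w.
Proof. by apply: sumr_ge0. Qed.

Lemma Nstop_le n i t w : Nstop n i t w <= n.+1%:R.
Proof.
rewrite -[X in X%:R](card_ord n.+1) -sumr_const; apply: ler_sum => k _.
by rewrite /pt_before; case: (_ && _).
Qed.

Lemma Nstop_nd n i w : {homo Nstop n i ^~ w : s t / s <= t}.
Proof. by move=> s t st; apply: ler_sum => k _; exact: pt_before_nd. Qed.

Lemma Nstop0 n i t w : t <= 0 -> Nstop n i t w = 0.
Proof.
move=> t0; apply: big1 => k _; rewrite /pt_before lt_geF//.
by apply: (@le_lt_trans _ _ 0%E); rewrite ?lee_fin.
Qed.

Lemma measurable_Nstop n i :
  measurable_fun setT (fun p : R * Omega => Nstop n i p.1 p.2).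
Proof. by apply: measurable_sum => k; exact: measurable_pt_before. Qed.

Lemma measurable_Nstop_path n i w : measurable_fun setT (fun t => Nstop n i t w).
Proof. exact: (measurableT_comp (measurable_Nstop n i) (pair2_measurable w)). Qed.

Lemma bmeas_Nstop_path n i (t : R) w : bmeas (fun x : R => Nstop n i (t - x) w).
Proof.
split.
  apply: (measurableT_comp (measurable_Nstop_path n i w)).
  by apply: measurable_funB; [exact: measurable_cst|exact: measurable_id].
by exists n.+1%:R => x; rewrite ger0_norm ?Nstop_ge0// Nstop_le.
Qed.

(** Finite times increase strictly, so no point of index above n has occurred by time [tm n]. *)
Lemma counting_Nstop n i y w : (y%:E <= tm n w)%E -> CN i y w = (Nstop n i y w)%:E.
Proof.
move=> yn; rewrite /counting_process (nneseries_split _ n.+1); last first.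
  by move=> k _; case: ifP.
rewrite add0n eseries0 ?adde0; last first.
  move=> k nk _; rewrite lt_geF//=.
  have [tn|tn] := ltP (tm n w) +oo%E.
    apply: (le_lt_trans yn); apply: (lt_le_trans (tm_inc tn)).
    exact: tm_leq.
  by apply: (@lt_le_trans _ _ +oo%E); rewrite ?ltry// (le_trans tn)// tm_leq// ltnW.
rewrite big_mkord /Nstop -sumEFin; apply: eq_bigr => k _.
by rewrite /pt_before; case: (_ && _).
Qed.

Local Notation stop := (stopped_time tm).

Lemma stopE n t w : stop n t w = if (t%:E <= tm n w)%E then t else fine (tm n w).
Proof.
by rewrite /stopped_time; case: leP.
Qed.

Lemma stop_le n t w : stop n t w <= t.
Proof.
rewrite stopE; have [//|nt] := leP t%:E (tm n w).
by rewrite -lee_fin -tm_fine ?(ltW nt)// (lt_trans nt)// ltry.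
Qed.

Lemma stop_le_tm n t w : ((stop n t w)%:E <= tm n w)%E.
Proof.
rewrite stopE; have [//|nt] := leP t%:E (tm n w).
by rewrite -tm_fine// (lt_trans nt)// ltry.
Qed.

Lemma stop_lipschitz n s t w : s <= t ->
  0 <= stop n t w - stop n s w <= t - s.
Proof.
move=> st; rewrite !stopE.
have [tn|nt] := leP (t%:E) (tm n w).
  rewrite (le_trans _ tn) ?lee_fin// lexx andbT; lra.
have nt' := lt_trans nt (ltry t).
have ntR : fine (tm n w) < t by rewrite -lte_fin -tm_fine.
have [sn|ns] := leP s%:E (tm n w); last by rewrite subrr lexx subr_ge0.
have : s <= fine (tm n w) by rewrite -lee_fin -tm_fine.
by lra.
Qed.

Lemma stop_ge0 n t w : 0 <= t -> 0 <= stop n t w.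
Proof.
move=> t0; rewrite stopE; have [//|nt] := leP t%:E (tm n w).
by rewrite -lee_fin -tm_fine ?(ltW (tm_gt0 _ _))// (lt_trans nt)// ltry.
Qed.

Lemma Nstop_stop n i t w : Nstop n i (stop n t w) w = Nstop n i t w.
Proof.
apply: eq_bigr => k _; rewrite /pt_before stopE; have [//|nt] := leP t%:E (tm n w).
have nt' := lt_trans nt (ltry t).
have kn : (tm k w <= tm n w)%E by apply: tm_leq; rewrite -ltnS.
by rewrite -tm_fine// kn (le_trans kn (ltW nt)).
Qed.

(** The clock is not stopped here, only the driving points are. [Astop] evaluates this at the
    stopped time and is the true compensator; the free version is linear in [Nstop], which the
    moment recursion exploits. *)
Definition Afree n i t w : R := mu i * Num.max t 0 +
  wint (ker i) (fun x => Nstop n (partner i) (t - x) w).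

Lemma Afree_inc n i s t w : s <= t ->
  0 <= Afree n i t w - Afree n i s w <= mu i * (t - s) +
   wint (ker i) (fun x => Nstop n (partner i) (t - x) w - Nstop n (partner i) (s - x) w).
Proof.
move=> st.
rewrite (wintB (ker0 i) (mker i) (kerH i)); [|exact: bmeas_Nstop_path..].
have w0 : wint (ker i) (fun x => Nstop n (partner i) (s - x) w) <=
    wint (ker i) (fun x => Nstop n (partner i) (t - x) w).
  apply: (wint_le (ker0 i) (mker i) (kerH i)); [exact: bmeas_Nstop_path..|].
  by move=> x _; apply: Nstop_nd; rewrite lerD2r.
have m0 : mu i * Num.max s 0 <= mu i * Num.max t 0.
  by rewrite ler_wpM2l// ge_max !le_max lexx st orbT.
have m1 : mu i * Num.max t 0 - mu i * Num.max s 0 <= mu i * (t - s).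
  rewrite -mulrBr ler_wpM2l//.
  by rewrite /Num.max; case: ltP => ?; case: ltP => ?; lra.
by rewrite /Afree; lra.
Qed.

Definition Astop n i t w : R := Afree n i (stop n t w) w.

(** If the process is already stopped at s, nothing accrues afterwards; otherwise the stopped clock
    agrees with s at the left end and is at most t at the right end, and [Afree] is
    nondecreasing. *)
Lemma Astop_inc n i s t w : s <= t ->
  0 <= Astop n i t w - Astop n i s w <= mu i * (t - s) +
   wint (ker i) (fun x => Nstop n (partner i) (t - x) w - Nstop n (partner i) (s - x) w).
Proof.
move=> st; have /andP[l0 l1] := stop_lipschitz n w st.
rewrite subr_ge0 in l0; have /andP[a0 a1] := Afree_inc n i w l0.
rewrite a0 /=; have [sn|ns] := leP s%:E (tm n w); last first.
  have -> : Astop n i t w = Astop n i s w.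
    by rewrite /Astop !stopE !lt_geF// (lt_le_trans ns)// lee_fin.
  rewrite subrr addr_ge0 ?mulr_ge0 ?subr_ge0//.
  by apply: wint_ge0 => // x _; rewrite subr_ge0; apply: Nstop_nd; rewrite lerD2r.
apply: (@le_trans _ _ (Afree n i t w - Afree n i s w)).
  rewrite /Astop [stop n s w]stopE sn lerD2r.
  by have /andP[] := Afree_inc n i w (stop_le n t w); rewrite subr_ge0.
by have /andP[] := Afree_inc n i w st.
Qed.

Lemma Astop_neg n i t w : t <= 0 -> Astop n i t w = 0.
Proof.
move=> t0; have st : stop n t w <= 0 := le_trans (stop_le n t w) t0.
rewrite /Astop /Afree (max_r st) mulr0 add0r.
apply/eqP; rewrite eq_le; apply/andP; split; last first.
  by apply: wint_ge0 => // x _; exact: Nstop_ge0.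
rewrite -[leRHS](mul0r (mass i)) -(wint_cst (ker0 i) (mker i) (kerH i)).
apply: (wint_le (ker0 i) (mker i) (kerH i)); [exact: bmeas_Nstop_path|exact: bmeas_cst|].
by move=> x /ker_neq0 x0; rewrite Nstop0//; lra.
Qed.

Lemma Astop_ge0 n i t w : 0 <= Astop n i t w.
Proof.
have [t0|/ltW t0] := leP t 0; first by rewrite Astop_neg.
by have /andP[] := Astop_inc n i w t0; rewrite [Astop n i 0 w]Astop_neg// subr0.
Qed.

Lemma Astop_le n i t w : Astop n i t w <= mu i * Num.max t 0 + n.+1%:R * mass i.
Proof.
rewrite /Astop /Afree lerD//.
  by rewrite ler_wpM2l// ge_max !le_max stop_le lexx orbT.
rewrite -(wint_cst (ker0 i) (mker i) (kerH i)).
apply: (wint_le (ker0 i) (mker i) (kerH i)); [exact: bmeas_Nstop_path|exact: bmeas_cst|].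
by move=> x _; exact: Nstop_le.
Qed.

Lemma compensatedE n i t w : 0 <= t ->
  compensated tm mk mu (kernel4 g h) n i t w = (Nstop n i t w - Astop n i t w)%:E.
Proof.
move=> t0; rewrite /compensated.
rewrite (counting_Nstop i (stop_le_tm n t w)) Nstop_stop EFinB; congr (_ - _)%E.
rewrite (integral_intensity g_ge0 h_ge0 g_int h_int mu_ge0 mpts)//; last exact: stop_ge0.
rewrite /Astop /Afree (max_l (stop_ge0 n w t0)) EFinD; congr (_ + _)%E.
rewrite (wint_EFin (ker0 i) (mker i) (kerH i)); last exact: bmeas_Nstop_path.
apply: eq_integral => x _; have [->|/ker_neq0 x0] := eqVneq (ker i x) 0.
  by rewrite mul0e mul0r.
rewrite (@counting_Nstop n)// ; apply: le_trans (stop_le_tm n t w).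
by rewrite lee_fin; lra.
Qed.

(** At most n + 1 points contribute, each with the kernel mass of an interval of length at most v -
    u; half of e is spent on them and half on the baseline. The modulus is uniform in the
    outcome. *)
Lemma Astop_modulus n i e : 0 < e -> exists2 dl : R, 0 < dl &
  forall w u v, u <= v -> v - u < dl -> Astop n i v w - Astop n i u w <= e.
Proof.
move=> e0.
have n0 : 0 < n.+1%:R :> R by rewrite ltr0n.
pose e' := e / 2 / n.+1%:R.
have e'0 : 0 < e' by rewrite !divr_gt0.
  have [dl1 dl10 mod] := weight_modulus (ker0 i) (mker i) (kerH i) e'0.
  pose dl2 := e / 2 / (mu i + 1).
  have m1 : 0 < mu i + 1 by rewrite ltr_wpDl.
  have dl20 : 0 < dl2 by rewrite !divr_gt0.
  exists (Num.min dl1 dl2); first by rewrite lt_min dl10.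
  move=> w u v uv; rewrite lt_min => /andP[uv1 uv2].
  have /andP[l0 l1] := stop_lipschitz n w uv; rewrite subr_ge0 in l0.
  have /andP[_] := Afree_inc n i w l0; rewrite -!/(Astop _ _ _ _) => /le_trans; apply.
  move: (stop n u w) (stop n v w) l0 l1 => u' v' l0 l1.
  have -> : e = e / 2 + e' * n.+1%:R by rewrite /e' divfK ?gt_eqF//; lra.
  apply: lerD.
    apply: (@le_trans _ _ (mu i * dl2)); first by rewrite ler_wpM2l//; lra.
    by rewrite /dl2 mulrCA ger_pMr ?divr_gt0// ler_pdivrMr// mul1r lerDl.
  have bI (k : nat) : bmeas (fun x : R => (u' - fine (tm k w) < x <= v' - fine (tm k w))%R%:R : R).
    split; last by exists 1 => x; rewrite ger0_norm//; case: (_ && _).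
    rewrite (_ : (fun x => _) = \1_(`]u' - fine (tm k w), v' - fine (tm k w)]%classic : set R)).
      exact: measurable_indic.
    by apply/funext => x; rewrite indicE mem_setE in_itv.
  have bd (c : R) : bmeas (fun x : R => Nstop n (partner i) (c - x) w) by exact: bmeas_Nstop_path.
  apply: (@le_trans _ _ (wint (ker i) (fun x => \sum_(k < n.+1)
      (u' - fine (tm k w) < x <= v' - fine (tm k w))%R%:R))).
    apply: (wint_le (ker0 i) (mker i) (kerH i)); [exact: bmeasB|exact: bmeas_sum|].
    move=> x _; rewrite /Nstop -sumrB; apply: ler_sum => k _; rewrite /pt_before.
    have [tk|tk] := ltP (tm k w) +oo%E; last first.
      have inf (y : R) : (tm k w <= y%:E)%E = false.
        by apply: lt_geF; rewrite (lt_le_trans _ tk)// ltry.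
      by rewrite !inf subrr.
    rewrite (tm_fine tk)/= !lee_fin.
    have -> : (u' - fine (tm k w) < x) = ~~ (fine (tm k w) <= u' - x).
      by rewrite -ltNge ltrBlDr ltrBlDr addrC.
    have -> : (x <= v' - fine (tm k w)) = (fine (tm k w) <= v' - x) by rewrite !lerBrDr addrC.
    have : fine (tm k w) <= u' - x -> fine (tm k w) <= v' - x by lra.
    case: (_ <= u' - x) => [->//|_]; first by case: (_ == _); rewrite subrr.
    by case: (_ <= v' - x); case: (_ == _); rewrite ?subr0.
  rewrite (wint_sum (ker0 i) (mker i) (kerH i))//.
  rewrite mulr_natr -[X in _ *+ X](card_ord n.+1) -sumr_const; apply: ler_sum => k _.
  by apply: mod; lra.
Qed.

End stopped_processes.

(** * The stopped compensated processes form an orthogonal system *)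

Section stopped_martingales.
Context d (Omega : measurableType d) (R : realType) (P : probability Omega R).
Local Notation leb := (@lebesgue_measure R).
Variables (g h : R -> R).
Hypothesis g_ge0 : forall t, 0 <= t -> 0 <= g t.
Hypothesis h_ge0 : forall t, 0 <= t -> 0 <= h t.
Hypothesis g_int : leb.-integrable `[0, +oo[ (EFin \o g).
Hypothesis h_int : leb.-integrable `[0, +oo[ (EFin \o h).
Variables (mu : 'I_4 -> R) (mu_ge0 : forall i, 0 <= mu i).
Variables (tm : nat -> Omega -> \bar R) (mk : nat -> Omega -> 'I_4).
Hypothesis haw : is_hawkes P tm mk mu (kernel4 g h).

Let mpts : marked_points tm mk. Proof. by case: haw. Qed.
Let tm_gt0 n w : (0 < tm n w)%E. Proof. by case: mpts. Qed.
Let tm_inc n w : (tm n w < +oo)%E -> (tm n w < tm n.+1 w)%E.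
Proof. by case: mpts => _ _ _ _ tinc; exact: tinc. Qed.
Let tm_leq n m w : (n <= m)%N -> (tm n w <= tm m w)%E.
Proof. exact: (tm_le mpts). Qed.
Let tm_fine n w : (tm n w < +oo)%E -> tm n w = (fine (tm n w))%:E.
Proof. exact: (tm_fin mpts). Qed.

Local Notation Ns := (Nstop tm mk).
Local Notation As := (Astop g h mu tm mk).

Lemma points_gap n w : exists2 dl : R, 0 < dl & forall k, (k < n)%N ->
  (tm k w < +oo)%E -> ((fine (tm k w) + dl)%:E <= tm k.+1 w)%E.
Proof.
elim: n => [|n [dl dl0 IH]]; first by exists 1.
have [e e0 He] : exists2 e : R, 0 < e & ((tm n w < +oo)%E -> ((fine (tm n w) + e)%:E <= tm n.+1 w)%E).
  have [tn|tn] := ltP (tm n w) +oo%E; last by exists 1.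
  have := tm_inc tn; rewrite {1}(tm_fine tn).
  case E : (tm n.+1 w) => [r| |//] => [|_]; last by exists 1; rewrite // leey.
  rewrite lte_fin => tr; exists (r - fine (tm n w)); first by rewrite subr_gt0.
  by rewrite lee_fin; lra.
exists (Num.min dl e); first by rewrite lt_min dl0.
have m1 : Num.min dl e <= dl by rewrite ge_min lexx.
have m2 : Num.min dl e <= e by rewrite ge_min lexx orbT.
move=> k; rewrite ltnS leq_eqVlt => /predU1P[->|kn] tk.
  by apply: le_trans (He tk); rewrite lee_fin lerD2l.
by apply: le_trans (IH k kn tk); rewrite lee_fin lerD2l.
Qed.

(** Below the smallest gap between the first n + 1 points an interval holds at most one of them,
    carrying one mark: the product of two increments is then the increment itself if i = j, and 0
    otherwise. The gap may depend on the outcome, as the convergence of brackets is pathwise. *)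
Lemma Nstop_separated n w : exists2 dl : R, 0 < dl & forall i j u v, u <= v -> v - u < dl ->
  (Ns n i v w - Ns n i u w) * (Ns n j v w - Ns n j u w) =
  (i == j)%:R * (Ns n i v w - Ns n i u w).
Proof.
have [dl dl0 gap] := points_gap n w.
exists dl => // i j u v uv vu.
pose c k i : R := ((u%:E < tm k w)%E && (tm k w <= v%:E)%E && (mk k w == i))%:R.
have NE l : Ns n l v w - Ns n l u w = \sum_(k < n.+1) c k l.
  rewrite /Nstop -sumrB; apply: eq_bigr => k _; rewrite /pt_before /c ltNge.
  have : (tm k w <= u%:E)%E -> (tm k w <= v%:E)%E.
    by move=> /le_trans; apply; rewrite lee_fin.
  case: (tm k w <= u%:E)%E => [->//|_] /=; first by rewrite subrr.
  by rewrite subr0.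
rewrite !NE.
have disj (k l : nat) : (k < l)%N -> (l <= n)%N -> (u%:E < tm k w)%E -> ~ (tm l w <= v%:E)%E.
  move=> kl ln uk lv.
  have tk : (tm k w < +oo)%E.
    by apply: le_lt_trans (ltry v); apply: le_trans lv; apply: tm_leq; exact: ltnW.
  have := gap k (leq_trans kl ln) tk; apply/negP; rewrite -ltNge.
  apply: (@le_lt_trans _ _ v%:E); first by apply: le_trans lv; exact: tm_leq.
  rewrite lte_fin; move: uk; rewrite (tm_fine tk) lte_fin; lra.
have off (k l : 'I_n.+1) : k != l -> c k i * c l j = 0.
  move=> kl; rewrite /c; have [uk|] := boolP (u%:E < tm k w)%E; last by rewrite mul0r.
  have [ul|] := boolP (u%:E < tm l w)%E; last by rewrite mulr0.
  case: (ltngtP k l) => [lt|lt|/val_inj E]; last by rewrite E eqxx in kl.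
    by have [/(disj k l lt (ltn_ord l) uk)//|_] := boolP (tm l w <= v%:E)%E; rewrite mulr0.
  by have [/(disj l k lt (ltn_ord k) ul)//|_] := boolP (tm k w <= v%:E)%E; rewrite mul0r.
rewrite mulr_suml mulr_sumr; apply: eq_bigr => k _.
rewrite mulr_sumr (bigD1 k)//= big1 ?addr0; last by move=> l lk; rewrite off// eq_sym.
rewrite /c; case: ((u%:E < tm k w)%E && (tm k w <= v%:E)%E); last by rewrite mul0r mulr0.
have [<-|ij] := eqVneq i j; first by rewrite mul1r; case: (_ == i); rewrite ?mulr1 ?mulr0.
rewrite mul0r; have [->|_] := eqVneq (mk k w) i; last by rewrite mul0r.
by rewrite (negPf ij) mulr0.
Qed.

Definition Mstop n i t w : R := Ns n i t w - As n i t w.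

(** The generators of [natural_filtration]; the sigma-algebra is restored inside [adapted]. *)
Definition fil (t : R) : set (set Omega) :=
  [set A | exists i s B, [/\ (0 <= s <= t), measurable B &
                             A = counting_process tm mk i s @^-1` B] ].

Lemma measurable_counting i s : measurable_fun setT (counting_process tm mk i s).
Proof.
apply: (measurable_nneseriesT (f := fun n w => if (tm n w <= s%:E)%E && (mk n w == i) then 1%E else 0%E)).
  by move=> n w; case: ifP.
move=> n; apply: measurable_fun_ifT; [|exact: measurable_cst..].
apply: measurable_and.
  by apply: measurable_fun_lee; [case: mpts|exact: measurable_cst].
apply: (measurable_fun_bool true); rewrite setTI.
rewrite (_ : _ @^-1` _ = mk n @^-1` [set i]); first by case: mpts.
by apply/seteqP; split => p /= /eqP.
Qed.

Lemma fil_meas t : fil t `<=` measurable.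
Proof.
move=> _ [i [s [B [_ mB ->]]]]; rewrite -[X in measurable X]setTI.
exact: measurable_counting.
Qed.

Lemma fil_mono s t : s <= t -> fil s `<=` fil t.
Proof.
move=> st _ [i [r [B [/andP[r0 rs] mB ->]]]]; exists i, r, B; split => //.
by rewrite r0 (le_trans rs).
Qed.

Let compE n i t w : 0 <= t -> compensated tm mk mu (kernel4 g h) n i t w = (Mstop n i t w)%:E.
Proof. exact: compensatedE. Qed.

Lemma Mstop_neg n i t w : t <= 0 -> Mstop n i t w = 0.
Proof. by move=> t0; rewrite /Mstop Nstop0// Astop_neg// subr0. Qed.

Let Amono n i w : {homo As n i ^~ w : s t / s <= t}.
Proof.
by move=> s t st; have /andP[] := Astop_inc g_ge0 h_ge0 g_int h_int mu_ge0 mpts n i w st;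
  rewrite subr_ge0.
Qed.

Let Ale n i t w : `|As n i t w| <= mu i * Num.max t 0 + n.+1%:R * mass g h i.
Proof.
by rewrite ger0_norm; [exact: (Astop_le g_ge0 h_ge0 g_int h_int mu_ge0 mpts)|
  exact: (Astop_ge0 g_ge0 h_ge0 g_int h_int mu_ge0 mpts)].
Qed.

Lemma Mstop_adapted n i t : adapted (fil t) (Mstop n i t).
Proof.
have [t0|t0] := leP 0 t; last first.
  rewrite (_ : Mstop n i t = fun=> 0); first exact: bmeas_cst.
  by apply/funext => w; rewrite Mstop_neg// ltW.
split; last first.
  exists (n.+1%:R + (mu i * Num.max t 0 + n.+1%:R * mass g h i)) => w.
  apply: le_trans (ler_normB _ _) _; apply: lerD; last exact: Ale.
  by rewrite ger0_norm ?Nstop_ge0// Nstop_le.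
(* Measurability is read off the martingale hypothesis for [compensated], after a Borel set of R is
   mapped into the extended reals. *)
have [aM _ _] := haw.2 n i; move=> _ B mB; rewrite setTI.
have := aM t t0 _ (measurable_image_EFin mB).
congr (<<s _ >> _); apply/seteqP; split => w /=.
  by move=> [r Br]; rewrite compE// => -[<-].
by move=> Bw; exists (Mstop n i t w) => //; rewrite compE.
Qed.

Lemma Mstop_bmart n i : bmart P fil (Mstop n i).
Proof.
split; first exact: Mstop_adapted.
have base s t Z : 0 <= s -> s <= t -> adapted (fil s) Z ->
    Ex P (fun w => inc (Mstop n i) s t w * Z w) = 0.
  move=> s0 st aZ; have t0 := le_trans s0 st.
  have bM r : bmeas (Mstop n i r) by exact: (adapted_bmeas (@fil_meas r) (Mstop_adapted n i r)).
  apply: (ortho_adapted (@fil_meas s) _ _ aZ); first exact: bmeasB.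
  move=> A FA.
  have mA : measurable A.
    by apply: smallest_sub FA => //; [exact: sigma_algebra_measurable|exact: fil_meas].
  have [_ _ mart] := haw.2 n i.
  have st' : 0 <= s <= t by rewrite s0.
  have [_ _ eqA] := mart s t st'; have := eqA A FA.
  have iA r : P.-integrable A (EFin \o Mstop n i r).
    by apply: integrableS (bmeas_integrable P (bM r)).
  have ee r : 0 <= r -> (\int[P]_(w in A) compensated tm mk mu (kernel4 g h) n i r w =
      \int[P]_(w in A) (Mstop n i r w)%:E)%E.
    by move=> r0; apply: eq_integral => w _; exact: compE.
  move=> e'; have e := etrans (esym (ee s s0)) (etrans e' (ee t t0)).
  transitivity (\int[P]_(w in A) Mstop n i t w - \int[P]_(w in A) Mstop n i s w)%R.
    exact: (RintegralB mA (iA t) (iA s)).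
  by apply/eqP; rewrite subr_eq0; apply/eqP; exact: (congr1 fine (esym e)).
(* The process vanishes up to time 0: an interval with s < 0 <= t may be replaced by (0, t], where Z
   is adapted by monotonicity, and an interval of negative times gives 0. *)
move=> s t Z st aZ.
have [s0|/ltW s0] := leP 0 s; first exact: base.
have [t0|t0] := leP 0 t.
  rewrite -[RHS](base 0 t Z (lexx 0) t0); last exact: adapted_mono (fil_mono s0) aZ.
  by apply: Ex_eq => w; rewrite /inc (Mstop_neg n i w s0) (Mstop_neg n i w (lexx 0)).
rewrite -[RHS](Ex_cst P 0); apply: Ex_eq => w.
by rewrite /inc (Mstop_neg n i w s0) (Mstop_neg n i w (ltW t0)) subrr mul0r.
Qed.

Let mesh_cross_E n i j s t w m : mesh_bracket (Mstop n) i j s t m w =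
  mesh_cross (Ns n i ^~ w) (Ns n j ^~ w) (As n i ^~ w) (As n j ^~ w) s t m.
Proof. by []. Qed.

Lemma stopped_orthogonal n : orthogonal_system P fil (Mstop n) (Ns n).
Proof.
have cvg i j s t w : s <= t -> mesh_bracket (Mstop n) i j s t ^~ w @ \oo -->
    ((i == j)%:R * inc (Ns n i) s t w : R).
  move=> st; under eq_fun do rewrite mesh_cross_E.
  apply: mesh_cross_cvg => //; try exact: Nstop_nd; try exact: Amono.
    have [dl dl0 sep] := Nstop_separated n w; exists dl => // u v; exact: sep.
  move=> e e0.
  have [dl dl0 m1] := Astop_modulus g_ge0 h_ge0 g_int h_int mu_ge0 mpts n i e0.
  have [dl' dl'0 m2] := Astop_modulus g_ge0 h_ge0 g_int h_int mu_ge0 mpts n j e0.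
  exists (Num.min dl dl'); first by rewrite lt_min dl0.
  move=> u v uv; rewrite lt_min => /andP[v1 v2]; split; [exact: m1|exact: m2].
have bdd i j s t : s <= t -> exists K : R, forall m w, `|mesh_bracket (Mstop n) i j s t m w| <= K.
  move=> st.
  pose K i := n.+1%:R + (mu i * Num.max t 0 + n.+1%:R * mass g h i).
  exists (K i * K j) => m w; rewrite mesh_cross_E.
  have Nnd := @Nstop_nd _ _ R tm mk n.
  apply: le_trans (mesh_cross_bounded (Nnd i w) (Nnd j w) (@Amono n i w) (@Amono n j w) m st) _.
  have b l : 0 <= Ns n l t w - Ns n l s w + (As n l t w - As n l s w) <= K l.
    have := Nnd l w _ _ st; have := @Amono n l w _ _ st.
    have := Nstop_ge0 tm mk n l s w; have := Nstop_le tm mk n l t w.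
    have := Ale n l t w; rewrite ler_norml.
    have := Astop_ge0 g_ge0 h_ge0 g_int h_int mu_ge0 mpts n l s w.
    by rewrite /K; move: (Ns n l t w) (Ns n l s w) (As n l t w) (As n l s w) => *; lra.
  have /andP[i0 i1] := b i; have /andP[j0 j1] := b j.
  by rewrite ler_pM.
split.
- exact: Mstop_bmart.
- by move=> i s t st; apply: (point_inc_adp fil_mono (Mstop_bmart n) cvg bdd).
- by move=> i j s t Z st aZ; apply: (bracketE fil_meas fil_mono (Mstop_bmart n) cvg bdd).
- by move=> i s t st; apply: (fourth_moment_le fil_meas fil_mono (Mstop_bmart n) cvg bdd).
Qed.

End stopped_martingales.

(** * Moments of increments of the stopped process, uniformly in the stopping *)

Section pair_contraction.
Context (R : realType).

Lemma partnerK i : partner (partner i) = i.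
Proof. by apply/val_inj; case: i => [[|[|[|[|//]]]] ?]. Qed.

(** Two steps return to the component i with factor q. The first of them contributes b multiplied by
    [q_ i], at most [Qm] b, whence the constant (1 + Qm) b. *)
Lemma pair_contraction (e : 'I_4 -> R -> R) (q_ : 'I_4 -> R) (b Qm q K0 : R) :
  0 < b -> 0 <= q < 1 -> (forall i, 0 <= q_ i <= Qm) ->
  (forall i, q_ i * q_ (partner i) = q) -> 0 <= K0 -> (forall i s, e i s <= K0) ->
  (forall i K, 0 <= K -> (forall s, e (partner i) s <= K) -> forall s, e i s <= b + q_ i * K) ->
  forall i s, e i s <= 2 * ((1 + Qm) * b) / (1 - q).
Proof.
move=> b0 q01 qQ qq K00 eK0 step i.
have /andP[qi0 qiQ] := qQ i; have /andP[qp0 _] := qQ (partner i).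
have c0 : 0 < (1 + Qm) * b by rewrite mulr_gt0//; lra.
apply: (contraction_bound (P := fun K => forall s, e i s <= K) _ c0 q01 K00 _ (eK0 i)).
  by move=> K L KL eK s; exact: le_trans (eK s) KL.
move=> K K0' eK s.
have := step (partner i) K K0'; rewrite partnerK => /(_ eK) ep.
have p0 : 0 <= b + q_ (partner i) * K by rewrite addr_ge0 ?(ltW b0)// mulr_ge0.
apply: le_trans (step i _ p0 ep s) _.
rewrite mulrDr mulrA qq.
have : q_ i * b <= Qm * b by rewrite ler_wpM2r// ltW.
by lra.
Qed.

End pair_contraction.

Section stopped_moments.
Context d (Omega : measurableType d) (R : realType) (P : probability Omega R).
Local Notation leb := (@lebesgue_measure R).
Local Notation Ex := (Ex P).
Variables (g h : R -> R).
Hypothesis g_ge0 : forall t, 0 <= t -> 0 <= g t.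
Hypothesis h_ge0 : forall t, 0 <= t -> 0 <= h t.
Hypothesis g_int : leb.-integrable `[0, +oo[ (EFin \o g).
Hypothesis h_int : leb.-integrable `[0, +oo[ (EFin \o h).
Hypothesis hg_lt1 : normL1 h * normL1 g < 1.
Variables (mu : 'I_4 -> R) (mu_ge0 : forall i, 0 <= mu i).
Variables (tm : nat -> Omega -> \bar R) (mk : nat -> Omega -> 'I_4).
Hypothesis haw : is_hawkes P tm mk mu (kernel4 g h).

Let mpts : marked_points tm mk. Proof. by case: haw. Qed.
Local Notation Ns := (Nstop tm mk).
Local Notation Ms := (Mstop g h mu tm mk).
Local Notation ker := (ker g h).
Local Notation mass := (mass g h).
Let ker0 i s : 0 <= ker i s. Proof. exact: ker_ge0. Qed.
Let mker i : measurable_fun setT (ker i). Proof. exact: measurable_ker. Qed.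
Let kerH i : (\int[leb]_s (ker i s)%:E = (mass i)%:E)%E. Proof. exact: integral_ker. Qed.
Let mass0 i : 0 <= mass i. Proof. exact: (mass_ge0 (ker0 i) (kerH i)). Qed.

Definition mum : R := \sum_i mu i.
Definition massm : R := normL1 h + normL1 g.

Let mu_le i : mu i <= mum.
Proof. by rewrite /mum (bigD1 i)//= lerDl sumr_ge0. Qed.

Let mum0 : 0 <= mum. Proof. exact: sumr_ge0. Qed.

Let h0 : 0 <= normL1 h. Proof. exact: (mass0 comp1). Qed.
Let g0 : 0 <= normL1 g. Proof. exact: (mass0 comp3). Qed.

Let mass_le i : mass i <= massm.
Proof. by rewrite /mass /kbase /massm; case: ifP => _; [rewrite lerDl|rewrite lerDr]. Qed.

Let massm0 : 0 <= massm. Proof. exact: le_trans (mass_le comp1). Qed.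

Lemma mass_partner i : mass i * mass (partner i) = normL1 h * normL1 g.
Proof. by case: i => [[|[|[|[|//]]]] ?]; rewrite /mass /kbase /=//; rewrite mulrC. Qed.

Let r01 : 0 <= normL1 h * normL1 g < 1. Proof. by rewrite hg_lt1 mulr_ge0. Qed.

Let bN n i s t : s <= t -> bmeas (inc (Ns n i) s t).
Proof.
move=> st; have [_ aN _ _] := stopped_orthogonal g_ge0 h_ge0 g_int h_int mu_ge0 haw n.
exact: (adapted_bmeas (fil_meas haw (t := t)) (aN i s t st)).
Qed.

Let bM n i s t : s <= t -> bmeas (inc (Ms n i) s t).
Proof.
move=> st; have [aM _ _ _] := stopped_orthogonal g_ge0 h_ge0 g_int h_int mu_ge0 haw n.
by apply: (adapted_bmeas (fil_meas haw (t := t))); apply: (inc_adp (fil_mono (mk := mk) (tm := tm))) => //; exact: (aM i).1.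
Qed.

Let inc0 n i s t w : s <= t -> 0 <= inc (Ns n i) s t w.
Proof. by move=> st; rewrite subr_ge0 Nstop_nd. Qed.

Let inc_le n i s t w : inc (Ns n i) s t w <= n.+1%:R.
Proof.
have := Nstop_le tm mk n i t w; have := Nstop_ge0 tm mk n i s w.
by rewrite /inc; lra.
Qed.

Let bpath n i s t w : bmeas (fun x : R => inc (Ns n i) (s - x) (t - x) w).
Proof. by apply: bmeasB; exact: bmeas_Nstop_path. Qed.

Let joint n i (s t : R) :
  measurable_fun setT (fun p : R * Omega => inc (Ns n i) (s - p.1) (t - p.1) p.2).
Proof.
have m (c : R) : measurable_fun setT (fun p : R * Omega => Ns n i (c - p.1) p.2).
  have mg : measurable_fun setT (fun p : R * Omega => (c - p.1, p.2)).
    apply: measurable_fun_pair; last exact: measurable_snd.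
    by apply: measurable_funB; [exact: measurable_cst|exact: measurable_fst].
  exact: (measurableT_comp (measurable_Nstop mpts n i) mg).
exact: measurable_funB.
Qed.

(* The compensator of the stopped process is at most that of the free one. *)
Lemma inc_Nstop_le n i s t w : s <= t ->
  inc (Ns n i) s t w <= inc (Ms n i) s t w + mu i * (t - s) +
    wint (ker i) (fun x => inc (Ns n (partner i)) (s - x) (t - x) w).
Proof.
move=> st; have /andP[_] := Astop_inc g_ge0 h_ge0 g_int h_int mu_ge0 mpts n i w st.
rewrite /inc /Mstop; move: (wint _ _) (Astop _ _ _ _ _ _ _ _ _) (Astop _ _ _ _ _ _ _ _ _) => *; lra.
Qed.

Lemma Ex_inc_M n i s t : s <= t -> Ex (inc (Ms n i) s t) = 0.
Proof.
move=> st; have [aM _ _ _] := stopped_orthogonal g_ge0 h_ge0 g_int h_int mu_ge0 haw n.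
have := (aM i).2 s t (fun=> 1) st (bmeas_cst _ 1).
by under Ex_eq do rewrite mulr1.
Qed.

Lemma Ex_wint_le n i s t K : s <= t ->
  (forall x, Ex (inc (Ns n i) (s - x) (t - x)) <= K) ->
  bmeas (fun w => wint (ker (partner i)) (fun x => inc (Ns n i) (s - x) (t - x) w)) /\
  Ex (fun w => wint (ker (partner i)) (fun x => inc (Ns n i) (s - x) (t - x) w)) <=
  mass (partner i) * K.
Proof.
move=> st EK; set j := partner i.
have stx x : s - x <= t - x by rewrite lerD2r.
pose F x w : \bar R := (ker j x * inc (Ns n i) (s - x) (t - x) w)%:E.
have mF : measurable_fun setT (fun p : R * Omega => F p.1 p.2).
  apply: measurable_EFinT; apply: measurable_funM => //.
  exact: (measurableT_comp (mker j) measurable_fst).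
have F0 x w : (0 <= F x w)%E by rewrite lee_fin mulr_ge0// inc0.
have wE w : (wint (ker j) (fun x => inc (Ns n i) (s - x) (t - x) w))%:E = (\int[leb]_x F x w)%E.
  exact: (wint_EFin (ker0 j) (mker j) (kerH j)).
have bw : bmeas (fun w => wint (ker j) (fun x => inc (Ns n i) (s - x) (t - x) w)).
  split.
    have := measurable_integral_l leb mF F0.
    under eq_fun do rewrite -wE.
    by move/measurable_EFinP.
  exists (n.+1%:R * mass j) => w; rewrite ger0_norm; last first.
    by apply: wint_ge0 => // x _; exact: inc0.
  rewrite -(wint_cst (ker0 j) (mker j) (kerH j)).
  by apply: (wint_le (ker0 j) (mker j) (kerH j)) => //; exact: bmeas_cst.
split => //; rewrite -lee_fin Ex_EFin//.
under eq_integral do rewrite wE.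
rewrite -(tonelli_swap leb P mF F0).
apply: (@le_trans _ _ (\int[leb]_x (K%:E * (ker j x)%:E))%E).
  have K0 : 0 <= K by apply: le_trans (EK 0); apply: Ex_ge0 => w; exact: inc0.
  apply: integralT_le.
  - exact: measurable_integral_r.
  - by apply: measurable_funeM; exact: measurable_EFinT (mker j).
  - by move=> x; exact: integralT_ge0.
  move=> x; rewrite /F; under eq_integral do rewrite EFinM.
  rewrite integralT_Zl; last 3 first.
  - by apply: measurable_EFinT; exact: (bN n i (stx x)).1.
  - by move=> w; rewrite lee_fin inc0.
  - by rewrite lee_fin.
  rewrite muleC; apply: lee_wpmul2r; first by rewrite lee_fin.
  by rewrite -Ex_EFin ?lee_fin//; exact: bN.
rewrite integralZl//; first by rewrite kerH -EFinM mulrC.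
exact: (weight_integrable (ker0 j) (mker j) (kerH j)).
Qed.

Definition moment1 : R := 2 * ((1 + massm) * (mum + 1)) / (1 - normL1 h * normL1 g).

Lemma moment1_ge0 : 0 <= moment1.
Proof.
apply: divr_ge0; last by move: r01; lra.
by apply: mulr_ge0 => //; apply: mulr_ge0; move: massm0 mum0; lra.
Qed.

(** The expected increments of N satisfy the renewal inequality with forcing mu l. The contraction
    starts from n + 1, which is finite for each n, and ends at a constant free of n. The case s = t
    is separate since the contraction needs a positive forcing. *)
Lemma Ex_inc_N n i s t : s <= t -> Ex (inc (Ns n i) s t) <= moment1 * (t - s).
Proof.
rewrite le_eqVlt => /predU1P[->|st].
  rewrite subrr mulr0 le_eqVlt; apply/orP; left; apply/eqP.
  by rewrite -[RHS](Ex_cst P 0); apply: Ex_eq => w; rewrite /inc subrr.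
pose l := t - s; have l0 : 0 < l by rewrite subr_gt0.
have lx s' : s' <= s' + l by rewrite lerDl ltW.
suff : forall i s', Ex (inc (Ns n i) s' (s' + l)) <=
    2 * ((1 + massm) * ((mum + 1) * l)) / (1 - normL1 h * normL1 g).
  move=> /(_ i s); rewrite /l [s + _]addrC subrK => /le_trans; apply.
  by rewrite /moment1 le_eqVlt; apply/orP; left; apply/eqP; rewrite -/l; ring.
apply: (pair_contraction (q_ := mass) (K0 := n.+1%:R)) => //.
- by rewrite mulr_gt0//; move: mum0; lra.
- by move=> j; rewrite mass0 mass_le.
- exact: mass_partner.
- move=> j s'; rewrite -[leRHS](Ex_cst P); apply: Ex_le => //; [exact: bN|exact: bmeas_cst].
move=> j K K0 EK s'.
have EK' x : Ex (inc (Ns n (partner j)) (s' - x) (s' + l - x)) <= K.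
  by have := EK (s' - x); rewrite (_ : s' - x + l = s' + l - x)//; ring.
have := Ex_wint_le (lx s') EK'; rewrite partnerK => -[bw Ew].
apply: (@le_trans _ _ (Ex (fun w => inc (Ms n j) s' (s' + l) w + (mu j * l +
    wint (ker j) (fun x => inc (Ns n (partner j)) (s' - x) (s' + l - x) w))))).
  apply: Ex_le; first exact: bN.
    by apply: bmeasD; [exact: bM|apply: bmeasD => //; exact: bmeas_cst].
  move=> w; have := inc_Nstop_le n j w (lx s').
  rewrite (_ : s' + l - s' = l); last by ring.
  by move=> hle; apply: le_trans hle _; rewrite -addrA.
rewrite ExD; [|exact: bM|by apply: bmeasD => //; exact: bmeas_cst].
rewrite [X in _ + X <= _]ExD; [|exact: bmeas_cst|exact: bw].
rewrite Ex_inc_M// add0r Ex_cst; apply: lerD => //.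
rewrite ler_wpM2r ?(ltW l0)//; have := mu_le j; lra.
Qed.

Lemma msqE (X : Omega -> R) : bmeas X -> msq P X = (Ex (fun w => X w ^+ 2))%:E.
Proof. by move=> bX; rewrite Ex_EFin//; exact: bmeasX. Qed.

Lemma Ex_inc_M2 n i s t : s <= t ->
  Ex (fun w => inc (Ms n i) s t w ^+ 2) = Ex (inc (Ns n i) s t).
Proof.
move=> st; have [_ _ br _] := stopped_orthogonal g_ge0 h_ge0 g_int h_int mu_ge0 haw n.
have := br i i s t (fun=> 1) st (bmeas_cst _ 1); rewrite eqxx.
under Ex_eq do rewrite mulr1 mul1r -expr2.
rewrite ExB; [|exact/bmeasX/bM|exact: bN].
by move/eqP; rewrite subr_eq0 => /eqP.
Qed.

Let U_le n i s t w : s <= t ->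
  (`|inc (Ns n i) s t w|%:E <= `|(`|inc (Ms n i) s t w|%R + mu i * (t - s))%R|%:E +
    \int[leb]_x (ker i x * `|inc (Ns n (partner i)) (s - x) (t - x) w|)%:E)%E.
Proof.
move=> st; under eq_integral => x _.
  rewrite (ger0_norm (inc0 _ _ _ _)); last by rewrite lerD2r.
  over.
rewrite -(wint_EFin (ker0 i) (mker i) (kerH i)) //.
have m0 : 0 <= mu i * (t - s) by rewrite mulr_ge0// subr_ge0.
rewrite -EFinD lee_fin ger0_norm ?inc0// ger0_norm ?addr_ge0//.
have := inc_Nstop_le n i w st; have := ler_norm (inc (Ms n i) s t w).
by lra.
Qed.

(** Here the forcing is |M| + mu l, and E M^2 = E N is at most [moment1] l by the first moment;
    hence the bound of order l + l^2, linear for short intervals. *)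
Lemma Ex_inc_N2 : exists2 C2, 0 <= C2 & forall n i s t, s <= t ->
  Ex (fun w => inc (Ns n i) s t w ^+ 2) <= C2 * ((t - s) + (t - s) ^+ 2).
Proof.
have [eps eps0 q3] := exists_contraction_eps r01.
have q1 := contraction_factor eps0 q3.
have e0 : 0 < eps^-1 by rewrite invr_gt0.
pose r := normL1 h * normL1 g.
pose q := (1 + eps) ^+ 2 * r ^+ 2.
pose c := (1 + eps^-1) * (2 * moment1 + 2 * mum ^+ 2) + 1.
have m10 := moment1_ge0.
have c0 : 0 < c.
  rewrite ltr_wpDl//; apply: mulr_ge0; first by lra.
  by have := sqr_ge0 mum; lra.
pose Qm := (1 + eps) * massm ^+ 2.
have Qm0 : 0 <= Qm by rewrite mulr_ge0 ?sqr_ge0//; lra.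
have q01 : 0 <= q < 1 by rewrite q1 mulr_ge0 ?sqr_ge0.
exists (2 * ((1 + Qm) * c) / (1 - q)).
  by rewrite divr_ge0 ?mulr_ge0//; lra.
move=> n i s t; rewrite le_eqVlt => /predU1P[->|st].
  rewrite subrr expr0n addr0 mulr0 le_eqVlt; apply/orP; left; apply/eqP.
  by rewrite -[RHS](Ex_cst P 0); apply: Ex_eq => w; rewrite /inc subrr expr0n.
pose l := t - s; have l0 : 0 < l by rewrite subr_gt0.
have l2 : 0 < l + l ^+ 2 by rewrite addr_gt0// exprn_gt0.
have lx s' : s' <= s' + l by rewrite lerDl ltW.
suff : forall i s', Ex (fun w => inc (Ns n i) s' (s' + l) w ^+ 2) <=
    2 * ((1 + Qm) * (c * (l + l ^+ 2))) / (1 - q).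
  move=> /(_ i s); rewrite /l [s + _]addrC subrK => /le_trans; apply.
  by rewrite le_eqVlt; apply/orP; left; apply/eqP; rewrite -/l; ring.
apply: (pair_contraction (q_ := fun i => (1 + eps) * mass i ^+ 2) (K0 := n.+1%:R ^+ 2)).
- exact: mulr_gt0.
- exact: q01.
- move=> j; rewrite mulr_ge0 ?sqr_ge0//=; last by lra.
  by rewrite /Qm ler_wpM2l ?lerXn2r ?nnegrE//; lra.
- by move=> j; rewrite /q /r -(mass_partner j); ring.
- exact: sqr_ge0.
- move=> j s'; rewrite -[leRHS](Ex_cst P); apply: Ex_le.
  + exact/bmeasX/bN.
  + exact: bmeas_cst.
  + by move=> w; rewrite lerXn2r ?nnegrE// inc0.
move=> j K K0 EK s'.
have EK' x : (msq P (inc (Ns n (partner j)) (s' - x) (s' + l - x)%R) <= K%:E)%E.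
  rewrite msqE; last by apply: bN; rewrite lerD2r.
  by rewrite lee_fin; have := EK (s' - x); rewrite (_ : s' - x + l = s' + l - x)//; ring.
have bX : bmeas (fun w => `|inc (Ms n j) s' (s' + l) w| + mu j * (s' + l - s')).
  apply: bmeasD; last exact: bmeas_cst.
  have [mM [L ML]] := bM n j (lx s'); split; first exact: measurableT_comp.
  by exists L => w; rewrite normr_id.
have := perturbed_integral_const (ker0 j) (mker j) (kerH j) eps0 (bN n j (lx s')).1
  bX.1 (@joint n (partner j) s' (s' + l)) (aeW P (fun w => U_le n j w (lx s'))) EK'.
rewrite -/(msq P _) -/(msq P _) !msqE//; last exact: bN.
rewrite -EFinM -EFinD lee_fin => /le_trans; apply.
rewrite lerD2r.
have EX : Ex (fun w => (`|inc (Ms n j) s' (s' + l) w| + mu j * (s' + l - s')) ^+ 2) <=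
    2 * (moment1 * l) + 2 * (mum * l) ^+ 2.
  rewrite (_ : s' + l - s' = l); last by ring.
  apply: (@le_trans _ _ (Ex (fun w => 2 * inc (Ms n j) s' (s' + l) w ^+ 2 + 2 * (mu j * l) ^+ 2))).
    apply: Ex_le.
    - by apply: bmeasX; move: bX; rewrite (_ : s' + l - s' = l)//; ring.
    - by apply: bmeasD; [apply: bmeasM; [exact: bmeas_cst|exact/bmeasX/bM]|exact: bmeas_cst].
    move=> w; rewrite -(real_normK (num_real (inc _ _ _ _))); set a := `|_|.
    rewrite -subr_ge0 [X in 0 <= X](_ : _ = (a - mu j * l) ^+ 2) ?sqr_ge0//; ring.
  rewrite ExD; [|by apply: bmeasM; [exact: bmeas_cst|exact/bmeasX/bM]|exact: bmeas_cst].
  rewrite ExZ ?Ex_cst; last exact/bmeasX/bM.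
  rewrite Ex_inc_M2//; apply: lerD.
    rewrite ler_pM2l//; have := Ex_inc_N n j (lx s').
    by rewrite (_ : s' + l - s' = l)//; ring.
  rewrite ler_pM2l// lerXn2r ?nnegrE ?mulr_ge0 ?(ltW l0)//.
  by rewrite ler_wpM2r ?(ltW l0).
apply: (@le_trans _ _ ((1 + eps^-1) * (2 * (moment1 * l) + 2 * (mum * l) ^+ 2))).
  by rewrite ler_wpM2l//; lra.
rewrite /c; have : 0 <= moment1 * l ^+ 2 by rewrite mulr_ge0 ?sqr_ge0.
have : 0 <= mum ^+ 2 * l by rewrite mulr_ge0 ?sqr_ge0// ltW.
move=> h1 h2; rewrite -subr_ge0.
rewrite [X in 0 <= X](_ : _ = (1 + eps^-1) * (2 * (moment1 * l ^+ 2) +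
  2 * (mum ^+ 2 * l)) + (l + l ^+ 2)); last by ring.
apply: addr_ge0; last exact: ltW.
by apply: mulr_ge0; lra.
Qed.

Lemma Ex_inc_M4 n i s t : s <= t ->
  Ex (fun w => inc (Ms n i) s t w ^+ 4) <= 294 * Ex (fun w => inc (Ns n i) s t w ^+ 2).
Proof.
move=> st; have [_ _ _ four] := stopped_orthogonal g_ge0 h_ge0 g_int h_int mu_ge0 haw n.
exact: four.
Qed.

(** The perturbed Jensen inequality is used twice: pathwise to bound the square of the increment,
    then in mean square on these squares. One passage costs (1 + eps)^3 mass^4. The forcing needs E
    M^4, which is bounded by the second moment of N. *)
Lemma Ex_inc_N4 l : 0 < l -> exists2 C4, 0 <= C4 & forall n i s,
  Ex (fun w => inc (Ns n i) s (s + l) w ^+ 4) <= C4.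
Proof.
move=> l0; have [C2 C20 EN2] := Ex_inc_N2.
have lx s' : s' <= s' + l by rewrite lerDl ltW.
have [eps eps0 q3] := exists_contraction_eps r01.
have e0 : 0 < eps^-1 by rewrite invr_gt0.
have e1 : 0 <= 1 + eps^-1 by lra.
pose r := normL1 h * normL1 g.
pose q := ((1 + eps) ^+ 3 * r ^+ 2) ^+ 2.
have q01 : 0 <= q < 1 by rewrite sqr_ge0 expr_lt1// mulr_ge0 ?sqr_ge0// exprn_ge0//; lra.
(* From (a + c)^4 <= 8 a^4 + 8 c^4 with a = |M| and c the baseline term; 294 comes from the fourth
   moment of M. *)
pose B := 8 * (294 * (C2 * (l + l ^+ 2))) + 8 * (mum * l) ^+ 4.
have B0 : 0 <= B.
  have : 0 <= (mum * l) ^+ 4 by rewrite exprn_ge0// mulr_ge0// ltW.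
  have : 0 <= C2 * (l + l ^+ 2) by rewrite mulr_ge0// addr_ge0 ?sqr_ge0// ltW.
  by rewrite /B; lra.
pose b := (1 + eps^-1) ^+ 3 * B + 1.
have b0 : 0 < b by rewrite ltr_wpDl// mulr_ge0// exprn_ge0.
pose Qm := (1 + eps) ^+ 3 * massm ^+ 4.
have Qm0 : 0 <= Qm by rewrite mulr_ge0 ?exprn_ge0//; lra.
exists (2 * ((1 + Qm) * b) / (1 - q)).
  by rewrite divr_ge0 ?mulr_ge0//; lra.
move=> n.
apply: (pair_contraction (q_ := fun i => (1 + eps) ^+ 3 * mass i ^+ 4) (K0 := n.+1%:R ^+ 4)).
- exact: b0.
- exact: q01.
- move=> j; rewrite mulr_ge0 ?exprn_ge0//=; last by lra.
  by rewrite /Qm ler_wpM2l ?lerXn2r ?nnegrE// exprn_ge0//; lra.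
- by move=> j; rewrite /q /r -(mass_partner j); ring.
- by rewrite exprn_ge0.
- move=> j s'; rewrite -[leRHS](Ex_cst P); apply: Ex_le.
  + exact/bmeasX/bN.
  + exact: bmeas_cst.
  + by move=> w; rewrite lerXn2r ?nnegrE// inc0.
move=> j K K0 EK s'.
have bX : bmeas (fun w => `|inc (Ms n j) s' (s' + l) w| + mu j * (s' + l - s')).
  apply: bmeasD; last exact: bmeas_cst.
  have [mM [L ML]] := bM n j (lx s'); split; first exact: measurableT_comp.
  by exists L => w; rewrite normr_id.
pose X w := (1 + eps^-1) * (`|inc (Ms n j) s' (s' + l) w| + mu j * (s' + l - s')) ^+ 2.
pose Z x w := (1 + eps) * mass j * inc (Ns n (partner j)) (s' - x) (s' + l - x) w ^+ 2.
have bX2 : bmeas X by apply: bmeasM; [exact: bmeas_cst|exact: bmeasX].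
have c0 : 0 <= (1 + eps) * mass j by rewrite mulr_ge0//; lra.
have UXZ w : (`|inc (Ns n j) s' (s' + l) w ^+ 2|%:E <= `|X w|%:E +
    \int[leb]_x (ker j x * `|Z x w|)%:E)%E.
  have := perturbed_sqr_le (ker0 j) (mker j) (kerH j) eps0
    (bpath n (partner j) s' (s' + l) w).1 (U_le n j w (lx s')).
  have X0 : 0 <= X w by rewrite /X mulr_ge0// sqr_ge0.
  rewrite (ger0_norm (sqr_ge0 _)) (ger0_norm X0).
  move=> /le_trans; apply; rewrite leeD2l// le_eqVlt; apply/orP; left; apply/eqP.
  by apply: eq_integral => x _; rewrite ger0_norm// /Z mulr_ge0// sqr_ge0.
have mZ : measurable_fun setT (fun p : R * Omega => Z p.1 p.2).
  apply: measurable_funM; first exact: measurable_cst.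
  by apply: measurable_funX; exact: (@joint n (partner j) s' (s' + l)).
have ZK x : (\int[P]_w (Z x w ^+ 2)%:E <= (((1 + eps) * mass j) ^+ 2 * K)%:E)%E.
  have bNx : bmeas (inc (Ns n (partner j)) (s' - x) (s' + l - x)).
    by apply: bN; rewrite lerD2r.
  have bZ : bmeas (Z x) by apply: bmeasM; [exact: bmeas_cst|exact: bmeasX].
  rewrite -Ex_EFin; last exact: bmeasX.
  rewrite lee_fin.
  have -> : Ex (fun w => Z x w ^+ 2) = Ex (fun w => ((1 + eps) * mass j) ^+ 2 *
      inc (Ns n (partner j)) (s' - x) (s' + l - x) w ^+ 4).
    by apply: Ex_eq => w; rewrite /Z; ring.
  rewrite ExZ; last exact: bmeasX.
  rewrite ler_wpM2l ?sqr_ge0//.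
  by have := EK (s' - x); rewrite (_ : s' - x + l = s' + l - x)//; ring.
have := perturbed_integral_const (ker0 j) (mker j) (kerH j) eps0
  (bmeasX 2 (bN n j (lx s'))).1 bX2.1 mZ (aeW P UXZ) ZK.
rewrite -!Ex_EFin; [|exact: bmeasX|by apply: bmeasX; apply: bmeasX; exact: bN].
have -> : Ex (fun w => (inc (Ns n j) s' (s' + l) w ^+ 2) ^+ 2) =
    Ex (fun w => inc (Ns n j) s' (s' + l) w ^+ 4).
  by apply: Ex_eq => w; rewrite -exprM.
rewrite -EFinM -EFinD lee_fin => /le_trans; apply.
have EX : Ex (fun w => X w ^+ 2) <= (1 + eps^-1) ^+ 2 * B.
  apply: (@le_trans _ _ (Ex (fun w => (1 + eps^-1) ^+ 2 *
     (8 * inc (Ms n j) s' (s' + l) w ^+ 4 + 8 * (mu j * l) ^+ 4)))).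
    apply: Ex_le.
    - exact: bmeasX.
    - apply: bmeasM; first exact: bmeas_cst.
      by apply: bmeasD; [apply: bmeasM; [exact: bmeas_cst|exact/bmeasX/bM]|exact: bmeas_cst].
    move=> w; rewrite /X exprMn ler_wpM2l ?sqr_ge0//.
    rewrite (_ : s' + l - s' = l); last by ring.
    rewrite -exprM (_ : inc (Ms n j) s' (s' + l) w ^+ 4 = `|inc (Ms n j) s' (s' + l) w| ^+ 4); last first.
      by rewrite -normrX ger0_norm// exprn_even_ge0.
    set a := `|_|; set c := mu j * l.
    rewrite -subr_ge0 [X in 0 <= X](_ : _ =
      (a - c) ^+ 2 * (7 * a ^+ 2 + 10 * (a * c) + 7 * c ^+ 2)); last by ring.
    have c_ge0 : 0 <= c by rewrite /c mulr_ge0 ?mu_ge0// ltW.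
    have ac0 : 0 <= a * c by rewrite mulr_ge0 ?normr_ge0.
    apply: mulr_ge0; first exact: sqr_ge0.
    by have := sqr_ge0 a; have := sqr_ge0 c; lra.
  rewrite ExZ; last first.
    by apply: bmeasD; [apply: bmeasM; [exact: bmeas_cst|exact/bmeasX/bM]|exact: bmeas_cst].
  rewrite ler_wpM2l ?sqr_ge0//.
  rewrite ExD; [|by apply: bmeasM; [exact: bmeas_cst|exact/bmeasX/bM]|exact: bmeas_cst].
  rewrite ExZ ?Ex_cst; last exact/bmeasX/bM.
  rewrite /B; apply: lerD; rewrite ler_pM2l//.
    apply: le_trans (Ex_inc_M4 n j (lx s')) _; apply: ler_wpM2l; first exact: ler0n.
    by have := EN2 n j _ _ (lx s'); rewrite (_ : s' + l - s' = l)//; ring.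
  by rewrite lerXn2r ?nnegrE ?mulr_ge0 ?(ltW l0)// ler_wpM2r ?(ltW l0).
have : (1 + eps^-1) * Ex (fun w => X w ^+ 2) <= (1 + eps^-1) * ((1 + eps^-1) ^+ 2 * B).
  by rewrite ler_wpM2l.
rewrite (_ : (1 + eps^-1) * ((1 + eps^-1) ^+ 2 * B) = (1 + eps^-1) ^+ 3 * B); last by ring.
rewrite (_ : (1 + eps) * mass j ^+ 2 * (((1 + eps) * mass j) ^+ 2 * K) =
  (1 + eps) ^+ 3 * mass j ^+ 4 * K); last by ring.
by rewrite /b; lra.
Qed.

End stopped_moments.

(** * Absence of explosion and removal of the stopping *)

Section limit_processes.
Context d (Omega : measurableType d) (R : realType) (P : probability Omega R).
Local Notation leb := (@lebesgue_measure R).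
Local Notation Ex := (Ex P).
Variables (g h : R -> R).
Hypothesis g_ge0 : forall t, 0 <= t -> 0 <= g t.
Hypothesis h_ge0 : forall t, 0 <= t -> 0 <= h t.
Hypothesis g_int : leb.-integrable `[0, +oo[ (EFin \o g).
Hypothesis h_int : leb.-integrable `[0, +oo[ (EFin \o h).
Hypothesis hg_lt1 : normL1 h * normL1 g < 1.
Variables (mu : 'I_4 -> R) (mu_ge0 : forall i, 0 <= mu i).
Variables (tm : nat -> Omega -> \bar R) (mk : nat -> Omega -> 'I_4).
Hypothesis haw : is_hawkes P tm mk mu (kernel4 g h).

Let mpts : marked_points tm mk. Proof. by case: haw. Qed.
Local Notation CN := (counting_process tm mk).
Local Notation Ns := (Nstop tm mk).
Local Notation Ms := (Mstop g h mu tm mk).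
Local Notation ker := (ker g h).
Local Notation mass := (mass g h).
Let ker0 i s : 0 <= ker i s. Proof. exact: ker_ge0. Qed.
Let mker i : measurable_fun setT (ker i). Proof. exact: measurable_ker. Qed.
Let kerH i : (\int[leb]_s (ker i s)%:E = (mass i)%:E)%E. Proof. exact: integral_ker. Qed.

(** [fine] changes the value only where infinitely many points accumulate, an event shown below to
    be negligible. *)
Definition Nproc i t w : R := fine (CN i t w).

Definition Aproc i t w : R := mu i * Num.max t 0 +
  wint (ker i) (fun x => Nproc (partner i) (t - x) w).

Definition Mproc i t w : R := Nproc i t w - Aproc i t w.

Definition locally_finite w := forall t : R, exists n, (t%:E < tm n w)%E.

Lemma Nproc_stop n i t w : (t%:E <= tm n w)%E -> Nproc i t w = Ns n i t w.
Proof. by move=> tn; rewrite /Nproc (counting_Nstop mpts _ tn). Qed.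

Lemma Aproc_stop n i t w : (t%:E <= tm n w)%E ->
  Aproc i t w = mu i * Num.max t 0 + wint (ker i) (fun x => Ns n (partner i) (t - x) w).
Proof.
move=> tn; congr (_ + _); apply: eq_Rintegral => x _.
have [->|/ker_neq0 x0] := eqVneq (ker i x) 0; first by rewrite !mul0r.
by rewrite (@Nproc_stop n)//; apply: le_trans tn; rewrite lee_fin; lra.
Qed.

Lemma Mproc_stop n i t w : (t%:E <= tm n w)%E -> Mproc i t w = Ms n i t w.
Proof.
move=> tn; rewrite /Mproc (Nproc_stop i tn) (Aproc_stop i tn) /Mstop /Astop /Afree.
by rewrite stopE tn.
Qed.

Lemma stop_eventually w (t : R) : locally_finite w ->
  \forall n \near \oo, forall s, s <= t -> (s%:E <= tm n w)%E.
Proof.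
move=> /(_ t)[n tn]; exists n => // m /= nm s st.
apply: le_trans (tm_le mpts _ nm); apply: le_trans (ltW tn).
by rewrite lee_fin.
Qed.

Lemma inc_Nproc_eventually i s t w : locally_finite w -> s <= t ->
  \forall n \near \oo, inc (Ns n i) s t w = inc (Nproc i) s t w.
Proof.
move=> lw st; apply: filterS (stop_eventually t lw) => n tn.
by rewrite /inc (Nproc_stop i (tn s st)) (Nproc_stop i (tn t (lexx t))).
Qed.

Lemma inc_Mproc_eventually i s t w : locally_finite w -> s <= t ->
  \forall n \near \oo, inc (Ms n i) s t w = inc (Mproc i) s t w.
Proof.
move=> lw st; apply: filterS (stop_eventually t lw) => n tn.
by rewrite /inc (Mproc_stop i (tn s st)) (Mproc_stop i (tn t (lexx t))).
Qed.

(** If all the points occur before m, the four stopped processes at time m add up to n + 1. Their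
    expectations add up to at most 4 [moment1] m whatever n is, so this event has probability
    zero. *)
Lemma ae_locally_finite : {ae P, forall w, locally_finite w}.
Proof.
have tm_meas n : measurable_fun setT (tm n) by case: mpts.
pose A (m : nat) : set Omega := \bigcap_n [set w | (tm n w <= m%:R%:E)%E].
have mA m : measurable (A m).
  apply: bigcapT_measurable => n.
  by rewrite -[X in measurable X]setTI; apply: emeasurable_fun_infty_c.
have PA m : P (A m) = 0%E.
  have bI : bmeas (\1_(A m) : Omega -> R).
    split; first exact: measurable_indic.
    by exists 1 => w; rewrite indicE ger0_norm//; case: (_ \in _).
  have EI : (Ex (\1_(A m)))%:E = P (A m).
    by rewrite Ex_EFin// integral_indic// setIT.
  pose K := 4 * (moment1 g h mu * m%:R).
  have m10 := moment1_ge0 g_ge0 h_ge0 g_int h_int hg_lt1 mu_ge0.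
  have K0 : 0 <= K by apply: mulr_ge0 => //; apply: mulr_ge0.
  have le n : n.+1%:R * Ex (\1_(A m)) <= K.
    rewrite -ExZ//.
    have bN i : bmeas (inc (Ns n i) 0 m%:R).
      have [_ aN _ _] := stopped_orthogonal g_ge0 h_ge0 g_int h_int mu_ge0 haw n.
      apply: (adapted_bmeas (fil_meas haw (t := m%:R)) (aN i 0 m%:R _)).
      exact: ler0n.
    apply: (@le_trans _ _ (Ex (fun w => \sum_(i < 4) inc (Ns n i) 0 m%:R w))).
      apply: Ex_le.
      - by apply: bmeasM => //; exact: bmeas_cst.
      - exact: bmeas_sum.
      move=> w; rewrite indicE; have [wA|_] := boolP (w \in A m); last first.
        rewrite mulr0 sumr_ge0// => i _; rewrite subr_ge0.
        by apply: Nstop_nd; exact: ler0n.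
      rewrite mulr1 /inc sumrB [X in _ - X]big1 ?subr0; last first.
        by move=> i _; rewrite Nstop0.
      rewrite /Nstop exchange_big/= -[X in X%:R](card_ord n.+1) -sumr_const.
      apply: ler_sum => k _; rewrite (bigD1 (mk k w))//= /pt_before eqxx andbT.
      have := set_mem wA => /(_ k I) /= ->.
      by rewrite lerDl sumr_ge0.
    rewrite Ex_sum//; apply: (@le_trans _ _ (\sum_(i < 4) (moment1 g h mu * m%:R))).
      apply: ler_sum => i _.
      have := Ex_inc_N g_ge0 h_ge0 g_int h_int hg_lt1 mu_ge0 haw n i (ler0n R m).
      by rewrite subr0.
    by rewrite sumr_const card_ord /K mulr_natl.
  have E0 : 0 <= Ex (\1_(A m)) by apply: Ex_ge0 => w; rewrite indicE.
  rewrite -EI; congr EFin; apply/eqP; rewrite eq_le E0 andbT leNgt; apply/negP => Ep.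
  have := le (Num.truncn (K / Ex (\1_(A m)))).
  rewrite leNgt => /negP; apply.
  by rewrite -ltr_pdivrMr// truncnS_gt.
have Neg : P.-negligible (\bigcup_m A m).
  by apply: negligible_bigcup => m; exists (A m); split; [exact: mA|exact: PA|].
apply: negligibleS Neg => w /= nl; apply: contrapT => nA; apply: nl => t.
have [m tm'] : exists m : nat, t < m%:R.
  by exists (Num.truncn t).+1; exact: truncnS_gt.
apply: contrapT => nn; apply: nA; exists m => // n _ /=.
rewrite leNgt; apply/negP => mn; apply: nn; exists n.
by apply: lt_trans mn; rewrite lte_fin.
Qed.

(** Off the negligible explosion event, a functional of finitely many times sees no stopping once n
    is large; Fatou then transfers any bound that is uniform in n. *)
Lemma fatou_bound (F : nat -> Omega -> R) (f : Omega -> R) (K : R) :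
  (forall n, bmeas (F n)) -> (forall n w, 0 <= F n w) -> measurable_fun setT f ->
  (forall w, 0 <= f w) -> (forall n, Ex (F n) <= K) ->
  (forall w, locally_finite w -> \forall n \near \oo, F n w = f w) ->
  (\int[P]_w (f w)%:E <= K%:E)%E.
Proof.
move=> bF F0 mf f0 FK Ff.
have mF n : measurable_fun setT (fun w => (F n w)%:E) by exact: measurable_EFinT (bF n).1.
have lim w : locally_finite w -> limn_einf (fun n => (F n w)%:E) = (f w)%:E.
  move=> /Ff Fw; apply: (@cvg_limn_einf_sup _ _ _ _).1.
  by apply: cvg_near_cst; apply: filterS Fw => n ->.
have mlim : measurable_fun setT (fun w => limn_einf (fun n => (F n w)%:E)).
  have -> : (fun w => limn_einf (fun n => (F n w)%:E)) =
      (fun w => - limn_esup (fun n => (- F n w)%:E))%E.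
    apply/funext => w; rewrite -limn_einfN; congr limn_einf.
    by apply/funext => n /=; rewrite opprK.
  apply: measurableT_comp => //; apply: measurable_fun_limn_esup => n.
  by apply: measurable_EFinT; apply: measurable_funN; exact: (bF n).1.
rewrite (@ae_eq_integral _ _ _ P setT (fun w => limn_einf (fun n => (F n w)%:E)))//.
- apply: le_trans (fatou P measurableT mF _) _; first by move=> n w _; rewrite lee_fin.
  rewrite limn_einf_lim; apply: lime_le; first exact: is_cvg_einfs.
  apply: nearW => n; apply: (@le_trans _ _ (\int[P]_w (F n w)%:E)%E).
    by apply: ereal_inf_lbound; exists n => //=.
  by rewrite -Ex_EFin// lee_fin.
- exact: measurable_EFinT.
- by apply: filterS ae_locally_finite => w lw _; rewrite lim.
Qed.

End limit_processes.

(** * Functionals linear in increments, and their renewal equation *)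

Section linear_functionals.
Context (R : realType).

(** The common shape of the three applications: constant coefficients for the law of large numbers,
    and for a covariation the increments of the other process, frozen together with the outcome.
    Only b is translated by the renewal equation. *)
Definition lin p (c u v : nat -> R) (f : R -> R) (b : R) : R :=
  \sum_(r < p) c r * (f (b + v r) - f (b + u r)).

Lemma linB p c u v f f' b :
  lin p c u v (fun t => f t - f' t) b = lin p c u v f b - lin p c u v f' b.
Proof. by rewrite /lin -sumrB; apply: eq_bigr => r _; ring. Qed.

Local Notation leb := (@lebesgue_measure R).
Variables (k : R -> R) (H : R).
Hypotheses (k0 : forall s, 0 <= k s) (mk : measurable_fun setT k).
Hypothesis (kH : (\int[leb]_s (k s)%:E = H%:E)%E).

(** Subtracts the deterministic centres [al] and [y] from both sides of the renewal equation; if the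
    centres solve their own equation, only the centred forcing remains. *)
Lemma renewal_abs_le (Y X al : R) (L Z y : R -> R) : bmeas L -> bmeas y ->
  Y = X + wint k L -> (forall x, k x != 0 -> L x = Z x) ->
  (`|Y - al|%:E <= `|X - (al - wint k y)|%:E + \int[leb]_x (k x * `|Z x - y x|)%:E)%E.
Proof.
move=> bL bY -> LZ.
have -> : (X + wint k L - al = (X - (al - wint k y)) + wint k (fun x => L x - y x)).
  by rewrite (wintB k0 mk kH)//; ring.
apply: (@le_trans _ _ (`|X - (al - wint k y)| + `|wint k (fun x => L x - y x)|)%:E).
  by rewrite lee_fin ler_normD.
rewrite EFinD leeD2l//; apply: le_trans (wint_norm_le k0 mk kH _) _; first exact: bmeasB.
rewrite le_eqVlt; apply/orP; left; apply/eqP; apply: eq_integral => x _.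
by have [->|/LZ ->//] := eqVneq (k x) 0; rewrite !mul0r.
Qed.

End linear_functionals.

Section limit_bounds.
Context d (Omega : measurableType d) (R : realType) (P : probability Omega R).
Local Notation leb := (@lebesgue_measure R).
Local Notation Ex := (Ex P).
Variables (g h : R -> R).
Hypothesis g_ge0 : forall t, 0 <= t -> 0 <= g t.
Hypothesis h_ge0 : forall t, 0 <= t -> 0 <= h t.
Hypothesis g_int : leb.-integrable `[0, +oo[ (EFin \o g).
Hypothesis h_int : leb.-integrable `[0, +oo[ (EFin \o h).
Hypothesis hg_lt1 : normL1 h * normL1 g < 1.
Variables (mu : 'I_4 -> R) (mu_ge0 : forall i, 0 <= mu i).
Variables (tm : nat -> Omega -> \bar R) (mk : nat -> Omega -> 'I_4).
Hypothesis haw : is_hawkes P tm mk mu (kernel4 g h).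

Let mpts : marked_points tm mk. Proof. by case: haw. Qed.
Local Notation CN := (counting_process tm mk).
Local Notation Ns := (Nstop tm mk).
Local Notation Ms := (Mstop g h mu tm mk).
Local Notation Np := (Nproc tm mk).
Local Notation Mp := (Mproc g h mu tm mk).
Local Notation ker := (ker g h).
Local Notation mass := (mass g h).
Local Notation lf := (locally_finite tm).
Let ker0 i s : 0 <= ker i s. Proof. exact: ker_ge0. Qed.
Let mker i : measurable_fun setT (ker i). Proof. exact: measurable_ker. Qed.
Let kerH i : (\int[leb]_s (ker i s)%:E = (mass i)%:E)%E. Proof. exact: integral_ker. Qed.
Let orth n := stopped_orthogonal g_ge0 h_ge0 g_int h_int mu_ge0 haw n.

Lemma measurable_counting_joint i :
  measurable_fun setT (fun p : R * Omega => CN i p.1 p.2).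
Proof.
apply: (measurable_nneseriesT (f := fun n (p : R * Omega) =>
    if (tm n p.2 <= p.1%:E)%E && (mk n p.2 == i) then 1%E else 0%E : \bar R)).
  by move=> n w; case: ifP.
move=> n.
have := measurable_EFinT (measurable_pt_before mpts n i).
by apply: eq_measurable_fun => p _; rewrite /pt_before; case: (_ && _).
Qed.

Lemma measurable_Nproc_joint i :
  measurable_fun setT (fun p : R * Omega => Np i p.1 p.2).
Proof. by apply: measurableT_comp (measurable_counting_joint i). Qed.

Lemma measurable_Nproc i t : measurable_fun setT (Np i t).
Proof. exact: (measurableT_comp (measurable_Nproc_joint i) (pair1_measurable t)). Qed.

Lemma Nproc_ge0 i t w : 0 <= Np i t w.
Proof. by apply: fine_ge0; apply: nneseries_ge0 => n _ _; case: ifP. Qed.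

Lemma measurable_Mproc i t : measurable_fun setT (Mp i t).
Proof.
apply: measurable_funB; first exact: measurable_Nproc.
apply: measurable_funD; first exact: measurable_cst.
rewrite /wint /Rintegral; apply: measurableT_comp => //.
apply: (measurable_integral_l leb (f := fun x w => (ker i x * Np (partner i) (t - x) w)%:E)).
  apply: measurable_EFinT; apply: measurable_funM.
    exact: (measurableT_comp (mker i) measurable_fst).
  have mg : measurable_fun setT (fun p : R * Omega => (t - p.1, p.2)).
    apply: measurable_fun_pair; last exact: measurable_snd.
    by apply: measurable_funB; [exact: measurable_cst|exact: measurable_fst].
  exact: (measurableT_comp (measurable_Nproc_joint (partner i)) mg).
by move=> x w; rewrite lee_fin mulr_ge0// Nproc_ge0.
Qed.

Lemma measurable_incM i s t : measurable_fun setT (inc (Mp i) s t).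
Proof. by apply: measurable_funB; exact: measurable_Mproc. Qed.

Lemma measurable_incN i s t : measurable_fun setT (inc (Np i) s t).
Proof. by apply: measurable_funB; exact: measurable_Nproc. Qed.

Let inc_stop n t w : (forall s, s <= t -> (s%:E <= tm n w)%E) ->
  forall i a b, a <= t -> b <= t ->
  inc (Ns n i) a b w = inc (Np i) a b w /\ inc (Ms n i) a b w = inc (Mp i) a b w.
Proof.
move=> tn i a b at_ bt; rewrite /inc.
by rewrite !(Nproc_stop haw i (tn _ at_), Nproc_stop haw i (tn _ bt),
  Mproc_stop haw i (tn _ at_), Mproc_stop haw i (tn _ bt)).
Qed.

Let bN n i s t : s <= t -> bmeas (inc (Ns n i) s t).
Proof.
by move=> st; have [_ aN _ _] := orth n; exact: (adapted_bmeas (fil_meas haw (t := t)) (aN i s t st)).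
Qed.

Let bM n i s t : s <= t -> bmeas (inc (Ms n i) s t).
Proof.
move=> st; have [aM _ _ _] := orth n.
by apply: (adapted_bmeas (fil_meas haw (t := t))); apply: (inc_adp (fil_mono (mk := mk) (tm := tm))) => //; exact: (aM i).1.
Qed.

Lemma msq_sum_incM i D lo hi p : 0 <= D -> lo <= hi -> hi <= lo + D ->
  (msq P (fun w => \sum_(r < p) inc (Mp i) (lo + r%:R * D) (hi + r%:R * D) w)%R <=
  (p%:R * (moment1 g h mu * D))%:E)%E.
Proof.
move=> D0 lohi hiD.
have le r : lo + r%:R * D <= hi + r%:R * D :> R by rewrite lerD2r.
apply: (fatou_bound g_ge0 h_ge0 g_int h_int hg_lt1 mu_ge0 haw
  (F := fun n w => (\sum_(r < p) inc (Ms n i) (lo + r%:R * D) (hi + r%:R * D) w) ^+ 2)).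
- by move=> n; apply: bmeasX; apply: bmeas_sum => r; exact: bM.
- by move=> n w; exact: sqr_ge0.
- by apply: measurable_funX; apply: measurable_sum => r; exact: measurable_incM.
- by move=> w; exact: sqr_ge0.
- move=> n.
  rewrite (sum_inc_sqr (fil_meas haw) (fil_mono (mk := mk) (tm := tm)) (orth n) i p lohi hiD).
  rewrite mulr_natl -[X in _ *+ X](card_ord p) -sumr_const; apply: ler_sum => r _.
  apply: le_trans (Ex_inc_N g_ge0 h_ge0 g_int h_int hg_lt1 mu_ge0 haw n i (le r)) _.
  rewrite ler_wpM2l//; first exact: (moment1_ge0 g_ge0 h_ge0 g_int h_int hg_lt1 mu_ge0).
  by lra.
- move=> w lw; apply: filterS (stop_eventually haw (hi + p%:R * D) lw) => n tn.
  congr (_ ^+ 2); apply: eq_bigr => r _.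
  have rp : hi + r%:R * D <= hi + p%:R * D by rewrite lerD2l ler_wpM2r// ler_nat (ltnW (ltn_ord r)).
  by have [] := inc_stop tn i (le_trans (le r) rp) rp.
Qed.

Lemma msq_prod_sum : exists2 C2, 0 <= C2 & forall D i j a b p, 0 < D ->
  (msq P (prod_sum_error Mp Np D i j a b p) <=
  (p%:R * (4000 * (C2 * (D + D ^+ 2))))%:E)%E.
Proof.
have [C2 C20 HC2] := Ex_inc_N2 g_ge0 h_ge0 g_int h_int hg_lt1 mu_ge0 haw.
exists C2 => // D i j a b p D0.
have lle x r : x + r%:R * D <= x + D + r%:R * D :> R by rewrite lerD2r lerDl ltW.
have lmx r : Num.max a b + r%:R * D <= Num.max (Num.max a b) (Num.min a b + D) + r%:R * D.
  by rewrite lerD2r le_max lexx.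
have N2 n : forall i s t, s <= t -> t <= s + D ->
    Ex (fun w => inc (Ns n i) s t w ^+ 2) <= C2 * (D + D ^+ 2).
  move=> l s t st tD; apply: le_trans (HC2 n l s t st) _; rewrite ler_wpM2l//.
  apply: lerD; first by lra.
  by rewrite lerXn2r ?nnegrE; lra.
apply: (fatou_bound g_ge0 h_ge0 g_int h_int hg_lt1 mu_ge0 haw
  (F := fun n w => prod_sum_error (Ms n) (Ns n) D i j a b p w ^+ 2)).
- move=> n; apply: bmeasX; apply: bmeas_sum => r; apply: bmeasB.
    by apply: bmeasM; apply: bM.
  by apply: bmeasM; [exact: bmeas_cst|exact: bN].
- by move=> n w; exact: sqr_ge0.
- apply: measurable_funX; apply: measurable_sum => r; apply: measurable_funB.
    by apply: measurable_funM; exact: measurable_incM.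
  by apply: measurable_funM; [exact: measurable_cst|exact: measurable_incN].
- by move=> w; exact: sqr_ge0.
- by move=> n; apply: (prod_sum_error_le (fil_meas haw) (fil_mono (mk := mk) (tm := tm)) (orth n) i j a b p D0 (N2 n)).
- move=> w lw.
  pose t := Num.max a b + D + p%:R * D.
  apply: filterS (stop_eventually haw t lw) => n tn.
  congr (_ ^+ 2); apply: eq_bigr => r _.
  have rp : r%:R * D <= p%:R * D by rewrite ler_wpM2r ?(ltW D0)// ler_nat (ltnW (ltn_ord r)).
  have am : a <= Num.max a b by rewrite le_max lexx.
  have bm : b <= Num.max a b by rewrite le_max lexx orbT.
  have aD : a + D + r%:R * D <= t by rewrite /t; lra.
  have bD : b + D + r%:R * D <= t by rewrite /t; lra.
  have mD : Num.max (Num.max a b) (Num.min a b + D) + r%:R * D <= t.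
    apply: lerD => //; rewrite ge_max lerDl (ltW D0)/= lerD2r.
    by rewrite ge_min am.
  have [_ ->] := inc_stop tn i (le_trans (lle a r) aD) aD.
  have [_ ->] := inc_stop tn j (le_trans (lle b r) bD) bD.
  by have [-> _] := inc_stop tn i (le_trans (lmx r) mD) mD.
Qed.

Lemma fourth_bounds l : 0 < l -> exists2 C4, 0 <= C4 & forall i s,
  ((\int[P]_w (inc (Np i) s (s + l)%R w ^+ 4)%:E <= C4%:E) /\
   (\int[P]_w (inc (Mp i) s (s + l)%R w ^+ 4)%:E <= C4%:E))%E.
Proof.
move=> l0; have lx s' : s' <= s' + l by rewrite lerDl ltW.
have [C2 C20 HC2] := Ex_inc_N2 g_ge0 h_ge0 g_int h_int hg_lt1 mu_ge0 haw.
have [C4 C40 HC4] := Ex_inc_N4 g_ge0 h_ge0 g_int h_int hg_lt1 mu_ge0 haw l0.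
have k0 : 0 <= 294 * (C2 * (l + l ^+ 2)).
  apply: mulr_ge0; first exact: ler0n.
  by apply: mulr_ge0 C20 _; apply: addr_ge0; [exact: ltW|exact: sqr_ge0].
exists (C4 + 294 * (C2 * (l + l ^+ 2))); first exact: addr_ge0.
move=> i s; split.
  apply: (fatou_bound g_ge0 h_ge0 g_int h_int hg_lt1 mu_ge0 haw
    (F := fun n w => inc (Ns n i) s (s + l) w ^+ 4)).
  - by move=> n; apply: bmeasX; exact: bN.
  - by move=> n w; rewrite exprn_even_ge0.
  - by apply: measurable_funX; exact: measurable_incN.
  - by move=> w; rewrite exprn_even_ge0.
  - by move=> n; have := HC4 n i s; lra.
  - move=> w lw; apply: filterS (inc_Nproc_eventually haw i lw (lx s)) => n -> //.
apply: (fatou_bound g_ge0 h_ge0 g_int h_int hg_lt1 mu_ge0 haw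
  (F := fun n w => inc (Ms n i) s (s + l) w ^+ 4)).
- by move=> n; apply: bmeasX; exact: bM.
- by move=> n w; rewrite exprn_even_ge0.
- by apply: measurable_funX; exact: measurable_incM.
- by move=> w; rewrite exprn_even_ge0.
- move=> n; apply: le_trans (Ex_inc_M4 g_ge0 h_ge0 g_int h_int mu_ge0 haw n i (lx s)) _.
  have := HC2 n i _ _ (lx s); rewrite (_ : s + l - s = l); last by ring.
  by lra.
- move=> w lw; apply: filterS (inc_Mproc_eventually haw i lw (lx s)) => n -> //.
Qed.

(** The functional L is built from a stopped process, hence bounded in the lag; the unstopped one at
    negative lags looks into the future and need not be bounded. The two agree on the lags charged
    by the kernel. *)
Lemma lin_N_decomp i p c u v b w : lf w -> exists L : R -> R, [/\ bmeas L,
  forall x, 0 <= x -> L x = lin p c u v (Np (partner i) ^~ w) (b - x) &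
  lin p c u v (Np i ^~ w) b = lin p c u v (Mp i ^~ w) b +
    mu i * lin p c u v (fun t => Num.max t 0) b + wint (ker i) L].
Proof.
move=> lw.
(* A time beyond all the finitely many evaluation times, so that one stopping index serves for every
   term. *)
pose t := b + \sum_(r < p) (`|u r| + `|v r|).
have [n _ /(_ n (leqnn n)) tn] := stop_eventually haw t lw.
have ut (r : 'I_p) : b + u r <= t.
  rewrite lerD2l (bigD1 r)//= -addrA; apply: le_trans (ler_norm _) _; rewrite lerDl.
  by rewrite addr_ge0// sumr_ge0// => j _; rewrite addr_ge0.
have vt (r : 'I_p) : b + v r <= t.
  rewrite lerD2l (bigD1 r)//= addrAC; apply: le_trans (ler_norm _) _; rewrite lerDr.
  by rewrite addr_ge0// sumr_ge0// => j _; rewrite addr_ge0.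
pose F y (x : R) := Ns n (partner i) (y - x) w.
have bF y : bmeas (F y) by exact: bmeas_Nstop_path.
exists (fun x => \sum_(r < p) c r * (F (b + v r) x - F (b + u r) x)); split.
- by apply: bmeas_sum => r; apply: bmeasM; [exact: bmeas_cst|exact: bmeasB].
- move=> x x0; apply: eq_bigr => r _; rewrite /F.
  rewrite (_ : b - x + v r = b + v r - x); last by ring.
  rewrite (_ : b - x + u r = b + u r - x); last by ring.
  have := ut r; have := vt r => h1 h2.
  rewrite -!(@Nproc_stop _ _ _ _ _ _ _ _ _ haw n)//; apply: tn; lra.
- rewrite (wint_sum (ker0 i) (mker i) (kerH i)); last first.
    by move=> r; apply: bmeasM; [exact: bmeas_cst|exact: bmeasB].
  rewrite /lin mulr_sumr -!big_split/=; apply: eq_bigr => r _.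
  rewrite (wintZ (ker0 i) (mker i) (kerH i)); last exact: bmeasB.
  rewrite (wintB (ker0 i) (mker i) (kerH i))//.
  rewrite /Mproc (Aproc_stop haw i (tn _ (ut r))) (Aproc_stop haw i (tn _ (vt r))).
  by rewrite -/(F (b + u r)) -/(F (b + v r)); ring.
Qed.

End limit_bounds.

(** * Convolutions of nonnegative functions and set functions *)

Section daniell_functionals.
Import HBNNSimple.
Context d (T : measurableType d) (R : realType).
Local Open Scope ereal_scope.

Definition pm (f : T -> \bar R) := measurable_fun setT f /\ forall x, 0 <= f x.

Lemma pm_series (f : nat -> T -> \bar R) : (forall n, pm (f n)) ->
  pm (fun x => \sum_(0 <= n <oo) f n x).
Proof.
move=> pf; split; last by move=> x; apply: nneseries_ge0 => n _ _; exact: (pf n).2.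
by apply: measurable_nneseriesT => n; [exact: (pf n).2|exact: (pf n).1].
Qed.

Lemma pm_add (f k : T -> \bar R) : pm f -> pm k -> pm (fun x => f x + k x).
Proof.
move=> [mf f0] [mk k0]; split; first exact: emeasurable_funD.
by move=> x; exact: adde_ge0.
Qed.

Lemma pm_mul (f k : T -> \bar R) : pm f -> pm k -> pm (fun x => f x * k x).
Proof.
move=> [mf f0] [mk k0]; split; first exact: emeasurable_funM.
by move=> x; exact: mule_ge0.
Qed.

Lemma pm_cst (c : \bar R) : 0 <= c -> pm (fun=> c).
Proof. by move=> c0; split => //; exact: measurable_cst. Qed.

Lemma pm_indic (A : set T) : measurable A -> pm (fun x => (\1_A x)%:E).
Proof.
move=> mA; split; first by apply: measurable_EFinT; exact: measurable_indic.
by move=> x; rewrite lee_fin indicE.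
Qed.

Lemma nneseries_mull (x : \bar R) (u : nat -> \bar R) : 0 <= x -> (forall n, 0 <= u n) ->
  x * \sum_(0 <= n <oo) u n = \sum_(0 <= n <oo) (x * u n).
Proof.
move=> x0 u0; rewrite -!ge0_integral_count//; last by move=> n; exact: mule_ge0.
by rewrite ge0_integralZl.
Qed.

(** The set functions in the limit formulas are not declared as measures. Positive functionals
    commuting with series replace them: such functionals are closed under sums, scaling and
    iteration, and are determined by indicators. *)
Definition sigma_functional (Phi : (T -> \bar R) -> \bar R) :=
  [/\ forall f, pm f -> 0 <= Phi f,
      forall (c : R) f, (0 <= c)%R -> pm f -> Phi (fun x => c%:E * f x) = c%:E * Phi f &
      forall f : nat -> T -> \bar R, (forall n, pm (f n)) ->
        Phi (fun x => \sum_(0 <= n <oo) f n x) = \sum_(0 <= n <oo) Phi (f n)].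

Section functional.
Variable Phi : (T -> \bar R) -> \bar R.
Hypothesis sPhi : sigma_functional Phi.

Lemma sigma_functional0 : Phi (fun=> 0) = 0.
Proof.
have [_ sc _] := sPhi.
have p0 : pm (fun=> 0) by exact: pm_cst.
have := sc 0%R (fun=> 0) (lexx _) p0; rewrite [X in _ = X]mul0e => {2}<-.
by congr Phi; apply/funext => x; rewrite mule0.
Qed.

Lemma nneseries_finite (u : nat -> \bar R) n : (forall k, (n <= k)%N -> u k = 0) ->
  (forall k, 0 <= u k) -> \sum_(0 <= k <oo) u k = \sum_(k < n) u k.
Proof.
move=> un u0; rewrite (nneseries_split _ n)// add0n eseries0 ?adde0 ?big_mkord//.
by move=> k nk _; exact: un.
Qed.

Lemma sigma_functional_sum (f : nat -> T -> \bar R) n : (forall k, pm (f k)) ->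
  Phi (fun x => \sum_(k < n) f k x) = \sum_(k < n) Phi (f k).
Proof.
move=> pf; have [p0 _ ser] := sPhi.
pose F k : T -> \bar R := if (k < n)%N then f k else fun=> 0.
have pF k : pm (F k) by rewrite /F; case: ifP => // _; exact: pm_cst.
transitivity (Phi (fun x => \sum_(0 <= k <oo) F k x)).
  congr Phi; apply/funext => x; rewrite (@nneseries_finite _ n).
  - by apply: eq_bigr => k _; rewrite /F ltn_ord.
  - by move=> k nk; rewrite /F ltnNge nk.
  - by move=> k; exact: (pF k).2.
rewrite ser// (@nneseries_finite _ n).
- by apply: eq_bigr => k _; rewrite /F ltn_ord.
- by move=> k nk; rewrite /F ltnNge nk/= sigma_functional0.
- by move=> k; exact: p0.
Qed.

Lemma sigma_functional_nnsfun (f : {nnsfun T >-> R}) (s := finmap.enum_fset (fset_set (range f))) :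
  Phi (fun x => (f x)%:E) = \sum_(k < size s)
    (nth 0%R s k)%:E * Phi (fun x => (\1_(f @^-1` [set nth 0%R s k]) x)%:E).
Proof.
have [p0 sc _] := sPhi.
have s0 k : (0 <= nth 0%R s k)%R.
  have [ks|sk] := ltnP k (size s); last by rewrite nth_default.
  have : nth 0%R s k \in s by exact: mem_nth.
  by rewrite in_fset_set// inE => -[x _ <-].
pose F k x : \bar R := (nth 0%R s k)%:E * (\1_(f @^-1` [set nth 0%R s k]) x)%:E.
have pI k : pm (fun x => (\1_(f @^-1` [set nth 0%R s k]) x)%:E).
  by apply: pm_indic; exact: measurable_sfunP.
have pF k : pm (F k) by apply: pm_mul => //; apply: pm_cst; rewrite lee_fin.
transitivity (Phi (fun x => \sum_(k < size s) F k x)).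
  congr Phi; apply/funext => x; rewrite fimfunE fsbig_finite//= -sumEFin.
  rewrite (big_nth 0%R) big_mkord; apply: eq_bigr => k _.
  by rewrite /F -EFinM.
by rewrite sigma_functional_sum//; apply: eq_bigr => k _; exact: sc.
Qed.

Lemma sigma_functional_approx (f : T -> \bar R) (mf : measurable_fun setT f) :
  (forall x, 0 <= f x) ->
  (fun n => Phi (fun x => (nnsfun_approx measurableT mf n x)%:E)) @ \oo --> Phi f.
Proof.
move=> f0; have [p0 _ ser] := sPhi.
pose a n := nnsfun_approx measurableT mf n.
have a_nd n x : (a n x <= a n.+1 x)%R.
  by have /lefP := nd_nnsfun_approx measurableT mf (leqnSn n); exact.
(* A functional is only known to commute with series, so the increasing simple approximations are
   written as partial sums of their nonnegative increments. *)
pose e n x : \bar R := (if n is m.+1 then a m.+1 x - a m x else a 0 x)%:E%R.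
have pe n : pm (e n).
  split; last by case: n => [|n] x; rewrite lee_fin ?subr_ge0.
  by case: n => [|n]; apply: measurable_EFinT => //; exact: measurable_funB.
have part n x : \sum_(k < n.+1) e k x = (a n x)%:E.
  elim: n => [|n IH]; first by rewrite big_ord1.
  by rewrite big_ord_recr/= IH -EFinD addrC subrK.
have fE : f = (fun x => \sum_(0 <= n <oo) e n x).
  apply/funext => x; apply/esym/cvg_lim => //.
  rewrite -cvg_shiftS/=.
  have := cvg_nnsfun_approx measurableT mf (fun x _ => f0 x) (I : setT x).
  by apply: cvg_trans; apply: near_eq_cvg; apply: nearW => n /=; rewrite big_mkord part.
rewrite (_ : Phi f = \sum_(0 <= n <oo) Phi (e n)); last by rewrite [in LHS]fE ser.
have cs : (fun n => \sum_(0 <= k < n) Phi (e k)) @ \oo --> \sum_(0 <= n <oo) Phi (e n).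
  by apply: is_cvg_nneseries => n _ _; exact: p0.
move: cs; rewrite -cvg_shiftS/=; apply: cvg_trans; apply: near_eq_cvg; apply: nearW => n /=.
rewrite big_mkord -sigma_functional_sum//; congr Phi.
by apply/funext => x; rewrite part.
Qed.

End functional.

Lemma sigma_functional_unique Phi Psi : sigma_functional Phi -> sigma_functional Psi ->
  (forall A, measurable A -> Phi (fun x => (\1_A x)%:E) = Psi (fun x => (\1_A x)%:E)) ->
  forall f, pm f -> Phi f = Psi f.
Proof.
move=> sPhi sPsi ind f [mf f0].
have := sigma_functional_approx sPhi mf f0.
have := sigma_functional_approx sPsi mf f0.
have e n : Psi (fun x => (nnsfun_approx measurableT mf n x)%:E) =
    Phi (fun x => (nnsfun_approx measurableT mf n x)%:E).
  rewrite !sigma_functional_nnsfun//; apply: eq_bigr => k _.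
  by rewrite ind//; exact: measurable_sfunP.
under eq_fun do rewrite e.
by move=> c1 c2; apply: (cvg_unique _ c2 c1).
Qed.

Lemma sigma_functional_integral (m : {measure set T -> \bar R}) :
  sigma_functional (fun f => \int[m]_x f x).
Proof.
split.
- by move=> f [_ f0]; exact: integralT_ge0.
- by move=> c f c0 [mf f0]; rewrite integralT_Zl// lee_fin.
- by move=> f pf; rewrite integral_nneseries// => n *; [exact: (pf n).1|exact: (pf n).2].
Qed.

(** The integral is a supremum over simple functions, whose level sets are measurable. This holds
    for arbitrary set functions, without additivity. *)
Lemma eq_integral_set_function (m m' : set T -> \bar R) (f : T -> \bar R) :
  (forall A, measurable A -> m A = m' A) -> \int[m]_x f x = \int[m']_x f x.
Proof.
move=> mm'; have e (k : {nnsfun T >-> R}) : sintegral m k = sintegral m' k.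
  by rewrite /sintegral; apply: eq_fsbigr => r _; rewrite mm'//; exact: measurable_sfunP.
rewrite /integral/=; congr (_ - _); congr ereal_sup; apply/seteqP;
  split => y [k kf <-]; exists k => //; exact: e.
Qed.

Section set_function.
Variables (m : set T -> \bar R) (Phi : (T -> \bar R) -> \bar R).
Hypothesis sPhi : sigma_functional Phi.
Hypothesis mPhi : forall A, measurable A -> m A = Phi (fun x => (\1_A x)%:E).

(** The given set function is controlled on measurable sets only; extending it by 0 elsewhere yields
    a genuine measure with the same integrals. *)
Let mm (A : set T) : \bar R := if `[< measurable A >] then m A else 0.

Let mmE A : measurable A -> mm A = Phi (fun x => (\1_A x)%:E).
Proof. by move=> mA; rewrite /mm; case: asboolP => // _; exact: mPhi. Qed.

Let mm0 : mm set0 = 0.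
Proof.
rewrite mmE// -[RHS](sigma_functional0 sPhi); congr Phi.
by apply/funext => x; rewrite indic0.
Qed.

Let mm_ge0 A : 0 <= mm A.
Proof.
rewrite /mm; case: asboolP => // mA; rewrite mPhi//.
by have [p0 _ _] := sPhi; apply: p0; exact: pm_indic.
Qed.

Let mm_additive : semi_sigma_additive mm.
Proof.
move=> F mF tF mUF; have [p0 _ ser] := sPhi.
have -> : mm (\bigcup_n F n) = \sum_(0 <= n <oo) mm (F n).
  rewrite mmE//; under eq_eseriesr do rewrite mmE//.
  rewrite -ser; last by move=> n; exact: pm_indic.
  congr Phi; apply/funext => x.
  have := @measure_semi_bigcup _ _ _ (@dirac _ T x R) F mF tF mUF.
  by move=> e; exact: e.
have := @is_cvg_nneseries R (fun n => mm (F n)) xpredT 0 (fun n _ _ => mm_ge0 (F n)).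
exact.
Qed.

HB.instance Definition _ := isMeasure.Build _ _ _ mm mm0 mm_ge0 mm_additive.

Lemma integral_set_function f : pm f -> \int[m]_x f x = Phi f.
Proof.
move=> pf; rewrite (@eq_integral_set_function m mm); last first.
  by move=> A mA; rewrite mmE// mPhi.
apply: (sigma_functional_unique (sigma_functional_integral mm) sPhi) pf => A mA.
by rewrite integral_indic// setIT; exact: mmE.
Qed.

End set_function.

End daniell_functionals.

(** * Algebra of convolutions of nonnegative functions *)

Section convolution_algebra.
Context (R : realType).
Local Notation leb := (@lebesgue_measure R).
Local Open Scope ereal_scope.
Implicit Types f k l : R -> \bar R.

Lemma pm_comp (phi : R -> R) f : measurable_fun setT phi -> pm f -> pm (fun x : R => f (phi x)).
Proof.
by move=> mp [mf f0]; split => [|x]; [exact: measurableT_comp mf mp|exact: f0].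
Qed.

Lemma pm_reflect f : pm f -> pm (reflect_fun f).
Proof. by apply: pm_comp; exact: measurable_funN. Qed.

Lemma pm_sub f (a : R) : pm f -> pm (fun x : R => f (a - x)%R).
Proof.
by apply: pm_comp; apply: measurable_funB => //; exact: measurable_cst.
Qed.

Lemma pm_addl f (a : R) : pm f -> pm (fun x : R => f (a + x)%R).
Proof.
by apply: pm_comp; apply: measurable_funD => //; exact: measurable_cst.
Qed.

Lemma measurable_comp2 f (phi : R * R -> R) : measurable_fun setT phi -> pm f ->
  measurable_fun setT (fun z => f (phi z)).
Proof. by move=> mp [mf _]; exact: measurableT_comp mf mp. Qed.

Let mfst : measurable_fun setT (fun z : R * R => z.1). Proof. exact: measurable_fst. Qed.
Let msnd : measurable_fun setT (fun z : R * R => z.2). Proof. exact: measurable_snd. Qed.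

Lemma pm_integral_shift f (phi : R * R -> R) k :
  measurable_fun setT phi -> pm f -> pm k -> pm (fun x : R => \int[leb]_y (f (phi (x, y)) * k y)).
Proof.
move=> mp pf pk; split; last first.
  by move=> x; apply: integralT_ge0 => y; apply: mule_ge0; [exact: pf.2|exact: pk.2].
apply: (measurable_integral_r leb (f := fun x y : R => f (phi (x, y)) * k y)).
  apply: emeasurable_funM; last exact: measurable_comp2.
  by apply: measurable_comp2 pf; apply: eq_measurable_fun mp => -[].
by move=> x y; apply: mule_ge0; [exact: pf.2|exact: pk.2].
Qed.

Lemma pm_convol f k : pm f -> pm k -> pm (convol f k).
Proof.
move=> pf pk; apply: (@pm_integral_shift f (fun z => z.1 - z.2)%R k) => //.
exact: measurable_funB.
Qed.

Lemma convolC f k : pm f -> pm k -> convol f k = convol k f.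
Proof.
move=> pf pk; apply/funext => t; rewrite /convol.
have [m0 p0] := pm_mul (pm_sub t pf) pk.
rewrite -(integral_sub t m0 p0); apply: eq_integral => s _.
by rewrite muleC; congr (_ * f _); ring.
Qed.

Lemma convolA f k l : pm f -> pm k -> pm l -> convol (convol f k) l = convol f (convol k l).
Proof.
move=> pf pk pl; apply/funext => t; rewrite /convol.
transitivity (\int[leb]_s \int[leb]_u (f (t - s - u)%R * k u * l s)).
  apply: eq_integral => s _; rewrite -integralT_Zr ?pl.2//.
    by apply: (pm_mul _ _).1 => //; exact: pm_sub.
  by apply: (pm_mul _ _).2 => //; exact: pm_sub.
transitivity (\int[leb]_s \int[leb]_v (f (t - v)%R * k (v - s)%R * l s)).
  apply: eq_integral => s _.
  have pp : pm (fun v : R => f (t - v)%R * k (v - s)%R * l s).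
    apply: pm_mul; last by apply: pm_cst; exact: pl.2.
    apply: pm_mul; first exact: pm_sub.
    by apply: pm_comp pk; apply: measurable_funB => //; exact: measurable_cst.
  rewrite -(integral_shift s pp.1 pp.2); apply: eq_integral => u _.
  by congr (f _ * k _ * _); ring.
rewrite (tonelli_swap leb leb (f := fun s v => f (t - v)%R * k (v - s)%R * l s))/=.
- apply: eq_integral => v _.
  rewrite -integralT_Zl ?pf.2//.
  + by apply: eq_integral => s _; rewrite muleA.
  + by apply: (pm_mul _ _).1 => //; exact: pm_sub.
  + by apply: (pm_mul _ _).2 => //; exact: pm_sub.
- apply: emeasurable_funM; last exact: measurable_comp2.
  apply: emeasurable_funM.
    by apply: measurable_comp2 pf; apply: measurable_funB => //; exact: measurable_cst.
  by apply: measurable_comp2 pk; exact: measurable_funB.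
- by move=> s v; rewrite !mule_ge0// ?pf.2 ?pk.2 ?pl.2.
Qed.

Lemma convolDl f k l : pm f -> pm k -> pm l ->
  convol (fun x => f x + k x) l = (fun x => convol f l x + convol k l x).
Proof.
move=> pf pk pl; apply/funext => t; rewrite /convol.
have p1 := pm_mul (pm_sub t pf) pl; have p2 := pm_mul (pm_sub t pk) pl.
rewrite -integralT_D//; [|exact: p1.1|exact: p2.1|exact: p1.2|exact: p2.2].
by apply: eq_integral => s _; rewrite ge0_muleDl// ?pf.2 ?pk.2.
Qed.

Lemma convolZl (c : R) f l : (0 <= c)%R -> pm f -> pm l ->
  convol (fun x => c%:E * f x) l = (fun x => c%:E * convol f l x).
Proof.
move=> c0 pf pl; apply/funext => t; rewrite /convol.
have p1 := pm_mul (pm_sub t pf) pl.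
rewrite -integralT_Zl ?lee_fin//; [|exact: p1.1|exact: p1.2].
by apply: eq_integral => s _; rewrite muleA.
Qed.

Lemma convolDr f k l : pm f -> pm k -> pm l ->
  convol l (fun x => f x + k x) = (fun x => convol l f x + convol l k x).
Proof.
move=> pf pk pl; rewrite convolC//; last exact: pm_add.
by rewrite convolDl// convolC// (convolC pk).
Qed.

Lemma convol_reflect f k : pm f -> pm k ->
  reflect_fun (convol f k) = convol (reflect_fun f) (reflect_fun k).
Proof.
move=> pf pk; apply/funext => t; rewrite /reflect_fun /convol.
have p1 := pm_mul (pm_sub (- t) pf) pk.
rewrite -(integral_reflect p1.1 p1.2); apply: eq_integral => s _.
by congr (f _ * _); ring.
Qed.

Lemma convol_series f (u : nat -> R -> \bar R) : pm f -> (forall n, pm (u n)) ->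
  convol f (fun x => \sum_(0 <= n <oo) u n x) = (fun x => \sum_(0 <= n <oo) convol f (u n) x).
Proof.
move=> pf pu; apply/funext => t; rewrite /convol.
have pn n := pm_mul (pm_sub t pf) (pu n).
rewrite -integral_nneseries//; [|by move=> n; exact: (pn n).1|by move=> n s _; exact: (pn n).2].
apply: eq_integral => s _; rewrite nneseries_mull ?pf.2// => n; exact: (pu n).2.
Qed.

Lemma integral_convol f k : pm f -> pm k ->
  \int[leb]_t convol f k t = (\int[leb]_t f t) * (\int[leb]_t k t).
Proof.
move=> pf pk; rewrite /convol.
rewrite (tonelli_swap leb leb (f := fun t s => f (t - s)%R * k s))/=.
- rewrite -integralT_Zl//; [|exact: pk.1|exact: pk.2|by apply: integralT_ge0; exact: pf.2].
  apply: eq_integral => s _.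
  have p1 : pm (fun t : R => f (t - s)%R).
    by apply: pm_comp pf; apply: measurable_funB => //; exact: measurable_cst.
  rewrite integralT_Zr ?pk.2//; [|exact: p1.1|exact: p1.2].
  by rewrite (integral_shift (- s)) //; [exact: pf.1|exact: pf.2].
- apply: emeasurable_funM; last exact: measurable_comp2.
  by apply: measurable_comp2 pf; exact: measurable_funB.
- by move=> t s; rewrite mule_ge0// ?pf.2 ?pk.2.
Qed.

Lemma convol_le f k (c : \bar R) : pm f -> pm k -> (forall x, f x <= c) ->
  forall t, convol f k t <= c * \int[leb]_s k s.
Proof.
move=> pf pk fc t; have c0 : 0 <= c by apply: le_trans (fc 0%R); exact: pf.2.
have p1 := pm_mul (pm_sub t pf) pk; have p2 := pm_mul (pm_cst _ c0) pk.
rewrite -integralT_Zl//; [|exact: pk.1|exact: pk.2].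
apply: integralT_le; [exact: p1.1|exact: p2.1|exact: p1.2|].
by move=> s; apply: lee_wpmul2r => //; exact: pk.2.
Qed.

(** The kernels in the limit formulas keep their value at 0, those of the renewal equations drop it.
    In a convolution at t this affects the two points 0 and t only. *)
Lemma convol_eq_off0 f f' k k' : pm f -> pm k -> pm f' -> pm k' ->
  (forall x, x != 0%R -> f x = f' x) ->
  (forall x, x != 0%R -> k x = k' x) -> convol f k = convol f' k'.
Proof.
move=> pf pk pf' pk' ff' kk'; apply/funext => t; rewrite /convol.
have p1 := pm_mul (pm_sub t pf) pk; have p2 := pm_mul (pm_sub t pf') pk'.
apply: ae_eq_integral => //; [exact: p1.1|exact: p2.1|].
have m0 : (leb [set 0%R; t] = 0)%E.
  by apply: countable_lebesgue_measure0; apply: finite_set_countable; exact: finite_set2.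
exists [set 0%R; t]; split => //; first by apply: measurableU; exact: measurable_set1.
move=> s /= /not_implyP[_ ne]; apply: contrapT => /not_orP[/eqP s0 /eqP st]; apply: ne.
by rewrite ff' ?kk'// subr_eq0 eq_sym.
Qed.

End convolution_algebra.

(** * Convolutions of set functions as iterated functionals *)

Section set_functions.
Context (R : realType).
Local Notation leb := (@lebesgue_measure R).
Local Open Scope ereal_scope.
Implicit Types f k u : R -> \bar R.

Lemma sigma_functionalD (Phi Psi : (R -> \bar R) -> \bar R) :
  sigma_functional Phi -> sigma_functional Psi -> sigma_functional (fun f => Phi f + Psi f).
Proof.
move=> [p1 s1 c1] [p2 s2 c2]; split.
- by move=> f pf; rewrite adde_ge0 ?p1 ?p2.
- by move=> c f c0 pf; rewrite s1// s2// ge0_muleDr ?p1 ?p2.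
- by move=> f pf; rewrite c1// c2// nneseriesD// => n *; [exact: p1|exact: p2].
Qed.

Lemma sigma_functionalZ (c : R) (Phi : (R -> \bar R) -> \bar R) : (0 <= c)%R ->
  sigma_functional Phi -> sigma_functional (fun f => c%:E * Phi f).
Proof.
move=> c0 [p1 s1 c1]; split.
- by move=> f pf; rewrite mule_ge0 ?p1.
- by move=> b f b0 pf; rewrite s1// muleCA.
- by move=> f pf; rewrite c1// nneseries_mull// => n; exact: p1.
Qed.

Lemma sigma_functional_point (a : R) : sigma_functional (fun f => f a).
Proof. by split => // f pf; exact: pf.2. Qed.

Lemma sigma_functional_dens u : pm u -> sigma_functional (fun f => \int[leb]_x (f x * u x)).
Proof.
move=> pu; split.
- by move=> f pf; apply: integralT_ge0 => x; rewrite mule_ge0 ?pf.2 ?pu.2.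
- move=> c f c0 pf; have p1 := pm_mul pf pu.
  rewrite -integralT_Zl//; [|exact: p1.1|exact: p1.2].
  by apply: eq_integral => x _; rewrite muleA.
- move=> f pf; have pn n := pm_mul (pf n) pu.
  rewrite -integral_nneseries//; [|by move=> n; exact: (pn n).1|by move=> n s _; exact: (pn n).2].
  apply: eq_integral => s _; rewrite muleC nneseries_mull ?pu.2//; last by move=> n; exact: (pf n).2.
  by apply: eq_eseriesr => n _; rewrite muleC.
Qed.

Lemma dens_functional u A : measurable A -> dens u A = \int[leb]_x ((\1_A x)%:E * u x).
Proof.
move=> mA; rewrite /dens integral_mkcond; apply: eq_integral => x _.
by rewrite patchE indicE; case: (x \in A); rewrite ?mul1e ?mul0e.
Qed.

Section convolution_of_set_functions.
Variables (m n : set R -> \bar R) (Phi Psi : (R -> \bar R) -> \bar R).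
Hypotheses (sPhi : sigma_functional Phi) (sPsi : sigma_functional Psi).
Hypothesis mPhi : forall A, measurable A -> m A = Phi (fun x => (\1_A x)%:E).
Hypothesis nPsi : forall A, measurable A -> n A = Psi (fun x => (\1_A x)%:E).
Hypothesis pmPsi : forall f, pm f -> pm (fun x : R => Psi (fun y => f (x + y)%R)).

Lemma integral_convol_measure f : pm f ->
  \int[convol_measure m n]_x f x = Phi (fun x => Psi (fun y => f (x + y)%R)).
Proof.
have [p1 s1 c1] := sPhi; have [p2 s2 c2] := sPsi.
have pS f' x : pm f' -> pm (fun y : R => f' (x + y)%R) by move=> pf'; exact: pm_addl.
apply: (integral_set_function (Phi := fun f => Phi (fun x => Psi (fun y => f (x + y)%R)))).
  split.
  - by move=> f' pf'; apply: p1; exact: pmPsi.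
  - move=> c f' c0 pf'; rewrite -s1//; last exact: pmPsi.
    by congr Phi; apply/funext => x; rewrite s2//; exact: pS.
  - move=> f' pf'; rewrite -c1//; last by move=> k; exact: pmPsi.
    by congr Phi; apply/funext => x; rewrite c2// => k; exact: pS.
move=> A mA; rewrite /convol_measure.
have mAx x : measurable [set y | A (x + y)%R].
  have mx : measurable_fun setT (fun y : R => x + y)%R.
    by apply: measurable_funD => //; exact: measurable_cst.
  by have := mx measurableT A mA; rewrite setTI.
have e x : n [set y | A (x + y)%R] = Psi (fun y => (\1_A (x + y)%R)%:E).
  by rewrite nPsi.
rewrite (integral_set_function sPhi mPhi); last first.
  rewrite (_ : (fun x => _) = fun x : R => Psi (fun y => (\1_A (x + y)%R)%:E)); last exact/funext.
  by apply: (pmPsi (f := fun z => (\1_A z)%:E)); exact: pm_indic.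
by congr Phi; apply/funext => x; exact: e.
Qed.

End convolution_of_set_functions.
End set_functions.

(** * Resolvents of convolution equations *)

Section resolvent_algebra.
Context (R : realType).
Local Notation leb := (@lebesgue_measure R).
Local Open Scope ereal_scope.
Implicit Types f k u : R -> \bar R.

(** Convolution with the measure delta_0 + u, written so that the Dirac mass never has to be
    represented by a function. *)
Definition resolve u f : R -> \bar R := fun x => f x + convol f u x.

Lemma pm_resolve u f : pm u -> pm f -> pm (resolve u f).
Proof. by move=> pu pf; apply: pm_add => //; exact: pm_convol. Qed.

(** With associativity and commutativity, f * u = f * k + f * (k * u) = (f + f * u) * k. *)
Lemma resolve_renewal u k f : pm u -> pm k -> pm f -> u = (fun x => k x + convol k u x) ->
  resolve u f = (fun x => f x + convol (resolve u f) k x).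
Proof.
move=> pu pk pf uk; apply/funext => x; rewrite {1}/resolve; congr (_ + _).
have pfu := pm_convol pf pu.
rewrite /resolve convolDl// [in LHS]uk convolDr//; last exact: pm_convol.
by congr (_ + _); rewrite (convolA pf pu pk) (convolC pu pk).
Qed.

Lemma resolve_convol u f k : pm u -> pm f -> pm k ->
  resolve u (convol f k) = convol (resolve u f) k.
Proof.
move=> pu pf pk; rewrite /resolve (convolDl pf (pm_convol pf pu) pk).
by rewrite (convolA pf pu pk) (convolA pf pk pu) (convolC pk pu).
Qed.

Lemma resolveD u f f' : pm u -> pm f -> pm f' ->
  resolve u (fun x => f x + f' x) = (fun x => resolve u f x + resolve u f' x).
Proof. by move=> pu pf pf'; apply/funext => x; rewrite /resolve convolDl// addeACA. Qed.

Lemma resolveZ u f (c : R) : (0 <= c)%R -> pm u -> pm f ->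
  resolve u (fun x => c%:E * f x) = (fun x => c%:E * resolve u f x).
Proof.
move=> c0 pu pf; apply/funext => x; rewrite /resolve convolZl//.
by rewrite [RHS]ge0_muleDr ?pf.2 ?(pm_convol pf pu).2.
Qed.

Lemma resolve_le u f (c b : R) : pm u -> pm f -> (forall x, f x <= c%:E) ->
  \int[leb]_x u x <= b%:E -> forall x, resolve u f x <= (c + c * b)%:E.
Proof.
move=> pu pf fc ub x; rewrite EFinD leeD//.
apply: le_trans (convol_le pf pu fc x) _; rewrite EFinM lee_wpmul2l//.
by apply: le_trans (fc 0%R); exact: pf.2.
Qed.

Lemma resolve_reflect u f : pm u -> pm f ->
  reflect_fun (resolve u f) = resolve (reflect_fun u) (reflect_fun f).
Proof.
move=> pu pf; rewrite /resolve -convol_reflect//.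
Qed.

Section powers.
Variables (k : R -> \bar R) (q : R).
Hypotheses (pk : pm k) (kq : \int[leb]_x k x = q%:E) (q01 : (0 <= q < 1)%R).
Let F := convol_powers_sum k.

Lemma pm_iter_convol n : pm (iter n (convol k) k).
Proof. by elim: n => //= n IH; exact: pm_convol. Qed.

Lemma pm_powers_sum : pm F.
Proof. by apply: pm_series => n; exact: pm_iter_convol. Qed.

Lemma powers_sum_renewal : F = (fun x => k x + convol k F x).
Proof.
apply/funext => x; rewrite /F /convol_powers_sum convol_series//; last exact: pm_iter_convol.
rewrite nneseries_recl//; last by move=> n _; exact: (pm_iter_convol n).2.
congr (_ + _); rewrite -[in LHS](nneseries_addn 1)//=; last first.
  by move=> n; exact: (pm_iter_convol n).2.
by apply: eq_eseriesr => n _; rewrite addn1.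
Qed.

Lemma integral_powers_sum_le : \int[leb]_x F x <= (1 - q)^-1%:E.
Proof.
have /andP[q0 q1] := q01.
have e n : \int[leb]_x iter n (convol k) k x = (q ^+ n.+1)%:E.
  elim: n => [|n IH]; first by rewrite /= kq expr1.
  rewrite iterS integral_convol//; last exact: pm_iter_convol.
  by rewrite kq IH -EFinM -exprS.
rewrite /F /convol_powers_sum integral_nneseries//; last 2 first.
- by move=> n; exact: (pm_iter_convol n).1.
- by move=> n x _; exact: (pm_iter_convol n).2.
apply: lime_le; first by apply: is_cvg_nneseries => n _ _; rewrite e lee_fin exprn_ge0.
apply: nearW => n; rewrite (eq_bigr (fun n => (q ^+ n.+1)%:E)) => [|i _]; last exact: e.
rewrite big_mkord sumEFin lee_fin -[leRHS]mul1r ler_pdivlMr ?subr_gt0//.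
suff -> : ((\sum_(i < n) q ^+ i.+1) * (1 - q) = q - q ^+ n.+1)%R.
  by have := exprn_ge0 n.+1 q0; lra.
elim: n => [|n IH]; first by rewrite big_ord0 expr1; ring.
by rewrite big_ord_recr/= mulrDl IH !exprS; ring.
Qed.

End powers.
End resolvent_algebra.

Section bounded_convolution.
Context (R : realType).
Local Notation leb := (@lebesgue_measure R).
Variables (k : R -> R) (H : R).
Hypotheses (k0 : forall s, 0 <= k s) (mk : measurable_fun setT k).
Hypothesis (kH : (\int[leb]_s (k s)%:E = H%:E)%E).
Variables (f : R -> \bar R) (B : R).
Hypotheses (pf : pm f) (fB : forall x, (f x <= B%:E)%E).

Lemma bounded_fineK x : (fine (f x))%:E = f x.
Proof.
rewrite fineK// ge0_fin_numE ?pf.2//.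
by apply: le_lt_trans (fB x) _; rewrite ltry.
Qed.

Lemma bmeas_fine : bmeas (fun x => fine (f x)).
Proof.
split; first by apply: measurableT_comp => //; exact: pf.1.
exists B => x; rewrite ger0_norm; last by apply: fine_ge0; exact: pf.2.
by rewrite -lee_fin bounded_fineK.
Qed.

Lemma bmeas_comp (phi : R -> R) (u : R -> R) : measurable_fun setT phi -> bmeas u ->
  bmeas (fun x => u (phi x)).
Proof. by move=> mp [mu [K uK]]; split; [exact: measurableT_comp mu mp|exists K]. Qed.

Lemma convol_wint t :
  convol f (fun s => (k s)%:E) t = (wint k (fun s => fine (f (t - s))))%:E.
Proof.
rewrite (wint_EFin k0 mk kH); last first.
  apply: (@bmeas_comp (fun s => t - s)) bmeas_fine.
  by apply: measurable_funB => //; exact: measurable_cst.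
by apply: eq_integral => s _; rewrite EFinM bounded_fineK muleC.
Qed.

Lemma convol_reflect_wint t :
  convol f (reflect_fun (fun s => (k s)%:E)) t = (wint k (fun s => fine (f (t + s))))%:E.
Proof.
have pk : pm (fun s => (k s)%:E) by split; [exact: measurable_EFinT|].
have p1 := pm_mul (pm_sub t pf) (pm_reflect pk).
rewrite (wint_EFin k0 mk kH); last first.
  apply: (@bmeas_comp (fun s => t + s)) bmeas_fine.
  by apply: measurable_funD => //; exact: measurable_cst.
rewrite /convol -(integral_reflect p1.1 p1.2); apply: eq_integral => s _.
by rewrite /reflect_fun !opprK EFinM bounded_fineK muleC.
Qed.

End bounded_convolution.

Section resolvent_measure.
Context (R : realType).
Local Notation leb := (@lebesgue_measure R).
Local Open Scope ereal_scope.
Variables (F : R -> \bar R) (pF : pm F).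

Let Phi (f : R -> \bar R) := f 0%R + \int[leb]_x (f x * F x) +
  \int[leb]_x (f x * reflect_fun F x) +
  \int[leb]_x (f x * convol F (reflect_fun F) x).

Let pF' : pm (reflect_fun F). Proof. exact: pm_reflect. Qed.
Let pFF : pm (convol F (reflect_fun F)). Proof. exact: pm_convol. Qed.

Let sPhi : sigma_functional Phi.
Proof.
by do 3 (apply: sigma_functionalD; last exact: sigma_functional_dens);
  exact: sigma_functional_point.
Qed.

(** The resolvent measure factors as the convolution of delta_0 + F with its reflection, so
    convolving with it amounts to two successive calls of [resolve]. The function [q] is [gam]
    convolved with the second set function. *)
Lemma resolvent_measure_triangle (n : set R -> \bar R) (Psi : (R -> \bar R) -> \bar R)
    (gam : R -> R) (q : R -> \bar R) (t : R) :
  sigma_functional Psi -> (forall A, measurable A -> n A = Psi (fun x => (\1_A x)%:E)) ->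
  (forall f, pm f -> pm (fun x : R => Psi (fun y => f (x + y)%R))) ->
  pm (fun x => (gam x)%:E) -> pm q ->
  (forall x, Psi (fun y => (gam (t - (x + y)))%:E) = q (t - x)%R) ->
  convol_fun_measure gam (convol_measure (\d_(0%R : R) \+ dens F \+ dens (reflect_fun F)
   \+ dens (convol F (reflect_fun F))) n) t = resolve (reflect_fun F) (resolve F q) t.
Proof.
move=> sPsi nPsi pmPsi pg pq Psiq.
have mPhi A : measurable A -> (\d_(0%R : R) \+ dens F \+ dens (reflect_fun F)
   \+ dens (convol F (reflect_fun F))) A = Phi (fun x => (\1_A x)%:E).
  by move=> mA; rewrite /Phi -!dens_functional// diracE indicE.
rewrite /convol_fun_measure.
rewrite (integral_convol_measure sPhi sPsi mPhi nPsi pmPsi (pm_sub t pg)).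
rewrite /Phi !Psiq subr0 /resolve convolDl//; last exact: pm_convol.
rewrite convolA// [RHS]addeA; congr (_ + _ + _ + _).
- by rewrite /convol; apply: eq_integral => x _; rewrite Psiq.
- by rewrite /convol; apply: eq_integral => x _; rewrite Psiq.
- by rewrite /convol; apply: eq_integral => x _; rewrite Psiq.
Qed.

End resolvent_measure.

(** * The deterministic renewal equations satisfied by the limits *)

Section limit_covariances.
Context (R : realType).
Local Notation leb := (@lebesgue_measure R).
Variables (g h : R -> R).
Hypothesis g_ge0 : forall t, 0 <= t -> 0 <= g t.
Hypothesis h_ge0 : forall t, 0 <= t -> 0 <= h t.
Hypothesis g_int : leb.-integrable `[0, +oo[ (EFin \o g).
Hypothesis h_int : leb.-integrable `[0, +oo[ (EFin \o h).
Hypothesis hg_lt1 : normL1 h * normL1 g < 1.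
Variables (mu : 'I_4 -> R) (mu_ge0 : forall i, 0 <= mu i).
Local Open Scope ereal_scope.

(* The difference S_1 (resp. S_2) is encoded by [true] (resp. [false]). *)
Definition pos_comp (k : bool) : 'I_4 := if k then comp1 else comp3.
Definition neg_comp (k : bool) : 'I_4 := if k then comp2 else comp4.

Local Notation ker := (ker g h).
Local Notation mass := (mass g h).
Local Notation kr k := (ker (pos_comp k)).
Let ker0 i s : (0 <= ker i s)%R. Proof. exact: ker_ge0. Qed.
Let mker i : measurable_fun setT (ker i). Proof. exact: measurable_ker. Qed.
Let kerH i : (\int[leb]_s (ker i s)%:E = (mass i)%:E)%E. Proof. exact: integral_ker. Qed.
Let mass0 i : (0 <= mass i)%R. Proof. exact: (mass_ge0 (ker0 i) (kerH i)). Qed.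

Definition ekr (k : bool) : R -> \bar R := fun s => (kr k s)%:E.

Let pE k : pm (ekr k). Proof. by split; [exact: measurable_EFinT|move=> x; rewrite lee_fin]. Qed.

Definition kloop := convol (ekr true) (ekr false).

Let ploop : pm kloop. Proof. exact: pm_convol. Qed.

Let kloopE k : convol (ekr (~~ k)) (ekr k) = kloop.
Proof. by case: k => //; rewrite convolC. Qed.

Definition Floop := convol_powers_sum kloop.
Local Notation F := Floop.
Let pF : pm F. Proof. exact: pm_powers_sum. Qed.

Let rho := (normL1 h * normL1 g)%R.
Let rho01 : (0 <= rho < 1)%R.
Proof. by rewrite hg_lt1 mulr_ge0//; [exact: (mass0 comp1)|exact: (mass0 comp3)]. Qed.

Let kloop_mass : \int[leb]_x kloop x = rho%:E.
Proof. by rewrite integral_convol// /ekr !kerH -EFinM. Qed.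

Let F_le : \int[leb]_x F x <= (1 - rho)^-1%:E.
Proof. exact: integral_powers_sum_le. Qed.

Let F'_le : \int[leb]_x reflect_fun F x <= (1 - rho)^-1%:E.
Proof. by rewrite /reflect_fun integral_reflect//; [exact: pF.1|exact: pF.2]. Qed.

Definition gain : R := (1 - normL1 h * normL1 g)^-1.

Definition rate (k : bool) : R :=
  ((mu (pos_comp k) + mass (pos_comp k) * mu (pos_comp (~~ k))) * gain)%R.

Let gain0 : (0 <= gain)%R.
Proof. by rewrite /gain invr_ge0 subr_ge0 ltW. Qed.

Lemma rate_ge0 k : (0 <= rate k)%R.
Proof. by rewrite mulr_ge0// addr_ge0// mulr_ge0. Qed.

Lemma rateE k : rate k = (mu (pos_comp k) + mass (pos_comp k) * rate (~~ k))%R.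
Proof.
have r1 : (1 - normL1 h * normL1 g != 0)%R by rewrite gt_eqF// subr_gt0.
by case: k; rewrite /rate /gain /mass /kbase /=; field.
Qed.

Definition tri (D x : R) : \bar R := (triangle D x)%:E.

Section fixed_mesh.
Variable D : R.
Hypothesis D0 : (0 < D)%R.
Local Notation gam := (tri D).

Lemma triangle_bound x : (0 <= triangle D x <= 1)%R.
Proof.
rewrite /triangle le_max lexx orbT ge_max ler01 andbT lerBlDr lerDl.
by rewrite divr_ge0// ltW.
Qed.

Lemma pm_tri : pm gam.
Proof.
split; last by move=> x; rewrite lee_fin le_max lexx orbT.
apply: measurable_EFinT; apply: measurable_maxr; last exact: measurable_cst.
apply: measurable_funB; first exact: measurable_cst.
by apply: measurable_funM; [exact: normr_measurable|exact: measurable_cst].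
Qed.

Let pg := pm_tri.

Let gam_le x : gam x <= 1%:E.
Proof. by rewrite lee_fin; have /andP[] := triangle_bound x. Qed.

Let pF' : pm (reflect_fun F). Proof. exact: pm_reflect. Qed.
Let pE' k : pm (reflect_fun (ekr k)). Proof. exact: pm_reflect. Qed.

Let Pg := resolve F gam.
Let pPg : pm Pg. Proof. exact: pm_resolve. Qed.

Let base k x : \bar R := (2 * rate k)%:E * Pg x.
Let c0 k : (0 <= 2 * rate k)%R. Proof. by rewrite mulr_ge0// rate_ge0. Qed.
Let pbase k : pm (base k).
Proof. by apply: pm_mul => //; apply: pm_cst; rewrite lee_fin. Qed.

(** Inserting the off-diagonal equation into the diagonal one leaves a single equation with kernel
    [kloop], solved by [resolve F]; the off-diagonal solution then costs one more convolution. *)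
Definition elim_mart k l : R -> \bar R :=
  if k == l then base k else convol (base k) (ekr l).
Local Notation X := elim_mart.

(** Eliminating the unknown of index ~~ l leaves an equation whose kernel is the reflected loop and
    whose forcing is the sum of X l k and of X (~~ l) k convolved with the reflected kernel; the
    reflected F resolves it. *)
Definition elim_cov l k : R -> \bar R := fun x =>
  resolve (reflect_fun F) (X l k) x +
  convol (resolve (reflect_fun F) (X (~~ l) k)) (reflect_fun (ekr l)) x.
Local Notation C := elim_cov.

Let pX k l : pm (X k l).
Proof. by rewrite /X; case: ifP => // _; exact: pm_convol. Qed.

Let pQX k l : pm (resolve (reflect_fun F) (X k l)). Proof. exact: pm_resolve. Qed.

Let pC k l : pm (C k l).
Proof. by apply: pm_add => //; exact: pm_convol. Qed.

Let convol_bound f k b : pm f -> (forall x, f x <= b%:E) -> 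
  forall x, convol f (ekr k) x <= (b * mass (pos_comp k))%:E.
Proof. by move=> pf fb x; apply: le_trans (convol_le pf (pE k) fb x) _; rewrite kerH EFinM. Qed.

Let convol_bound' f k b : pm f -> (forall x, f x <= b%:E) -> 
  forall x, convol f (reflect_fun (ekr k)) x <= (b * mass (pos_comp k))%:E.
Proof.
move=> pf fb x; apply: le_trans (convol_le pf (pE' k) fb x) _.
by rewrite /reflect_fun integral_reflect ?kerH ?EFinM//; [exact: (pE k).1|exact: (pE k).2].
Qed.

Let Xb k l : exists b : R, forall x, X k l x <= b%:E.
Proof.
have Pb := resolve_le pF pg gam_le F_le.
have bb x : base k x <= (2 * rate k * (1 + 1 * (1 - rho)^-1))%:E.
  by rewrite /base [leRHS]EFinM lee_wpmul2l ?lee_fin.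
rewrite /X; case: ifP => _; first by eexists; exact: bb.
by eexists; exact: convol_bound bb.
Qed.

Let Cb k l : exists b : R, forall x, C k l x <= b%:E.
Proof.
have [b1 hb1] := Xb k l; have [b2 hb2] := Xb (~~ k) l.
have r1 := resolve_le pF' (pX k l) hb1 F'_le.
have r2 := convol_bound' k (pQX _ _) (resolve_le pF' (pX _ _) hb2 F'_le).
by eexists => x; apply: le_trans (leeD (r1 x) (r2 x)) _; rewrite -EFinD.
Qed.

Let XE k l x : X k l x = (if k == l then (2 * rate k)%:E * gam x else 0) +
  convol (X k (~~ l)) (ekr l) x.
Proof.
have Fr : F = (fun x => kloop x + convol kloop F x) by exact: powers_sum_renewal.
have Pr : Pg = _ := resolve_renewal pF ploop pg Fr.
case: (eqVneq k l) => [<-|kl].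
  have -> : X k (~~ k) = convol (base k) (ekr (~~ k)) by rewrite /X; case: (k).
  have -> : X k k = base k by rewrite /X eqxx.
  rewrite (convolA (pbase k) (pE _) (pE k)) kloopE.
  have -> : convol (base k) kloop = (fun x => (2 * rate k)%:E * convol Pg kloop x).
    exact: (convolZl (c0 k) pPg ploop).
  have e : Pg x = gam x + convol Pg kloop x by exact: (congr1 (fun f => f x) Pr).
  rewrite [LHS](_ : _ = (2 * rate k)%:E * (gam x + convol Pg kloop x)); last by rewrite -e.
  by apply: ge0_muleDr; [exact: pg.2|exact: (pm_convol pPg ploop).2].
rewrite add0e {1}/X (negPf kl) {1}/X (_ : k == ~~ l)//.
by case: k l kl => -[].
Qed.

Let CE l k x : C l k x = X l k x + convol (C (~~ l) k) (reflect_fun (ekr l)) x.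
Proof.
have Fr : F = (fun x => kloop x + convol kloop F x) by exact: powers_sum_renewal.
have Fr' : reflect_fun F = (fun x => reflect_fun kloop x + convol (reflect_fun kloop) (reflect_fun F) x).
  rewrite -(convol_reflect ploop pF); apply/funext => x'.
  exact: (congr1 (fun f => f (- x')%R) Fr).
have Qr := resolve_renewal pF' (pm_reflect ploop) (pX l k) Fr'.
have Qe := congr1 (fun f => f x) Qr.
have pQ := pQX l k; have pQ' := pQX (~~ l) k.
have -> : C (~~ l) k = (fun y => resolve (reflect_fun F) (X (~~ l) k) y +
    convol (resolve (reflect_fun F) (X l k)) (reflect_fun (ekr (~~ l))) y).
  by rewrite /C negbK.
rewrite (convolDl pQ' (pm_convol pQ (pE' _)) (pE' l)) (convolA pQ (pE' _) (pE' l)).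
rewrite -(convol_reflect (pE _) (pE l)) kloopE.
rewrite [LHS](_ : _ = (X l k x + convol (resolve (reflect_fun F) (X l k)) (reflect_fun kloop) x) +
  convol (resolve (reflect_fun F) (X (~~ l) k)) (reflect_fun (ekr l)) x); last first.
  by rewrite /C; congr (_ + _).
by rewrite -[LHS]addeA; congr (_ + _); exact: addeC.
Qed.

Definition mart_lim k l x : R := fine (X k l x).
Definition cov_lim l k x : R := fine (C l k x).

Lemma measurable_mart_lim k l : measurable_fun setT (mart_lim k l).
Proof. by apply: measurableT_comp => //; exact: (pX k l).1. Qed.

Lemma measurable_cov_lim l k : measurable_fun setT (cov_lim l k).
Proof. by apply: measurableT_comp => //; exact: (pC l k).1. Qed.

Lemma bmeas_mart_lim k l : bmeas (mart_lim k l).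
Proof. by have [b hb] := Xb k l; exact: bmeas_fine hb. Qed.

Lemma bmeas_cov_lim k l : bmeas (cov_lim k l).
Proof. by have [b hb] := Cb k l; exact: bmeas_fine hb. Qed.

Lemma mart_lim_renewal k l x : mart_lim k l x =
  ((k == l)%:R * (2 * rate k * triangle D x) +
   wint (kr l) (fun s => mart_lim k (~~ l) (x - s)))%R.
Proof.
have [b hb] := Xb k (~~ l); have [b' hb'] := Xb k l.
apply: EFin_inj; rewrite (bounded_fineK (pX k l) hb').
rewrite EFinD -(convol_wint (ker0 _) (mker _) (kerH _) (pX k (~~ l)) hb) XE.
by congr (_ + _); case: eqP; rewrite ?mul1r ?mul0r// EFinM.
Qed.

Lemma cov_lim_renewal l k x : cov_lim l k x =
  (mart_lim l k x + wint (kr l) (fun s => cov_lim (~~ l) k (x + s)))%R.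
Proof.
have [b hb] := Cb (~~ l) k; have [b' hb'] := Xb l k; have [b'' hb''] := Cb l k.
apply: EFin_inj; rewrite (bounded_fineK (pC l k) hb'') EFinD (bounded_fineK (pX l k) hb').
by rewrite -(convol_reflect_wint (ker0 _) (mker _) (kerH _) (pC (~~ l) k) hb) CE.
Qed.

End fixed_mesh.
End limit_covariances.

(** * Identification of the solutions with the closed formulas *)

Section limit_formulas.
Context (R : realType).
Local Notation leb := (@lebesgue_measure R).
Variables (g h : R -> R).
Hypothesis g_ge0 : forall t, 0 <= t -> 0 <= g t.
Hypothesis h_ge0 : forall t, 0 <= t -> 0 <= h t.
Hypothesis g_int : leb.-integrable `[0, +oo[ (EFin \o g).
Hypothesis h_int : leb.-integrable `[0, +oo[ (EFin \o h).
Hypothesis hg_lt1 : normL1 h * normL1 g < 1.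
Variables (mu : 'I_4 -> R) (mu_ge0 : forall i, 0 <= mu i).
Local Open Scope ereal_scope.

Lemma pm_ext0 (f : R -> R) : (forall t, 0 <= t -> 0 <= f t)%R ->
  leb.-integrable `[0%R, +oo[ (EFin \o f) -> pm (ext0 f).
Proof.
move=> f0 intf; split; last by move=> t; rewrite /ext0; case: ifPn => // /f0; rewrite lee_fin.
have -> : ext0 f = (EFin \o f) \_ `[0%R, +oo[.
  by apply/funext => t; rewrite /ext0 patchE mem_setE in_itv/= andbT.
by apply/(measurable_restrictT _ _).1 => //; exact: (measurable_int _ intf).
Qed.

Lemma ext0_kpos (f : R -> R) x : x != 0%R -> ext0 f x = (kpos f x)%:E.
Proof. by move=> x0; rewrite /ext0 /kpos le_eqVlt eq_sym (negPf x0)/=; case: ifP. Qed.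

Lemma sum_densities_functional (a b : R) (u v : R -> \bar R) : (0 <= a)%R -> (0 <= b)%R ->
  pm u -> pm v ->
  let Psi (f : R -> \bar R) := a%:E * \int[leb]_y (f y * u y) + b%:E * \int[leb]_y (f y * v y) in
  [/\ sigma_functional Psi,
      forall A, measurable A -> a%:E * dens u A + b%:E * dens v A = Psi (fun x => (\1_A x)%:E) &
      forall f, pm f -> pm (fun x : R => Psi (fun y => f (x + y)%R))].
Proof.
move=> a0 b0 pu pv Psi; split.
- by apply: sigma_functionalD; apply: sigma_functionalZ => //; exact: sigma_functional_dens.
- by move=> A mA; rewrite !dens_functional.
- move=> f pf.
  have ps w : pm w -> pm (fun x : R => \int[leb]_y (f (x + y)%R * w y)).
    move=> pw; apply: (@pm_integral_shift _ f (fun z => z.1 + z.2)%R w) => //.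
    by apply: measurable_funD; [exact: measurable_fst|exact: measurable_snd].
  by apply: pm_add; apply: pm_mul; [apply: pm_cst; rewrite lee_fin|exact: ps|
    apply: pm_cst; rewrite lee_fin|exact: ps].
Qed.

Lemma point_density_functional (a b : R) (v : R -> \bar R) : (0 <= a)%R -> (0 <= b)%R ->
  pm v ->
  let Psi (f : R -> \bar R) := a%:E * f 0%R + b%:E * \int[leb]_y (f y * v y) in
  [/\ sigma_functional Psi,
      forall A, measurable A -> a%:E * \d_(0%R : R) A + b%:E * dens v A = Psi (fun x => (\1_A x)%:E) &
      forall f, pm f -> pm (fun x : R => Psi (fun y => f (x + y)%R))].
Proof.
move=> a0 b0 pv Psi; split.
- apply: sigma_functionalD; apply: sigma_functionalZ => //; last exact: sigma_functional_dens.
  exact: sigma_functional_point.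
- by move=> A mA; rewrite !dens_functional// diracE /Psi indicE.
- move=> f pf.
  have ps w : pm w -> pm (fun x : R => \int[leb]_y (f (x + y)%R * w y)).
    move=> pw; apply: (@pm_integral_shift _ f (fun z => z.1 + z.2)%R w) => //.
    by apply: measurable_funD; [exact: measurable_fst|exact: measurable_snd].
  have p0 : pm (fun x : R => f (x + 0)%R) by apply: (@pm_comp _ (fun x : R => x + 0)%R) pf; 
    apply: measurable_funD => //; exact: measurable_cst.
  by apply: pm_add; apply: pm_mul => //; exact: ps.
Qed.

Local Notation ker := (ker g h).
Local Notation mass := (mass g h).
Local Notation E := (ekr g h).
Local Notation F := (Floop g h).
Local Notation F' := (reflect_fun F).

Let pE k : pm (E k).
Proof. by split; [apply: measurable_EFinT; exact: measurable_ker|move=> x; rewrite lee_fin ker_ge0]. Qed.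
Let pE' k : pm (reflect_fun (E k)). Proof. exact: pm_reflect. Qed.
Let pF : pm F. Proof. by apply: pm_powers_sum; exact: pm_convol. Qed.
Let pF' : pm F'. Proof. exact: pm_reflect. Qed.
Let ph : pm (ext0 h). Proof. exact: pm_ext0. Qed.
Let pgx : pm (ext0 g). Proof. exact: pm_ext0. Qed.
Let ph' : pm (reflect_fun (ext0 h)). Proof. exact: pm_reflect. Qed.

Let ext0h x : x != 0%R -> ext0 h x = E true x. Proof. exact: ext0_kpos. Qed.
Let ext0g x : x != 0%R -> ext0 g x = E false x. Proof. exact: ext0_kpos. Qed.
Let ext0h' x : x != 0%R -> reflect_fun (ext0 h) x = reflect_fun (E true) x.
Proof. by move=> x0; apply: ext0h; rewrite oppr_eq0. Qed.

Lemma Fker_Floop : Fker g h = F.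
Proof. by rewrite /Fker /Floop /kloop (convol_eq_off0 ph pgx (pE true) (pE false)). Qed.

Let nu k := if k then nu1 h mu else nu2 g mu.

Let mass0 i : (0 <= mass i)%R.
Proof. exact: (mass_ge0 (ker_ge0 g_ge0 h_ge0 i) (integral_ker g_int h_int i)). Qed.

Let nu0 k : (0 <= nu k)%R.
Proof.
by case: k; rewrite /nu /nu1 /nu2 addr_ge0// mulr_ge0//;
  [exact: (mass0 comp1)|exact: (mass0 comp3)].
Qed.

Let K : R := (2 / (1 - normL1 h * normL1 g))%R.
Let K0 : (0 < K)%R. Proof. by rewrite divr_gt0// subr_gt0. Qed.

Let rateK k : (2 * rate g h mu k = K * nu k)%R.
Proof.
have r1 : (1 - normL1 h * normL1 g != 0)%R by rewrite gt_eqF// subr_gt0.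
by case: k; rewrite /rate /gain /K /nu /nu1 /nu2 /mass /kbase /=; field.
Qed.

(** Both infinities are sent to 0 by [fine], so for c > 0 the constant can be pulled out with no
    finiteness check. *)
Lemma fineM_gt0 (c : R) (x : \bar R) : (0 < c)%R -> fine (c%:E * x) = (c * fine x)%R.
Proof.
move=> c0; case: x => [r| |] //=; rewrite mulr0.
  by rewrite gt0_muley ?lte_fin.
by rewrite gt0_muleNy ?lte_fin.
Qed.

Section fixed_mesh.
Variable D : R.
Hypothesis D0 : (0 < D)%R.
Local Notation gam := (tri D).
Let pg : pm gam. Proof. exact: pm_tri. Qed.

Let Q2 f := resolve F' (resolve F f).
Let B := Q2 gam.
Let pP f : pm f -> pm (resolve F f). Proof. exact: pm_resolve. Qed.
Let pQ2 f : pm f -> pm (Q2 f). Proof. by move=> pf; do 2 apply: pm_resolve => //. Qed.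
Let pB : pm B. Proof. exact: pQ2. Qed.

Let pZ (c : R) (f : R -> \bar R) : (0 <= c)%R -> pm f -> pm (fun x => c%:E * f x).
Proof. by move=> c0 pf; apply: pm_mul => //; apply: pm_cst; rewrite lee_fin. Qed.

Let Q2D f f' : pm f -> pm f' -> Q2 (fun x => f x + f' x) = (fun x => Q2 f x + Q2 f' x).
Proof. by move=> pf pf'; rewrite /Q2 (resolveD pF pf pf') (resolveD pF' (pP pf) (pP pf')). Qed.

Let Q2Z c f : (0 <= c)%R -> pm f -> Q2 (fun x => c%:E * f x) = (fun x => c%:E * Q2 f x).
Proof. by move=> c0 pf; rewrite /Q2 (resolveZ c0 pF pf) (resolveZ c0 pF' (pP pf)). Qed.

Let Q2conv f k : pm f -> pm k -> Q2 (convol f k) = convol (Q2 f) k.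
Proof. by move=> pf pk; rewrite /Q2 (resolve_convol pF pf pk) (resolve_convol pF' (pP pf) pk). Qed.

Let cK k : (0 <= K * nu k)%R. Proof. by rewrite mulr_ge0// ltW. Qed.

Let Q_mart k l : resolve F' (elim_mart g h mu D k l) =
  (fun x => (K * nu k)%:E * (if k == l then B x else convol B (E l) x)).
Proof.
have e : resolve F' (fun x => (K * nu k)%:E * resolve F gam x) = (fun x => (K * nu k)%:E * B x).
  exact: (resolveZ (cK k) pF' (pP pg)).
rewrite /elim_mart rateK; case: ifP => _; first exact: e.
by rewrite (resolve_convol pF' (pZ (cK k) (pP pg)) (pE l)) e (convolZl (cK k) pB (pE l)).
Qed.

(** All the terms share the factor [B], the triangle convolved with both resolvents, because
    [resolve] commutes with convolutions; what remains is one kernel or a kernel and its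
    reflection. *)
Lemma elim_covE l k x : elim_cov g h mu D l k x = K%:E *
  (if l == k then (nu l)%:E * B x + (nu (~~ l))%:E * convol B (convol (E l) (reflect_fun (E l))) x
   else (nu l)%:E * convol B (E k) x + (nu k)%:E * convol B (reflect_fun (E l)) x).
Proof.
rewrite /elim_cov !Q_mart.
have pos (f : R -> \bar R) (c : bool) (y : R) : pm f -> 0 <= (nu c)%:E * f y.
  by move=> pf; rewrite mule_ge0 ?lee_fin ?pf.2.
case: (eqVneq l k) => [<-|lk].
  have -> : (~~ l == l) = false by case: (l).
  rewrite (convolZl (cK _) (pm_convol pB (pE l)) (pE' l)) (convolA pB (pE l) (pE' l)).
  have p1 : pm (convol B (convol (E l) (reflect_fun (E l)))) by do 2 apply: pm_convol => //.
  rewrite [RHS]ge0_muleDr; [|exact: pos|exact: (pos _ _ _ p1)].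
  by rewrite !EFinM !muleA.
have -> : ~~ l = k by case: l k lk => -[].
rewrite eqxx (convolZl (cK _) pB (pE' l)).
have p1 : pm (convol B (E k)) by exact: pm_convol.
have p2 : pm (convol B (reflect_fun (E l))) by exact: pm_convol.
rewrite [RHS]ge0_muleDr; [|exact: (pos _ _ _ p1)|exact: (pos _ _ _ p2)].
by rewrite !EFinM !muleA.
Qed.

Lemma C11_cov_lim t : C11 g h mu D t = cov_lim g h mu D true true t.
Proof.
rewrite /C11 -/K -(fineM_gt0 _ K0) /cov_lim elim_covE eqxx; congr (fine (_ * _)).
pose u := convol (E true) (reflect_fun (E true)).
have pu : pm u by exact: pm_convol.
rewrite /resolvent Fker_Floop (convol_eq_off0 ph ph' (pE true) (pE' true))//.
have [sP mP pP'] := point_density_functional (nu0 true) (nu0 false) pu.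
pose q x := (nu true)%:E * gam x + (nu false)%:E * convol gam u x.
have pq : pm q by apply: pm_add; apply: pZ => //; exact: pm_convol.
rewrite (resolvent_measure_triangle pF (q := q) sP mP pP' pg pq); last first.
  move=> x; rewrite /q addr0; congr (_ + _ * _); apply: eq_integral => y _.
  by rewrite opprD addrA.
rewrite -/(Q2 q) /q (Q2D (pZ (nu0 true) pg) (pZ (nu0 false) (pm_convol pg pu))).
by rewrite (Q2Z (nu0 true) pg) (Q2Z (nu0 false) (pm_convol pg pu)) (Q2conv pg pu).
Qed.

Lemma C12_cov_lim t : C12 g h mu D t = cov_lim g h mu D true false t.
Proof.
rewrite /C12 -/K -(fineM_gt0 _ K0) /cov_lim elim_covE; congr (fine (_ * _)).
rewrite /resolvent Fker_Floop /=.
have [sP mP pP'] := sum_densities_functional (nu0 false) (nu0 true) ph' pgx.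
pose q x := (nu false)%:E * convol gam (reflect_fun (E true)) x +
  (nu true)%:E * convol gam (E false) x.
have pq : pm q by apply: pm_add; apply: pZ => //; exact: pm_convol.
rewrite (resolvent_measure_triangle pF (q := q) sP mP pP' pg pq); last first.
  have eh := convol_eq_off0 pg ph' pg (pE' true) (fun _ _ => erefl) ext0h'.
  have eg := convol_eq_off0 pg pgx pg (pE false) (fun _ _ => erefl) ext0g.
  move=> x; rewrite /q -eh -eg.
  by congr (_ * _ + _ * _); apply: eq_integral => y _; rewrite opprD addrA.
rewrite -/(Q2 q) /q (Q2D (pZ (nu0 false) (pm_convol pg (pE' true))) (pZ (nu0 true) (pm_convol pg (pE false)))).
rewrite (Q2Z (nu0 true) (pm_convol pg (pE false))) (Q2Z (nu0 false) (pm_convol pg (pE' true))).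
by rewrite (Q2conv pg (pE' true)) (Q2conv pg (pE false)); exact: addeC.
Qed.

Lemma C12_cov_lim_opp t : C12 g h mu D (- t)%R = cov_lim g h mu D false true t.
Proof.
rewrite C12_cov_lim /cov_lim !elim_covE /=; congr (fine (_ * _)).
(* Reflection exchanges the two resolvents, which commute, and fixes the triangle. Since [B] is
   even, passing from t to - t exchanges each kernel with its reflection. *)
have B_even : reflect_fun B = B.
  have gam_even : reflect_fun gam = gam.
    by apply/funext => x; rewrite /reflect_fun /tri /triangle normrN.
  rewrite /B /Q2 (resolve_reflect pF' (pP pg)) (resolve_reflect pF pg) gam_even.
  have -> : reflect_fun F' = F by apply/funext => x; rewrite /reflect_fun opprK.
  rewrite {1}/resolve (convolC (pm_resolve pF' pg) pF) /resolve.
  have e : (fun x => gam x + convol gam F' x) = resolve F' gam by [].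
  rewrite (convolDr pg (pm_convol pg pF') pF) (convolDl pg (pm_convol pg pF) pF').
  rewrite (convolC pF pg) -(convolA pF pg pF') (convolC pF pg).
  by apply/funext => x; rewrite addeACA.
have refl l : reflect_fun (convol B (reflect_fun (E l))) = convol B (E l).
  rewrite (convol_reflect pB (pE' l)) B_even; congr (convol B _).
  by apply/funext => x; rewrite /reflect_fun opprK.
have refl' l : reflect_fun (convol B (E l)) = convol B (reflect_fun (E l)).
  by rewrite (convol_reflect pB (pE l)) B_even.
by rewrite -(refl true) -(refl' false); exact: addeC.
Qed.

End fixed_mesh.
End limit_formulas.

(** * Vanishing families and realized covariations *)

Section vanishing_families.
Context d (Omega : measurableType d) (R : realType) (P : probability Omega R).

(** Smallness for admissible shifts and a bound for all shifts travel together: a family serving as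
    forcing must provide both. *)
Definition ms_vanishing (Y : family Omega R) :=
  [/\ measurable_family Y, ms_small P Y & ms_bounded P Y].

Lemma ms_vanishingD (X Y : family Omega R) : ms_vanishing X -> ms_vanishing Y ->
  ms_vanishing (fun T D x b w => X T D x b w + Y T D x b w).
Proof.
move=> [mX sX bX] [mY sY bY]; split; [|exact: ms_smallD|exact: ms_boundedD].
by move=> T D x b; exact: measurable_funD.
Qed.

Lemma ms_vanishingZ (c : R) (X : family Omega R) : ms_vanishing X ->
  ms_vanishing (fun T D x b w => c * X T D x b w).
Proof.
move=> [mX sX bX]; split; [|exact: ms_smallZ|exact: ms_boundedZ].
by move=> T D x b; apply: measurable_funM => //; exact: measurable_cst.
Qed.

Lemma eq_ms_vanishing (X Y : family Omega R) : measurable_family Y ->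
  (forall T D x b, 1 <= T -> 0 < D <= T -> X T D x b = Y T D x b) ->
  ms_vanishing X -> ms_vanishing Y.
Proof.
by move=> mY XY [mX sX bX]; split => //; [exact: eq_ms_small sX|exact: eq_ms_bounded bX].
Qed.

(** Allows the two shift slots to be filled by quantities derived from D, x and b, such as the
    length and the left end of an overlap, as long as they are no larger than the original ones. *)
Lemma ms_vanishing_reparam (X : family Omega R) (fx fb : R -> R -> R -> R) :
  (forall D x b e, 0 < D <= e -> `|x| <= e -> `|b| <= e ->
    `|fx D x b| <= e /\ `|fb D x b| <= e) ->
  ms_vanishing X -> ms_vanishing (fun T D x b => X T D (fx D x b) (fb D x b)).
Proof.
move=> fe [mX sX [B B0 XB]]; split.
- by move=> T D x b; exact: mX.
- move=> dl dl0; have [e [T0 [e01 T01 Xdl]]] := sX _ dl0.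
  exists e, T0; split => // T D x b TT DT xT bT.
  by have [h1 h2] := fe _ _ _ _ DT xT bT; exact: Xdl.
- by exists B => // T D x b T1 DT; exact: XB.
Qed.

Lemma msq_cst (c : R) : (msq P (fun=> c) = (c ^+ 2)%:E)%E.
Proof. by rewrite /msq integral_cst// [X in (_ * X)%E]probability_setT mule1. Qed.

(** The minimum with 1 provides the uniform bound when |b| exceeds T; otherwise the error is of
    order (|b| + D) / T. *)
Lemma ms_vanishing_det (f : R -> R -> R -> R -> R) (C : R) : 0 <= C ->
  (forall T D x b, 1 <= T -> 0 < D <= T -> `|f T D x b| <= C * Num.min 1 ((`|b| + D) / T)) ->
  ms_vanishing (fun T D x b _ => f T D x b).
Proof.
move=> C0 fC; split; first by move=> T D x b; exact: measurable_cst.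
- move=> dl dl0.
  have c0 : 0 < 2 * C + 1 by lra.
  pose e := Num.min 1 (Num.sqrt dl / (2 * C + 1)).
  have e0 : 0 < e by rewrite lt_min ltr01 divr_gt0// sqrtr_gt0.
  exists e, 1; split => //; first by rewrite e0 ge_min lexx.
  move=> T D x b T1 /andP[D0 De] _ be; have T0 : 0 < T by lra.
  have e1 : e * T <= T by rewrite ler_piMl ?(ltW T0)// ge_min lexx.
  rewrite msq_cst lee_fin -[leRHS]sqr_sqrtr ?(ltW dl0)// -real_normK ?num_real//.
  rewrite lerXn2r ?nnegrE ?sqrtr_ge0//.
  apply: le_trans (fC T D x b T1 _) _; first by rewrite D0; lra.
  apply: (@le_trans _ _ (C * (2 * e))).
    by rewrite ler_wpM2l// ge_min ler_pdivrMr//; apply/orP; right; lra.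
  apply: (@le_trans _ _ ((2 * C + 1) * e)); first by rewrite mulrCA mulrA ler_wpM2r ?(ltW e0)//; lra.
  by rewrite mulrC -ler_pdivlMr// ge_min lexx orbT.
- exists (C ^+ 2); first exact: sqr_ge0.
  move=> T D x b T1 DT; rewrite msq_cst lee_fin -real_normK ?num_real//.
  rewrite lerXn2r ?nnegrE//; apply: le_trans (fC T D x b T1 DT) _.
  by rewrite ler_piMr// ge_min lexx.
Qed.

Lemma ms_vanishing_rate (Y : family Omega R) (C : R) : 0 <= C -> measurable_family Y ->
  (forall T D x b, 1 <= T -> 0 < D <= T -> (msq P (Y T D x b) <= (C * ((1 + D) / T))%:E)%E) ->
  ms_vanishing Y.
Proof.
move=> C0 mY YC; split => //.
- move=> dl dl0; have c0 : 0 < 2 * C + 1 by lra.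
  pose e := Num.min 1 (dl / (2 * C + 1)).
  have e0 : 0 < e by rewrite lt_min ltr01 divr_gt0.
  (* With T >= 1 / e and D <= e T one gets (1 + D) / T <= 2 e. *)
  exists e, (Num.max 1 e^-1); split.
  + by rewrite e0 ge_min lexx.
  + by rewrite le_max lexx.
  move=> T D x b; rewrite ge_max => /andP[T1 Te] /andP[D0 De] _ _.
  have T0 : 0 < T by lra.
  have e1 : e * T <= T by rewrite ler_piMl ?(ltW T0)// ge_min lexx.
  apply: le_trans (YC T D x b T1 _) _; first by rewrite D0; lra.
  have eT : 1 <= e * T by rewrite mulrC -ler_pdivrMr// div1r.
  rewrite lee_fin; apply: (@le_trans _ _ (C * (2 * e))).
    by rewrite ler_wpM2l// ler_pdivrMr//; lra.
  apply: (@le_trans _ _ ((2 * C + 1) * e)); first by rewrite mulrCA mulrA ler_wpM2r ?(ltW e0)//; lra.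
  by rewrite mulrC -ler_pdivlMr// ge_min lexx orbT.
- exists (C * 2); first by rewrite mulr_ge0.
  move=> T D x b T1 /andP[D0 DT]; apply: le_trans (YC T D x b T1 _) _; first by rewrite D0.
  by rewrite lee_fin ler_wpM2l// ler_pdivrMr//; lra.
Qed.

Lemma measurable_lin_joint p (c : nat -> Omega -> R) (u v : nat -> R) (Z : R -> Omega -> R) :
  (forall r, measurable_fun setT (c r)) ->
  measurable_fun setT (fun q : R * Omega => Z q.1 q.2) ->
  measurable_fun setT (fun q : R * Omega => lin p (c ^~ q.2) u v (Z ^~ q.2) q.1).
Proof.
move=> mc mZ; apply: measurable_sum => r.
have ms (a : R) : measurable_fun setT (fun q : R * Omega => Z (q.1 + a) q.2).
  have mg : measurable_fun setT (fun q : R * Omega => (q.1 + a, q.2)).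
    apply: measurable_fun_pair; last exact: measurable_snd.
    by apply: measurable_funD; [exact: measurable_fst|exact: measurable_cst].
  exact: (measurableT_comp mZ mg).
apply: measurable_funM; last exact: measurable_funB.
exact: (measurableT_comp (mc r) measurable_snd).
Qed.

Lemma msq_loc_bounded_sum (I : Type) (F : nat -> I -> Omega -> R) p :
  (forall r i, measurable_fun setT (F r i)) ->
  (forall r, exists2 K, 0 <= K & forall i, (msq P (F r i) <= K%:E)%E) ->
  exists2 K, 0 <= K & forall i, (msq P (fun w => \sum_(r < p) F r i w)%R <= K%:E)%E.
Proof.
move=> mF FK; elim: p => [|p [K K0 HK]].
  exists 0 => // i; rewrite (_ : (fun w => _) = fun=> 0) ?msq_cst ?expr0n//.
  by apply/funext => w; rewrite big_ord0.
have [K' K'0 HK'] := FK p; exists (2 * K + 2 * K'); first by rewrite addr_ge0// mulr_ge0.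
move=> i; rewrite (_ : (fun w => _) = (fun w => \sum_(r < p) F r i w + F p i w)); last first.
  by apply/funext => w; rewrite big_ord_recr.
apply: le_trans (msq_add P (measurable_sum _ (fun r : 'I_p => mF r i)) (mF p i)) _.
by rewrite [leRHS]EFinD ![in leRHS]EFinM; apply: leeD; apply: lee_wpmul2l => //.
Qed.

Lemma msq_mul_le (X Y : Omega -> R) (K : R) : 0 <= K ->
  measurable_fun setT X -> measurable_fun setT Y ->
  (\int[P]_w (X w ^+ 4)%:E <= K%:E)%E -> (\int[P]_w (Y w ^+ 4)%:E <= K%:E)%E ->
  (msq P (fun w => X w * Y w)%R <= K%:E)%E.
Proof.
move=> K0 mX mY XK YK.
have m4 (Z : Omega -> R) : measurable_fun setT Z -> measurable_fun setT (fun w : Omega => (Z w ^+ 4)%:E).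
  by move=> mZ; apply: measurable_EFinT; exact: measurable_funX.
have p4 (Z : Omega -> R) w : (0 <= (Z w ^+ 4)%:E)%E by rewrite lee_fin exprn_even_ge0.
apply: (@le_trans _ _ (2^-1%:E * (\int[P]_w (X w ^+ 4)%:E + \int[P]_w (Y w ^+ 4)%:E))%E).
  rewrite -(integralT_D P (m4 X mX) (m4 Y mY) (p4 X) (p4 Y)) -integralT_Zl ?lee_fin//; last 2 first.
  - by apply: emeasurable_funD; exact: m4.
  - by move=> w; exact: adde_ge0.
  apply: integralT_le.
  - by apply: measurable_EFinT; apply: measurable_funX; exact: measurable_funM.
  - by apply: measurable_funeM; apply: emeasurable_funD; exact: m4.
  - by move=> w; rewrite lee_fin sqr_ge0.
  move=> w; rewrite -EFinD -EFinM lee_fin -subr_ge0.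
  rewrite (_ : _ - _ = (X w ^+ 2 - Y w ^+ 2) ^+ 2 / 2); last by field.
  by rewrite divr_ge0// sqr_ge0.
apply: (@le_trans _ _ (2^-1%:E * (K%:E + K%:E))%E).
  by apply: lee_wpmul2l; [rewrite lee_fin|exact: leeD].
by rewrite -EFinD -EFinM lee_fin; lra.
Qed.

End vanishing_families.

(** * Counting mesh cells *)

Section mesh_points.
Context (R : realType).
Implicit Types T D b : R.

Definition npts T D : nat := Num.truncn (T / D).

Lemma npts_le T D : 0 < D -> 0 <= T -> (npts T D)%:R * D <= T.
Proof.
move=> D0 T0; rewrite -ler_pdivlMr//.
by have /andP[] := truncn_itv (divr_ge0 T0 (ltW D0)).
Qed.

Lemma npts_gt T D : 0 < D -> 0 <= T -> T < (npts T D)%:R * D + D.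
Proof.
move=> D0 T0; have /andP[_] := truncn_itv (divr_ge0 T0 (ltW D0)).
by rewrite ltr_pdivrMr// -natr1 mulrDl mul1r.
Qed.

(* The defects sum to at most those of whole cells, which telescope. *)
Lemma sum_pos_part_defect p D th b : 0 <= th <= D ->
  0 <= \sum_(r < p) (th - (Num.max (b + (r%:R * D + th)) 0 - Num.max (b + r%:R * D) 0))
    <= Num.min `|b| (p%:R * D).
Proof.
move=> /andP[t0 tD].
have mono c : 0 <= th - (Num.max (c + th) 0 - Num.max c 0) <=
    D - (Num.max (c + D) 0 - Num.max c 0).
  by have [h1|h1] := leP (c + th) 0; have [h2|h2] := leP (c + D) 0;
    have [h3|h3] := leP c 0; apply/andP; split; lra.
apply/andP; split.
  by apply: sumr_ge0 => r _; have /andP[] := mono (b + r%:R * D); rewrite addrA.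
apply: (@le_trans _ _ (\sum_(r < p) (D - (Num.max (b + r%:R * D + D) 0 - Num.max (b + r%:R * D) 0)))).
  by apply: ler_sum => r _; rewrite addrA; have /andP[_] := mono (b + r%:R * D).
have -> : \sum_(r < p) (D - (Num.max (b + r%:R * D + D) 0 - Num.max (b + r%:R * D) 0)) =
    p%:R * D - (Num.max (b + p%:R * D) 0 - Num.max b 0).
  elim: p => [|p IH]; first by rewrite big_ord0 mul0r addr0; lra.
  rewrite big_ord_recr/= IH -natr1 mulrDl mul1r (addrA b); ring.
have pD : 0 <= p%:R * D by rewrite mulr_ge0//; lra.
rewrite le_min; apply/andP; split.
  by have [h1|h1] := leP (b + p%:R * D) 0; have [h2|h2] := leP b 0; have := ler_norm b;
    have := ler_norm (- b); rewrite normrN; lra.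
by have [h1|h1] := leP (b + p%:R * D) 0; have [h2|h2] := leP b 0; lra.
Qed.

End mesh_points.

(** * The law of large numbers over the cells *)

Section process_families.
Context d (Omega : measurableType d) (R : realType) (P : probability Omega R).
Local Notation leb := (@lebesgue_measure R).
Variables (g h : R -> R).
Hypothesis g_ge0 : forall t, 0 <= t -> 0 <= g t.
Hypothesis h_ge0 : forall t, 0 <= t -> 0 <= h t.
Hypothesis g_int : leb.-integrable `[0, +oo[ (EFin \o g).
Hypothesis h_int : leb.-integrable `[0, +oo[ (EFin \o h).
Hypothesis hg_lt1 : normL1 h * normL1 g < 1.
Variables (mu : 'I_4 -> R) (mu_ge0 : forall i, 0 <= mu i).
Hypotheses (mu12 : mu comp1 = mu comp2) (mu34 : mu comp3 = mu comp4).
Variables (tm : nat -> Omega -> \bar R) (mk : nat -> Omega -> 'I_4).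
Hypothesis haw : is_hawkes P tm mk mu (kernel4 g h).

Local Notation Np := (Nproc tm mk).
Local Notation Mp := (Mproc g h mu tm mk).
Local Notation ker := (ker g h).
Local Notation mass := (mass g h).
Let ker0 i s : 0 <= ker i s. Proof. exact: ker_ge0. Qed.
Let mker i : measurable_fun setT (ker i). Proof. exact: measurable_ker. Qed.
Let kerH i : (\int[leb]_s (ker i s)%:E = (mass i)%:E)%E. Proof. exact: integral_ker. Qed.
Let kerneg i s : s < 0 -> ker i s = 0. Proof. exact: kpos_neg. Qed.
Let mN i t : measurable_fun setT (Np i t). Proof. exact: (measurable_Nproc haw). Qed.
Let mM i t : measurable_fun setT (Mp i t). Proof. exact: (measurable_Mproc g_ge0 h_ge0 g_int h_int haw). Qed.
Let mNj i : measurable_fun setT (fun q : R * Omega => Np i q.1 q.2).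
Proof. exact: (measurable_Nproc_joint haw). Qed.
Let lfae := ae_locally_finite g_ge0 h_ge0 g_int h_int hg_lt1 mu_ge0 haw.

(** One form for the three applications: [s] exchanges the two unknowns of the loop and [kap] names
    the kernel in each equation. For the law of large numbers these are [partner] and the identity,
    for the covariations [negb] and [pos_comp]. *)
Lemma coupled_vanishing (I : Type) (s : I -> I) (kap : I -> 'I_4)
    (X Y : I -> family Omega R) : involutive s ->
  (forall i, kap (s i) = partner (kap i)) -> (forall i, ms_vanishing P (X i)) ->
  (forall i T D x, measurable_fun setT (fun q : R * Omega => Y i T D x q.1 q.2)) ->
  (forall i T D x b, 1 <= T -> 0 < D <= T ->
    {ae P, forall w, (`|Y i T D x b w|%:E <= `|X i T D x b w|%:E +
     \int[leb]_u (ker (kap i) u * `|Y (s i) T D x (b - u)%R w|)%:E)%E}) ->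
  (forall i, ms_loc_bounded P (Y i)) -> forall i, ms_vanishing P (Y i).
Proof.
move=> ss kaps vX mY rel lY.
have H12 i : mass (kap i) * mass (kap (s i)) < 1 by rewrite kaps mass_partner.
have bY i : ms_bounded P (Y i).
  apply: (coupled_bounded (ker0 (kap i)) (mker _) (kerH _) (ker0 (kap (s i))) (mker _) (kerH _)
    (H12 i) (X1 := X i) (X2 := X (s i)) (Y1 := Y i) (Y2 := Y (s i))) => //.
  - by have [] := vX i.
  - by have [] := vX (s i).
  - exact: rel.
  - by move=> T D x b T1 DT; have := rel (s i) T D x b T1 DT; rewrite ss.
  - by have [] := vX i.
  - by have [] := vX (s i).
move=> i; split => //.
  by move=> T D x b; exact: (measurableT_comp (mY i T D x) (pair1_measurable b)).
apply: (coupled_small (ker0 (kap i)) (mker _) (@kerneg (kap i)) (kerH _) (ker0 (kap (s i)))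
  (mker _) (@kerneg (kap (s i))) (kerH _) (H12 i)
  (X1 := X i) (X2 := X (s i)) (Y1 := Y i) (Y2 := Y (s i))) => //.
- by have [] := vX i.
- by have [] := vX (s i).
- exact: rel.
- by move=> T D x b T1 DT; have := rel (s i) T D x b T1 DT; rewrite ss.
- by have [] := vX i.
- by have [] := vX (s i).
Qed.

(** A family takes arbitrary real shifts; clipping lets the slot x carry the length of a window
    inside a cell, always in [0, D]. *)
Definition clip (D x : R) : R := Num.min D (Num.max 0 x).

Lemma clip_bounds D x : 0 < D -> 0 <= clip D x <= D.
Proof. by move=> D0; rewrite /clip le_min ltW//= le_max lexx/= ge_min lexx. Qed.

Definition rate4 (i : 'I_4) : R := rate g h mu (val i < 2)%N.

Lemma rate4_renewal i : rate4 i = mu i + mass i * rate4 (partner i).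
Proof.
have Et := rateE hg_lt1 mu true; have Ef := rateE hg_lt1 mu false.
have : [\/ i = comp1, i = comp2, i = comp3 | i = comp4].
  by case: i => [[|[|[|[|//]]]] j]; [constructor 1|constructor 2|constructor 3|constructor 4];
    apply/val_inj.
by case=> ->; rewrite -?mu12 -?mu34; [exact: Et|exact: Et|exact: Ef|exact: Ef].
Qed.

Let uu D (r : nat) : R := r%:R * D.
Let vv D x (r : nat) : R := r%:R * D + clip D x.

(** Points are counted in the initial window of length [clip D x] of each cell, not in whole cells,
    because two meshes shifted against each other overlap only in such windows. *)
Definition lln_N (i : 'I_4) : family Omega R := fun T D x b w =>
  lin (npts T D) (fun=> T^-1) (uu D) (vv D x) (Np i ^~ w) b
  - T^-1 * ((npts T D)%:R * (rate4 i * clip D x)).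

Definition lln_M (i : 'I_4) : family Omega R := fun T D x b w =>
  lin (npts T D) (fun=> T^-1) (uu D) (vv D x) (Mp i ^~ w) b.

(** The baseline accrues at positive times only; this is the resulting error for windows that start
    before 0. *)
Definition lln_drift : family Omega R := fun T D x b _ =>
  lin (npts T D) (fun=> T^-1) (uu D) (vv D x) (fun t => Num.max t 0) b
  - T^-1 * ((npts T D)%:R * clip D x).

Lemma lln_M_vanishing i : ms_vanishing P (lln_M i).
Proof.
have mm1 := moment1_ge0 g_ge0 h_ge0 g_int h_int hg_lt1 mu_ge0.
have mI T D x b : measurable_fun setT (fun w => \sum_(r < npts T D)
    inc (Mp i) (b + r%:R * D) (b + clip D x + r%:R * D) w).
  by apply: measurable_sum => r; apply: measurable_funB.
have E T D x b : lln_M i T D x b = (fun w => T^-1 * \sum_(r < npts T D)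
    inc (Mp i) (b + r%:R * D) (b + clip D x + r%:R * D) w).
  apply/funext => w; rewrite /lln_M /lin mulr_sumr; apply: eq_bigr => r _.
  have e : b + (r%:R * D + clip D x) = b + clip D x + r%:R * D by ring.
  by rewrite /inc /uu /vv e.
apply: (@ms_vanishing_rate _ _ _ P _ (moment1 g h mu)) => //.
  by move=> T D x b; rewrite E; apply: measurable_funM => //; exact: measurable_cst.
move=> T D x b T1 /andP[D0 DT]; have T0 : 0 < T by lra.
rewrite E msq_scale//.
have /andP[c0 cD] := clip_bounds x D0.
have := msq_sum_incM g_ge0 h_ge0 g_int h_int hg_lt1 mu_ge0 haw i (npts T D) (ltW D0)
  (lo := b) (hi := b + clip D x).
rewrite lerDl lerD2l => /(_ c0 cD) le1.
apply: (@le_trans _ _ ((T^-1 ^+ 2)%:E * ((npts T D)%:R * (moment1 g h mu * D))%:E)%E).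
  by apply: lee_wpmul2l; rewrite ?lee_fin ?sqr_ge0.
rewrite -EFinM lee_fin.
have pD := npts_le D0 (ltW T0).
apply: (@le_trans _ _ (T^-1 ^+ 2 * (moment1 g h mu * T))).
  rewrite ler_wpM2l ?sqr_ge0//.
  by rewrite mulrCA ler_wpM2l.
rewrite (_ : T^-1 ^+ 2 * (moment1 g h mu * T) = moment1 g h mu * (1 / T)); last first.
  by field; rewrite gt_eqF.
rewrite ler_wpM2l// ler_pM2r ?invr_gt0//; lra.
Qed.

Lemma lln_drift_vanishing : ms_vanishing P lln_drift.
Proof.
apply: (@ms_vanishing_det _ _ _ P (fun T D x b => lln_drift T D x b point) 1) => //.
move=> T D x b T1 /andP[D0 DT]; have T0 : 0 < T by lra.
have -> : lln_drift T D x b point = - (T^-1 * \sum_(r < npts T D) (clip D x -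
    (Num.max (b + (r%:R * D + clip D x)) 0 - Num.max (b + r%:R * D) 0))).
  rewrite /lln_drift /lin sumrB sumr_const card_ord -mulr_sumr -[_ *+ _]mulr_natl.
  by rewrite /uu /vv; ring.
have /andP[s0 s1] := sum_pos_part_defect (npts T D) b (clip_bounds x D0).
rewrite normrN ger0_norm; last by rewrite mulr_ge0// invr_ge0 ltW.
rewrite mul1r mulrC ler_pdivrMr//.
move: s1; rewrite le_min => /andP[s1 s2].
have pD := npts_le D0 (ltW T0).
have [m|m] := leP 1 ((`|b| + D) / T); first by lra.
by rewrite divfK ?gt_eqF//; lra.
Qed.

Lemma fourth_loc i l : 0 < l -> exists2 K : R, 0 <= K & forall s t, t = s + l ->
  (\int[P]_w (inc (Np i) s t w ^+ 4)%:E <= K%:E)%E /\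
  (\int[P]_w (inc (Mp i) s t w ^+ 4)%:E <= K%:E)%E.
Proof.
move=> l0; have [K K0 HK] := fourth_bounds g_ge0 h_ge0 g_int h_int hg_lt1 mu_ge0 haw l0.
by exists K => // s t ->; exact: HK.
Qed.

Lemma lln_N_loc_bounded i : ms_loc_bounded P (lln_N i).
Proof.
move=> T D x T1 /andP[D0 DT]; have /andP[c0 cD] := clip_bounds x D0.
have T0 : 0 < T by lra.
pose F (r : nat) b w := T^-1 * (Np i (b + vv D x r) w - Np i (b + uu D r) w).
have mF r b : measurable_fun setT (F r b).
  by apply: measurable_funM; [exact: measurable_cst|exact: measurable_funB].
have FK r : exists2 K, 0 <= K & forall b, (msq P (F r b) <= K%:E)%E.
  have [K K0 HK] : exists2 K, 0 <= K & forall b,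
      (msq P (fun w => inc (Np i) (b + uu D r) (b + vv D x r) w * 1)%R <= K%:E)%E.
    (* An empty window gives 0 and is set apart, as the fourth moments are bounded for positive
       lengths. Multiplying by 1 lets [msq_mul_le] pass from fourth to second moments. *)
    have [c00|cp] := eqVneq (clip D x) 0.
      exists 0 => // b; rewrite (_ : (fun w => _) = fun=> 0) ?msq_cst ?expr0n//.
      by apply/funext => w; rewrite /inc /vv c00 addr0 subrr mul0r.
    have cp' : 0 < clip D x by rewrite lt_neqAle eq_sym cp.
    have [K K0 HK] := fourth_loc i cp'.
    exists (K + 1); first exact: addr_ge0.
    move=> b; apply: msq_mul_le; first exact: addr_ge0.
    - exact: measurable_funB.
    - exact: measurable_cst.
    - by have [k1 _] := HK (b + uu D r) (b + vv D x r) (addrA _ _ _);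
        apply: le_trans k1 _; rewrite lee_fin lerDl.
    - rewrite integral_cst// expr1n [X in (_ * X)%E]probability_setT mule1 lee_fin; lra.
  exists ((T^-1) ^+ 2 * K); first by rewrite mulr_ge0 ?sqr_ge0.
  move=> b; rewrite /F msq_scale; last exact: measurable_funB.
  rewrite [leRHS]EFinM; apply: lee_wpmul2l; first by rewrite lee_fin sqr_ge0.
  by apply: le_trans (HK b); rewrite le_eqVlt; apply/orP; left; apply/eqP; congr msq;
    apply/funext => w; rewrite mulr1.
have [K K0 HK] := msq_loc_bounded_sum (npts T D) mF FK.
pose c := T^-1 * ((npts T D)%:R * (rate4 i * clip D x)).
exists (2 * K + 2 * c ^+ 2); first by rewrite addr_ge0// mulr_ge0// sqr_ge0.
move=> b; apply: le_trans (@msq_add _ _ _ P (fun w => \sum_(r < npts T D) F r b w) (fun=> - c) _ _) _.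
- by apply: measurable_sum.
- exact: measurable_cst.
by rewrite [leRHS]EFinD ![in leRHS]EFinM msq_cst sqrrN; apply: leeD => //; apply: lee_wpmul2l.
Qed.

Lemma lln_N_vanishing i : ms_vanishing P (lln_N i).
Proof.
pose X i T D x b w := lln_M i T D x b w + mu i * lln_drift T D x b w.
move: i; apply: (@coupled_vanishing _ partner id X) => //.
- exact: partnerK.
- by move=> i; apply: ms_vanishingD; [exact: lln_M_vanishing|
    apply: ms_vanishingZ; exact: lln_drift_vanishing].
- move=> i T D x; apply: measurable_funB; last exact: measurable_cst.
  by apply: (@measurable_lin_joint _ _ _ _ (fun _ _ => T^-1)) => // r; exact: measurable_cst.
- move=> i T D x b T1 /andP[D0 DT]; apply: filterS lfae => w lw.
  have [L [bL LE decomp]] := lin_N_decomp g_ge0 h_ge0 g_int h_int haw i (npts T D) (fun=> T^-1)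
    (uu D) (vv D x) b lw.
  pose y := T^-1 * ((npts T D)%:R * (rate4 (partner i) * clip D x)).
  have := renewal_abs_le (ker0 i) (mker i) (kerH i)
    (T^-1 * ((npts T D)%:R * (rate4 i * clip D x))) bL (bmeas_cst _ y) decomp
    (Z := fun x' => lin (npts T D) (fun=> T^-1) (uu D) (vv D x) (Np (partner i) ^~ w) (b - x'))
    (fun x' kx => LE x' (ltW (ker_neq0 kx))).
  move=> /le_trans; apply.
  rewrite (wint_cst (ker0 i) (mker i) (kerH i)) leeD2r// lee_fin le_eqVlt.
  apply/orP; left; apply/eqP; congr `|_|.
  by rewrite /X /lln_M /lln_drift /y rate4_renewal; ring.
- exact: lln_N_loc_bounded.
Qed.

End process_families.

(** * Covariations of the compensated processes *)

Section covariation_families.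
Context d (Omega : measurableType d) (R : realType) (P : probability Omega R).
Local Notation leb := (@lebesgue_measure R).
Variables (g h : R -> R).
Hypothesis g_ge0 : forall t, 0 <= t -> 0 <= g t.
Hypothesis h_ge0 : forall t, 0 <= t -> 0 <= h t.
Hypothesis g_int : leb.-integrable `[0, +oo[ (EFin \o g).
Hypothesis h_int : leb.-integrable `[0, +oo[ (EFin \o h).
Hypothesis hg_lt1 : normL1 h * normL1 g < 1.
Variables (mu : 'I_4 -> R) (mu_ge0 : forall i, 0 <= mu i).
Hypotheses (mu12 : mu comp1 = mu comp2) (mu34 : mu comp3 = mu comp4).
Variables (tm : nat -> Omega -> \bar R) (mk : nat -> Omega -> 'I_4).
Hypothesis haw : is_hawkes P tm mk mu (kernel4 g h).

Local Notation Np := (Nproc tm mk).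
Local Notation Mp := (Mproc g h mu tm mk).
Local Notation ker := (ker g h).
Local Notation mass := (mass g h).
Let mN i t : measurable_fun setT (Np i t). Proof. exact: (measurable_Nproc haw). Qed.
Let mM i t : measurable_fun setT (Mp i t). Proof. exact: (measurable_Mproc g_ge0 h_ge0 g_int h_int haw). Qed.

Definition rcov p D T (Z Z' : R -> Omega -> R) (a b : R) (w : Omega) : R :=
  T^-1 * \sum_(r < p) inc Z (a + r%:R * D) (a + D + r%:R * D) w *
                      inc Z' (b + r%:R * D) (b + D + r%:R * D) w.

Lemma measurable_rcov p D T Z Z' a b : (forall t, measurable_fun setT (Z t)) ->
  (forall t, measurable_fun setT (Z' t)) -> measurable_fun setT (rcov p D T Z Z' a b).
Proof.
move=> mZ mZ'; apply: measurable_funM; first exact: measurable_cst.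
by apply: measurable_sum => r; apply: measurable_funM; apply: measurable_funB.
Qed.

(** With the increments of the first process frozen as coefficients, the covariation is linear in
    the second process, so the renewal equation acts on its shift. *)
Lemma rcov_lin p D T Z Z' a b w : rcov p D T Z Z' a b w =
  lin p (fun r => T^-1 * inc Z (a + r%:R * D) (a + D + r%:R * D) w)
    (fun r => r%:R * D) (fun r => D + r%:R * D) (Z' ^~ w) b.
Proof.
rewrite /rcov /lin mulr_sumr; apply: eq_bigr => r _.
by rewrite mulrA /inc (addrA b).
Qed.

Lemma rcovC p D T Z Z' a b w : rcov p D T Z Z' a b w = rcov p D T Z' Z b a w.
Proof. by rewrite /rcov; congr (_ * _); apply: eq_bigr => r _; rewrite mulrC. Qed.

Lemma rcovBl p D T Z1 Z2 Z' a b w : rcov p D T (fun t w => Z1 t w - Z2 t w) Z' a b w =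
  rcov p D T Z1 Z' a b w - rcov p D T Z2 Z' a b w.
Proof.
rewrite /rcov -mulrBr -sumrB; congr (_ * _); apply: eq_bigr => r _.
by rewrite /inc -mulrBl; congr (_ * _); ring.
Qed.

Lemma rcovB4 p D T Z1 Z2 Z3 Z4 a b w :
  rcov p D T (fun t w => Z1 t w - Z2 t w) (fun t w => Z3 t w - Z4 t w) a b w =
  rcov p D T Z1 Z3 a b w - rcov p D T Z1 Z4 a b w -
  (rcov p D T Z2 Z3 a b w - rcov p D T Z2 Z4 a b w).
Proof.
rewrite rcovBl rcovC rcovBl (rcovC _ _ _ Z3) (rcovC _ _ _ Z4); congr (_ - _).
by rewrite rcovC rcovBl (rcovC _ _ _ Z3) (rcovC _ _ _ Z4).
Qed.

Local Notation m_ := (rate4 g h mu).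

Definition pse (i j : 'I_4) : family Omega R := fun T D x b w =>
  T^-1 * prod_sum_error Mp Np D i j x b (npts T D) w.

Lemma pse_vanishing i j : ms_vanishing P (pse i j).
Proof.
have [c c0 Hc] : exists2 c : R, 0 <= c & forall D i j a b p, 0 < D ->
    (msq P (prod_sum_error Mp Np D i j a b p) <= (p%:R * (c * (D + D ^+ 2)))%:E)%E.
  have [C2 C20 HC2] := msq_prod_sum g_ge0 h_ge0 g_int h_int hg_lt1 mu_ge0 haw.
  exists (4000 * C2); first by apply: mulr_ge0 C20; exact: ler0n.
  by move=> D i' j' a b p D0; rewrite -(mulrA 4000); exact: HC2.
have mp D a b p : measurable_fun setT (prod_sum_error Mp Np D i j a b p).
  apply: measurable_sum => r; apply: measurable_funB.
    by apply: measurable_funM; apply: measurable_funB.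
  by apply: measurable_funM; [exact: measurable_cst|apply: measurable_funB].
apply: (ms_vanishing_rate c0).
  by move=> T D x b; apply: measurable_funM => //; exact: measurable_cst.
move=> T D x b T1 /andP[D0 DT]; have T0 : 0 < T by lra.
rewrite /pse msq_scale//.
apply: (@le_trans _ _ ((T^-1 ^+ 2)%:E * ((npts T D)%:R * (c * (D + D ^+ 2)))%:E)%E).
  by apply: lee_wpmul2l; [rewrite lee_fin sqr_ge0|exact: Hc].
rewrite -EFinM lee_fin.
have pD := npts_le D0 (ltW T0).
rewrite (_ : (npts T D)%:R * _ = (c * (1 + D)) * ((npts T D)%:R * D)); last by ring.
apply: (@le_trans _ _ (T^-1 ^+ 2 * (c * (1 + D) * T))).
  rewrite ler_wpM2l ?sqr_ge0// ler_wpM2l// mulr_ge0//; lra.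
by rewrite le_eqVlt; apply/orP; left; apply/eqP; field; rewrite gt_eqF.
Qed.

Definition mart_cov (i j : 'I_4) : family Omega R := fun T D x b w =>
  rcov (npts T D) D T (Mp i) (Mp j) x b w - (i == j)%:R * (m_ i * triangle D (b - x)).

Lemma overlap_triangle (D x : R) : 0 < D -> Num.max 0 (D - `|x|) = D * triangle D x.
Proof.
move=> D0; rewrite /triangle maxr_pMr ?(ltW D0)// mulr0 maxC; congr (Num.max _ 0).
by field; rewrite gt_eqF.
Qed.

(** Three errors: the products minus the points in the overlaps, the law of large numbers for these
    points, and [err] for rounding T down to a multiple of D. The overlap has length D times the
    triangle, and T / D cells leave the triangle itself. *)
Lemma mart_cov_vanishing i j : ms_vanishing P (mart_cov i j).
Proof.
have m0 : 0 <= m_ i by apply: rate_ge0.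
pose err : family Omega R := fun T D x b w =>
  m_ i * triangle D (b - x) * ((npts T D)%:R * D / T - 1).
have verr : ms_vanishing P err.
  apply: (@ms_vanishing_det _ _ _ P (fun T D x b => err T D x b point) (m_ i)) => //.
  move=> T D x b T1 /andP[D0 DT]; have T0 : 0 < T by lra.
  have /andP[t0 t1] := triangle_bound D0 (b - x).
  have pD := npts_le D0 (ltW T0); have pD' := npts_gt D0 (ltW T0).
  rewrite /err normrM ger0_norm; last by rewrite mulr_ge0.
  apply: (@le_trans _ _ (m_ i * `|(npts T D)%:R * D / T - 1|)).
    by rewrite ler_wpM2r// ler_piMr.
  rewrite ler_wpM2l// distrC ger0_norm; last by rewrite subr_ge0 ler_pdivrMr// mul1r.
  have pT : 0 <= (npts T D)%:R * D / T by rewrite divr_ge0 ?(ltW T0)// mulr_ge0// ltW.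
  rewrite le_min; apply/andP; split; first by lra.
  rewrite ler_pdivlMr// mulrBl mul1r divfK ?gt_eqF//.
  by have := normr_ge0 b; lra.
(* [fx] is the length of the overlap of two cells and [fb] its left end; they fill the two slots of
   the law of large numbers. *)
pose fx (D x b : R) := Num.max 0 (D - `|b - x|).
pose fb (D x b : R) := Num.max x b.
have fe (D x b e : R) : 0 < D <= e -> `|x| <= e -> `|b| <= e -> `|fx D x b| <= e /\ `|fb D x b| <= e.
  move=> /andP[D0 De] xe be; split.
    rewrite ger0_norm /fx ?le_max ?lexx// ge_max; have := normr_ge0 (b - x); lra.
  by rewrite /fb; have [_|_] := leP x b.
apply: (@eq_ms_vanishing _ _ _ P (fun T D x b w => pse i j T D x b w +
  (i == j)%:R * (lln_N g h mu tm mk i T D (fx D x b) (fb D x b) w + err T D x b w))).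
- move=> T D x b; apply: measurable_funB; last exact: measurable_cst.
  exact: measurable_rcov.
- move=> T D x b T1 /andP[D0 DT]; have T0 : 0 < T by lra.
  have /andP[t0 t1] := triangle_bound D0 (b - x).
  apply/funext => w.
  have fxE : fx D x b = D * triangle D (b - x) by exact: overlap_triangle.
  have cl : clip D (fx D x b) = fx D x b.
    have f0 : 0 <= fx D x b by rewrite /fx le_max lexx.
    rewrite /clip (max_idPr f0); apply/min_idPr.
    by rewrite fxE ler_piMr// ltW.
  have hi : Num.max (fb D x b) (Num.min x b + D) = fb D x b + fx D x b.
    rewrite /fb /fx; have [xb|xb] := leP x b.
      by rewrite ger0_norm ?subr_ge0// addr_maxr addr0; congr (Num.max _ _); ring.
    by rewrite ltr0_norm ?subr_lt0// addr_maxr addr0; congr (Num.max _ _); ring.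
  rewrite /pse /mart_cov /rcov /prod_sum_error sumrB mulrBr -addrA; congr (_ + _).
  case: eqP => _; last by rewrite big1 ?mulr0 ?mul0r ?subr0 ?oppr0 ?addr0// => r _; rewrite mul0r.
  rewrite !mul1r -/(fb D x b) hi /lln_N /lin cl /err.
  have -> : \sum_(r < npts T D) T^-1 * (Np i (fb D x b + (r%:R * D + fx D x b)) w -
      Np i (fb D x b + r%:R * D) w) = T^-1 * \sum_(r < npts T D) 1%:R * inc (Np i) (fb D x b + r%:R * D)
      (fb D x b + fx D x b + r%:R * D) w.
    rewrite mulr_sumr; apply: eq_bigr => r _; rewrite mul1r.
    have e : fb D x b + (r%:R * D + fx D x b) = fb D x b + fx D x b + r%:R * D by ring.
    by rewrite /inc e.
  rewrite fxE; field; by rewrite gt_eqF.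
apply: ms_vanishingD; first exact: pse_vanishing.
apply: ms_vanishingZ; apply: ms_vanishingD => //.
by apply: ms_vanishing_reparam fe _; exact: (lln_N_vanishing g_ge0 h_ge0 g_int h_int hg_lt1 mu_ge0 mu12 mu34 haw).
Qed.

End covariation_families.

(** * Covariations of the differences *)

Section difference_families.
Context d (Omega : measurableType d) (R : realType) (P : probability Omega R).
Local Notation leb := (@lebesgue_measure R).
Variables (g h : R -> R).
Hypothesis g_ge0 : forall t, 0 <= t -> 0 <= g t.
Hypothesis h_ge0 : forall t, 0 <= t -> 0 <= h t.
Hypothesis g_int : leb.-integrable `[0, +oo[ (EFin \o g).
Hypothesis h_int : leb.-integrable `[0, +oo[ (EFin \o h).
Hypothesis hg_lt1 : normL1 h * normL1 g < 1.
Variables (mu : 'I_4 -> R) (mu_ge0 : forall i, 0 <= mu i).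
Hypotheses (mu12 : mu comp1 = mu comp2) (mu34 : mu comp3 = mu comp4).
Variables (tm : nat -> Omega -> \bar R) (mk : nat -> Omega -> 'I_4).
Hypothesis haw : is_hawkes P tm mk mu (kernel4 g h).

Local Notation Np := (Nproc tm mk).
Local Notation Mp := (Mproc g h mu tm mk).
Local Notation ker := (ker g h).
Local Notation mass := (mass g h).
Local Notation lf := (locally_finite tm).
Let ker0 i s : 0 <= ker i s. Proof. exact: ker_ge0. Qed.
Let mker i : measurable_fun setT (ker i). Proof. exact: measurable_ker. Qed.
Let kerH i : (\int[leb]_s (ker i s)%:E = (mass i)%:E)%E. Proof. exact: integral_ker. Qed.
Let mN i t : measurable_fun setT (Np i t). Proof. exact: (measurable_Nproc haw). Qed.
Let mM i t : measurable_fun setT (Mp i t). Proof. exact: (measurable_Mproc g_ge0 h_ge0 g_int h_int haw). Qed.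
Let mNj i : measurable_fun setT (fun q : R * Omega => Np i q.1 q.2).
Proof. exact: (measurable_Nproc_joint haw). Qed.
Let lfae := ae_locally_finite g_ge0 h_ge0 g_int h_int hg_lt1 mu_ge0 haw.

Local Notation rate := (rate g h mu).
Local Notation kr k := (ker (pos_comp k)).
Local Notation dN k := (fun t w => Np (pos_comp k) t w - Np (neg_comp k) t w).
Local Notation dM k := (fun t w => Mp (pos_comp k) t w - Mp (neg_comp k) t w).

Let mdN k t : measurable_fun setT (dN k t). Proof. exact: measurable_funB. Qed.
Let mdM k t : measurable_fun setT (dM k t). Proof. exact: measurable_funB. Qed.
Let mdNj k : measurable_fun setT (fun q : R * Omega => dN k q.1 q.2).
Proof. exact: measurable_funB. Qed.

Lemma lin_diff_decomp k p c u v b w : lf w -> exists L : R -> R, [/\ bmeas L,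
  forall x, 0 <= x -> L x = lin p c u v (dN (~~ k) ^~ w) (b - x) &
  lin p c u v (dN k ^~ w) b = lin p c u v (dM k ^~ w) b + wint (kr k) L].
Proof.
move=> lw.
have [L1 [bL1 L1E d1]] := lin_N_decomp g_ge0 h_ge0 g_int h_int haw (pos_comp k) p c u v b lw.
have [L2 [bL2 L2E d2]] := lin_N_decomp g_ge0 h_ge0 g_int h_int haw (neg_comp k) p c u v b lw.
have p1 : partner (pos_comp k) = pos_comp (~~ k) by case: (k); apply/val_inj.
have p2 : partner (neg_comp k) = neg_comp (~~ k) by case: (k); apply/val_inj.
have kk : ker (neg_comp k) = kr k by case: (k).
have mm : mu (neg_comp k) = mu (pos_comp k) by case: (k).
exists (fun x => L1 x - L2 x); split; first exact: bmeasB.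
- by move=> x x0; rewrite linB L1E// L2E// p1 p2.
- have cancel (a a' m e e' : R) : a + m + e - (a' + m + e') = a - a' + (e - e') by ring.
  rewrite (wintB (ker0 (pos_comp k)) (mker _) (kerH _) bL1 bL2).
  rewrite (linB p c u v (Np (pos_comp k) ^~ w)) (linB p c u v (Mp (pos_comp k) ^~ w)) d1 d2 kk mm.
  exact: cancel.
Qed.

Definition fourth_bounded (Z : R -> Omega -> R) := forall l, 0 < l ->
  exists2 K : R, 0 <= K & forall s, (\int[P]_w (inc Z s (s + l)%R w ^+ 4)%:E <= K%:E)%E.

Lemma fourth_boundedB (Z Z' : R -> Omega -> R) : (forall t, measurable_fun setT (Z t)) ->
  (forall t, measurable_fun setT (Z' t)) -> fourth_bounded Z -> fourth_bounded Z' ->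
  fourth_bounded (fun t w => Z t w - Z' t w).
Proof.
move=> mZ mZ' bZ bZ' l l0; have [K K0 HK] := bZ l l0; have [K' K'0 HK'] := bZ' l l0.
exists (8 * (K + K')); first by rewrite mulr_ge0// addr_ge0.
move=> s.
have m4 (Y : R -> Omega -> R) : (forall t, measurable_fun setT (Y t)) ->
    measurable_fun setT (fun w : Omega => (inc Y s (s + l) w ^+ 4)%:E).
  by move=> mY; apply: measurable_EFinT; apply: measurable_funX; exact: measurable_funB.
have p4 (Y : R -> Omega -> R) w : (0 <= (inc Y s (s + l)%R w ^+ 4)%:E)%E.
  by rewrite lee_fin exprn_even_ge0.
apply: (@le_trans _ _ (8%:E * (\int[P]_w (inc Z s (s + l)%R w ^+ 4)%:E +
    \int[P]_w (inc Z' s (s + l)%R w ^+ 4)%:E))%E).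
  rewrite -(integralT_D P (m4 Z mZ) (m4 Z' mZ') (p4 Z) (p4 Z')) -integralT_Zl ?lee_fin//; last 2 first.
  - by apply: emeasurable_funD; exact: m4.
  - by move=> w; exact: adde_ge0.
  apply: integralT_le => //.
  - by apply: m4 => t; exact: measurable_funB.
  - by apply: measurable_funeM; apply: emeasurable_funD; exact: m4.
  move=> w; rewrite -EFinD -EFinM lee_fin /inc.
  set a := Z (s + l) w - Z s w; set b := Z' (s + l) w - Z' s w.
  rewrite (_ : _ - _ = a - b); last by rewrite /a /b; ring.
  rewrite -subr_ge0.
  rewrite (_ : _ - _ = 4 * (a ^+ 2 - b ^+ 2) ^+ 2 +
    (a + b) ^+ 2 * (2 * a ^+ 2 + 2 * b ^+ 2 + (a - b) ^+ 2)); last by ring.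
  have q1 := sqr_ge0 (a ^+ 2 - b ^+ 2); have q2 := sqr_ge0 (a - b).
  have q3 := sqr_ge0 a; have q4 := sqr_ge0 b.
  by apply: addr_ge0; [lra|apply: mulr_ge0; [exact: sqr_ge0|lra]].
by rewrite EFinM; apply: lee_wpmul2l => //; rewrite EFinD; exact: leeD.
Qed.

Lemma fourth_bounded_diff k : fourth_bounded (dN k) /\ fourth_bounded (dM k).
Proof.
have fN i : fourth_bounded (Np i).
  move=> l l0; have [K K0 HK] := fourth_bounds g_ge0 h_ge0 g_int h_int hg_lt1 mu_ge0 haw l0.
  by exists K => // s; have [] := HK i s.
have fM i : fourth_bounded (Mp i).
  move=> l l0; have [K K0 HK] := fourth_bounds g_ge0 h_ge0 g_int h_int hg_lt1 mu_ge0 haw l0.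
  by exists K => // s; have [] := HK i s.
by split; apply: fourth_boundedB.
Qed.

(** For fixed p, D and T this is a finite sum of products of increments over intervals of length D,
    whose fourth moments are bounded uniformly in the shifts. It is the finite bound from which the
    contraction starts. *)
Lemma rcov_loc_bounded p D T (Z Z' : R -> Omega -> R) (f : R -> R -> R) (B : R) :
  0 < D -> (forall t, measurable_fun setT (Z t)) -> (forall t, measurable_fun setT (Z' t)) ->
  fourth_bounded Z -> fourth_bounded Z' -> (forall a b, `|f a b| <= B) ->
  exists2 K, 0 <= K & forall a b, (msq P (fun w => rcov p D T Z Z' a b w - f a b)%R <= K%:E)%E.
Proof.
move=> D0 mZ mZ' bZ bZ' fB.
have [K K0 HK] := bZ D D0; have [K' K'0 HK'] := bZ' D D0.
pose F (r : nat) (q : R * R) w := inc Z (q.1 + r%:R * D) (q.1 + D + r%:R * D) w *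
  inc Z' (q.2 + r%:R * D) (q.2 + D + r%:R * D) w.
have mI (Y : R -> Omega -> R) s t : (forall t, measurable_fun setT (Y t)) ->
    measurable_fun setT (inc Y s t) by move=> mY; exact: measurable_funB.
have mF r q : measurable_fun setT (F r q) by apply: measurable_funM; exact: mI.
have FK r : exists2 L, 0 <= L & forall q, (msq P (F r q) <= L%:E)%E.
  exists (K + K'); first exact: addr_ge0.
  move=> [a b].
  have ea : a + D + r%:R * D = a + r%:R * D + D by ring.
  have eb : b + D + r%:R * D = b + r%:R * D + D by ring.
  rewrite /F /= ea eb; apply: msq_mul_le; [exact: addr_ge0|exact: mI|exact: mI|..].
    by apply: le_trans (HK _) _; rewrite lee_fin lerDl.
  by apply: le_trans (HK' _) _; rewrite lee_fin lerDr.
have [L L0 HL] := msq_loc_bounded_sum p mF FK.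
exists (2 * ((T^-1) ^+ 2 * L) + 2 * B ^+ 2).
  by apply: addr_ge0; apply: mulr_ge0 => //; [apply: mulr_ge0 => //; exact: sqr_ge0|exact: sqr_ge0].
move=> a b.
have ms : measurable_fun setT (fun w => \sum_(r < p) F r (a, b) w) by exact: measurable_sum.
have m1 : measurable_fun setT (fun w => T^-1 * \sum_(r < p) F r (a, b) w).
  by apply: measurable_funM => //; exact: measurable_cst.
apply: le_trans (msq_add P m1 (measurable_cst (- f a b))) _.
rewrite [leRHS]EFinD ![in leRHS]EFinM msq_cst sqrrN; apply: leeD; apply: lee_wpmul2l => //.
  by rewrite msq_scale//; apply: lee_wpmul2l; rewrite ?lee_fin ?sqr_ge0.
by rewrite -EFinM -expr2 lee_fin -(real_normK (num_real (f a b))) lerXn2r ?nnegrE// (le_trans _ (fB a b)).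
Qed.

Definition mart_diff_cov k l : family Omega R := fun T D x b w =>
  rcov (npts T D) D T (dM k) (dM l) x b w - (k == l)%:R * (2 * rate k * triangle D (b - x)).

(** Expanding bilinearly over four components, the two mixed terms have limit zero and the two
    matching ones have equal rates, whence the factor 2 when k = l. *)
Lemma mart_diff_cov_vanishing k l : ms_vanishing P (mart_diff_cov k l).
Proof.
have vE := mart_cov_vanishing g_ge0 h_ge0 g_int h_int hg_lt1 mu_ge0 mu12 mu34 haw.
pose E := mart_cov g h mu tm mk.
apply: (@eq_ms_vanishing _ _ _ P (fun T D x b w =>
  (E (pos_comp k) (pos_comp l) T D x b w + E (neg_comp k) (neg_comp l) T D x b w) +
  (-1) * (E (pos_comp k) (neg_comp l) T D x b w + E (neg_comp k) (pos_comp l) T D x b w))).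
- move=> T D x b; apply: measurable_funB; last exact: measurable_cst.
  exact: measurable_rcov.
- move=> T D x b _ _; apply/funext => w; rewrite /mart_diff_cov /E /mart_cov.
  have -> : (pos_comp k == pos_comp l) = (k == l) by case: (k); case: (l).
  have -> : (neg_comp k == neg_comp l) = (k == l) by case: (k); case: (l).
  have -> : (pos_comp k == neg_comp l) = false by case: (k); case: (l).
  have -> : (neg_comp k == pos_comp l) = false by case: (k); case: (l).
  have -> : rate4 g h mu (pos_comp k) = rate k by case: (k).
  have -> : rate4 g h mu (neg_comp k) = rate k by case: (k).
  have lin4 (V a1 a2 a3 a4 c t e f : R) : V = a1 - a2 - (a3 - a4) -> a1 - c * (e * t) + (a4 - c * (e * t)) +
      -1 * (a2 - false%:R * f + (a3 - false%:R * f)) = V - c * (2 * e * t).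
    by move=> ->; rewrite !mul0r; ring.
  exact: (lin4 _ _ _ _ _ _ _ _ _ (rcovB4 _ _ _ (Mp (pos_comp k)) (Mp (neg_comp k)) (Mp (pos_comp l)) (Mp (neg_comp l)) _ _ _)).
apply: ms_vanishingD; first by apply: ms_vanishingD; exact: vE.
by apply: ms_vanishingZ; apply: ms_vanishingD; exact: vE.
Qed.

Local Notation xlim D := (mart_lim g h mu D).
Local Notation clim D := (cov_lim g h mu D).

Let bX D k l : 0 < D -> bmeas (xlim D k l).
Proof. by move=> D0; exact: (bmeas_mart_lim g_ge0 h_ge0 g_int h_int hg_lt1 mu_ge0 D0). Qed.
Let bC D l k : 0 < D -> bmeas (clim D l k).
Proof. by move=> D0; exact: (bmeas_cov_lim g_ge0 h_ge0 g_int h_int hg_lt1 mu_ge0 D0). Qed.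

Lemma lin_diff_abs_le l p c u v b w (al : R) (y : R -> R) : lf w -> bmeas y ->
  (`|lin p c u v (dN l ^~ w) b - al|%:E <=
   `|lin p c u v (dM l ^~ w) b - (al - wint (kr l) y)|%:E +
   \int[leb]_s (kr l s * `|lin p c u v (dN (~~ l) ^~ w) (b - s)%R - y s|)%:E)%E.
Proof.
move=> lw bY; have [L [bL LE decomp]] := lin_diff_decomp l p c u v b lw.
exact: (renewal_abs_le (ker0 _) (mker _) (kerH _) al bL bY decomp
  (fun x kx => LE x (ltW (ker_neq0 kx)))).
Qed.

Lemma measurable_rcov_joint p D T k l x :
  measurable_fun setT (fun q : R * Omega => rcov p D T (dN k) (dN l) x q.1 q.2) /\
  measurable_fun setT (fun q : R * Omega => rcov p D T (dM k) (dN l) x q.1 q.2).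
Proof.
have m (Z : R -> Omega -> R) : (forall t, measurable_fun setT (Z t)) ->
    measurable_fun setT (fun q : R * Omega => rcov p D T Z (dN l) x q.1 q.2).
  move=> mZ; under eq_fun do rewrite rcov_lin.
  apply: (@measurable_lin_joint _ _ _ p
    (fun r w => T^-1 * inc Z (x + r%:R * D) (x + D + r%:R * D) w)
    (fun r => r%:R * D) (fun r => D + r%:R * D) (dN l)) => [r|]; last exact: mdNj.
  by apply: measurable_funM; [exact: measurable_cst|exact: measurable_funB].
by split; apply: m.
Qed.

Definition mart_diff_err k l : family Omega R := fun T D x b w =>
  rcov (npts T D) D T (dM k) (dN l) x b w - xlim D k l (b - x).

Lemma mart_diff_err_vanishing k l : ms_vanishing P (mart_diff_err k l).
Proof.
move: l; apply: (coupled_vanishing g_ge0 h_ge0 g_int h_int hg_lt1 (s := negb) (kap := pos_comp)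
  (X := mart_diff_cov k)).
- exact: negbK.
- by case; apply/val_inj.
- exact: mart_diff_cov_vanishing.
- move=> l T D x; apply: measurable_funB; first by case: (measurable_rcov_joint (npts T D) D T k l x).
  have mx : measurable_fun setT (xlim D k l) by exact: measurable_mart_lim.
  apply: (measurableT_comp mx).
  by apply: measurable_funB; [exact: measurable_fst|exact: measurable_cst].
- move=> l T D x b T1 /andP[D0 DT]; apply: filterS lfae => w lw.
  pose c r := T^-1 * inc (dM k) (x + r%:R * D) (x + D + r%:R * D) w.
  have E l' b' : mart_diff_err k l' T D x b' w = lin (npts T D) c (fun r => r%:R * D)
      (fun r => D + r%:R * D) (dN l' ^~ w) b' - xlim D k l' (b' - x).
    by rewrite /mart_diff_err rcov_lin.
  have bY : bmeas (fun s : R => xlim D k (~~ l) (b - x - s)).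
    apply: (@bmeas_comp _ (fun s : R => b - x - s)) (bX _ _ D0).
    by apply: measurable_funB => //; exact: measurable_cst.
  have main := lin_diff_abs_le l (npts T D) c (fun r => r%:R * D)
    (fun r => D + r%:R * D) b (xlim D k l (b - x)) lw bY.
  rewrite E; apply: le_trans main _.
  apply: leeD.
    rewrite lee_fin le_eqVlt; apply/orP; left; apply/eqP; congr `|_|.
    rewrite /mart_diff_cov rcov_lin; congr (_ - _).
    rewrite (mart_lim_renewal g_ge0 h_ge0 g_int h_int hg_lt1 mu_ge0 D0 k l).
    by rewrite addrK.
  rewrite le_eqVlt; apply/orP; left; apply/eqP; apply: eq_integral => s _.
  have e : b - s - x = b - x - s by ring.
  by rewrite E e.
- move=> l T D x T1 /andP[D0 _].
  have [_ [B xB]] := bX k l D0.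
  have [K K0 HK] := rcov_loc_bounded (npts T D) T (f := fun a b => xlim D k l (b - a)) D0
    (mdM k) (mdN l) (fourth_bounded_diff k).2 (fourth_bounded_diff l).1 (fun a b => xB (b - a)).
  by exists K => // b; exact: HK.
Qed.

(** In the last application the running shift is that of the martingale factor, whereas it was
    frozen in the previous one. Smallness and boundedness treat the two shifts alike. *)
Lemma mart_diff_err_vanishing_swap k l :
  ms_vanishing P (fun T D x b => mart_diff_err k l T D b x).
Proof.
have [mY sY [B B0 YB]] := mart_diff_err_vanishing k l.
split; [by move=> T D x b; exact: mY|exact: ms_small_swap|].
by exists B => // T D x b T1 DT; exact: YB.
Qed.

(** The running shift b now belongs to the first process, so the lag is x - b and b -> b - s
    increases it; this is why the reflected kernels enter the limit equation. *)
Definition diff_err k l : family Omega R := fun T D x b w =>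
  rcov (npts T D) D T (dN l) (dN k) b x w - clim D l k (x - b).

Lemma diff_err_vanishing k l : ms_vanishing P (diff_err k l).
Proof.
move: l; apply: (coupled_vanishing g_ge0 h_ge0 g_int h_int hg_lt1 (s := negb) (kap := pos_comp)
  (X := fun l T D x b => mart_diff_err l k T D b x)).
- exact: negbK.
- by case; apply/val_inj.
- by move=> l; exact: mart_diff_err_vanishing_swap.
- move=> l T D x; apply: measurable_funB.
    under eq_fun do rewrite rcovC.
    by case: (measurable_rcov_joint (npts T D) D T k l x).
  have mx : measurable_fun setT (clim D l k) by exact: measurable_cov_lim.
  apply: (measurableT_comp mx).
  by apply: measurable_funB; [exact: measurable_cst|exact: measurable_fst].
- move=> l T D x b T1 /andP[D0 DT]; apply: filterS lfae => w lw.
  pose c r := T^-1 * inc (dN k) (x + r%:R * D) (x + D + r%:R * D) w.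
  have E l' b' : diff_err k l' T D x b' w = lin (npts T D) c (fun r => r%:R * D)
      (fun r => D + r%:R * D) (dN l' ^~ w) b' - clim D l' k (x - b').
    by rewrite /diff_err rcovC rcov_lin.
  have bY : bmeas (fun s : R => clim D (~~ l) k (x - b + s)).
    apply: (@bmeas_comp _ (fun s : R => x - b + s)) (bC _ _ D0).
    by apply: measurable_funD => //; exact: measurable_cst.
  have main := lin_diff_abs_le l (npts T D) c (fun r => r%:R * D)
    (fun r => D + r%:R * D) b (clim D l k (x - b)) lw bY.
  rewrite E; apply: le_trans main _.
  apply: leeD.
    rewrite lee_fin le_eqVlt; apply/orP; left; apply/eqP; congr `|_|.
    rewrite /mart_diff_err rcovC rcov_lin; congr (_ - _).
    rewrite (cov_lim_renewal g_ge0 h_ge0 g_int h_int hg_lt1 mu_ge0 D0 l k).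
    by rewrite addrK.
  rewrite le_eqVlt; apply/orP; left; apply/eqP; apply: eq_integral => s _.
  have e : x - (b - s) = x - b + s by ring.
  by rewrite E e.
- move=> l T D x T1 /andP[D0 _].
  have [_ [B xB]] := bC l k D0.
  have [K K0 HK] := rcov_loc_bounded (npts T D) T (f := fun a b => clim D l k (b - a)) D0
    (mdN l) (mdN k) (fourth_bounded_diff l).1 (fourth_bounded_diff k).1 (fun a b => xB (b - a)).
  by exists K => // b; exact: HK.
Qed.

End difference_families.

(** * Convergence in L^2 along the given meshes and lags *)

Section mean_square_limits.
Context d (Omega : measurableType d) (R : realType) (P : probability Omega R).

Lemma Lnorm2_le (f : Omega -> R) (c : R) : 0 <= c -> (msq P f <= (c ^+ 2)%:E)%E ->
  ('N[P]_(2%:E) [EFin \o f] <= c%:E)%E.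
Proof.
move=> c0 fc; rewrite unlock /=.
have -> : (\int[P]_x (`|(EFin \o f) x| `^ 2) = msq P f)%E.
  apply: eq_integral => w _.
  by rewrite compE abse_EFin poweR_EFin powR_mulrn// real_normK// num_real.
have fin : msq P f \is a fin_num.
  by rewrite ge0_fin_numE ?msq_ge0//; apply: le_lt_trans fc _; rewrite ltry.
have r0 : 0 <= fine (msq P f) by apply: fine_ge0; exact: msq_ge0.
move: fc; rewrite -(fineK fin) lee_fin => rc.
by rewrite poweR_EFin powR12_sqrt// lee_fin -[leRHS]ger0_norm// -sqrtr_sqr ler_wsqrtr.
Qed.

Lemma cvg0_L2_of_ms_vanishing (Y : family Omega R) (Delta tau : R -> R) :
  ms_vanishing P Y -> (forall T : R, 0 < T -> 0 < Delta T) ->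
  Delta T / T @[T --> +oo] --> (0 : R) -> tau T / T @[T --> +oo] --> (0 : R) ->
  cvg0_L2 P (fun T => Y T (Delta T) (tau T) 0).
Proof.
move=> [mY sY _] D0 Dc tc.
have main (e : R) : 0 < e ->
    \forall T \near +oo, ('N[P]_(2%:E) [EFin \o Y T (Delta T) (tau T) 0%R] <= e%:E)%E.
  move=> e0; have e20 : 0 < e ^+ 2 by rewrite exprn_gt0.
  have [eta [T0 [/andP[eta0 _] T01 H]]] := sY _ e20.
  have nT : \forall T \near +oo, T0 <= T by apply: nbhs_pinfty_ge; exact: num_real.
  move/cvgrPdist_le : Dc => /(_ eta eta0) nD.
  move/cvgrPdist_le : tc => /(_ eta eta0) nt.
  apply: filterS3 nT nD nt => T /= TT DT tT.
  have Tp : 0 < T by lra.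
  have scale x : `|0 - x / T| <= eta -> `|x| <= eta * T.
    by rewrite sub0r normrN normrM normfV (gtr0_norm Tp) ler_pdivrMr.
  apply: Lnorm2_le; first exact: ltW.
  apply: H => //.
  - by rewrite D0//=; apply: le_trans (scale _ DT); exact: ler_norm.
  - exact: scale.
  - by rewrite normr0 mulr_ge0// ltW.
have N0 T := Lnorm_ge0 P 2%:E (EFin \o Y T (Delta T) (tau T) 0).
split.
  apply: filterS (main 1 ltr01) => T N1; rewrite inE; apply/andP; split.
    by rewrite inE /=; exact: mY.
  by rewrite inE /= /finite_norm; apply: le_lt_trans N1 _; rewrite ltry.
apply/fine_cvgP; split.
  apply: filterS (main 1 ltr01) => T N1.
  by rewrite ge0_fin_numE//; apply: le_lt_trans N1 _; rewrite ltry.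
apply/cvgrPdist_le => e e0; apply: filterS (main e e0) => T Ne /=.
rewrite sub0r normrN ger0_norm ?fine_ge0// -lee_fin fineK// ge0_fin_numE//.
by apply: le_lt_trans Ne _; rewrite ltry.
Qed.

End mean_square_limits.

Section difference_processes.
Context d (Omega : measurableType d) (R : realType).
Variables (tm : nat -> Omega -> \bar R) (mk : nat -> Omega -> 'I_4).
Hypothesis tm_gt0 : forall n w, (0 < tm n w)%E.

(** All the points lie at positive times, so the extension by 0 agrees with the counting processes
    themselves at times t <= 0. *)
Lemma difference_processE i j t w :
  difference_process tm mk i j t w = Nproc tm mk i t w - Nproc tm mk j t w.
Proof.
rewrite /difference_process; case: ltP => // t0.
have N0 l : Nproc tm mk l t w = 0.
  rewrite /Nproc /counting_process eseries0//= => n _ _.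
  rewrite ifF//; apply/negbTE; rewrite negb_and -ltNge.
  by rewrite (le_lt_trans _ (tm_gt0 n w))// lee_fin.
by rewrite !N0 subrr.
Qed.

Lemma realized_covE (Delta T tau : R) (Z Z' : R -> Omega -> R) w :
  realized_cov Delta T Z (time_shift tau Z') w = rcov (npts T Delta) Delta T Z Z' 0 tau w.
Proof.
rewrite /realized_cov /rcov; congr (_ * _).
rewrite big_add1/= big_mkord; apply: eq_bigr => r _.
have e : r.+1%:R * Delta = Delta + r%:R * Delta by rewrite -natr1; ring.
by rewrite /time_shift /inc /= !add0r e (addrA tau).
Qed.

End difference_processes.

Unset Implicit Arguments.

Theorem proposition3 (d : measure_display) (Omega : measurableType d)
    (R : realType) (P : probability Omega R)
    (g h : R -> R)
    (g_ge0 : forall t : R, 0 <= t -> 0 <= g t)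
    (h_ge0 : forall t : R, 0 <= t -> 0 <= h t)
    (g_int : lebesgue_measure.-integrable `[0, +oo[ (EFin \o g))
    (h_int : lebesgue_measure.-integrable `[0, +oo[ (EFin \o h))
    (hg_lt1 : normL1 h * normL1 g < 1)
    (mu : 'I_4 -> R) (mu_ge0 : forall i, 0 <= mu i)
    (mu12 : mu comp1 = mu comp2) (mu34 : mu comp3 = mu comp4)
    (tm : nat -> Omega -> \bar R) (mk : nat -> Omega -> 'I_4)
    (N_hawkes : is_hawkes P tm mk mu (kernel4 g h))
    (Delta tau : R -> R)
    (Delta_gt0 : forall T : R, 0 < T -> 0 < Delta T)
    (Delta_cvg : Delta T / T @[T --> +oo] --> (0 : R))
    (tau_cvg : tau T / T @[T --> +oo] --> (0 : R)) :
  let S1 := difference_process tm mk comp1 comp2 in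
  let S2 := difference_process tm mk comp3 comp4 in
  [/\ cvg0_L2 P (fun T w =>
        realized_cov (Delta T) T S1 (time_shift (tau T) S1) w
        - C11 g h mu (Delta T) (tau T)),
      cvg0_L2 P (fun T w =>
        realized_cov (Delta T) T S1 (time_shift (tau T) S2) w
        - C12 g h mu (Delta T) (tau T)) &
      cvg0_L2 P (fun T w =>
        realized_cov (Delta T) T S2 (time_shift (tau T) S1) w
        - C12 g h mu (Delta T) (- tau T))].
Proof.
move=> S1 S2.
have mpts : marked_points tm mk by case: N_hawkes.
have tm_gt0 n w : (0 < tm n w)%E by case: mpts.
have S1E : S1 = fun t w => Nproc tm mk (pos_comp true) t w - Nproc tm mk (neg_comp true) t w.
  by apply/funext => t; apply/funext => w; exact: difference_processE.
have S2E : S2 = fun t w => Nproc tm mk (pos_comp false) t w - Nproc tm mk (neg_comp false) t w.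
  by apply/funext => t; apply/funext => w; exact: difference_processE.
(* The lag tau is the shift x of the second process, and the running shift b of the first one is
   taken to be 0. *)
have lim k l := cvg0_L2_of_ms_vanishing
  (diff_err_vanishing g_ge0 h_ge0 g_int h_int hg_lt1 mu_ge0 mu12 mu34 N_hawkes k l)
  Delta_gt0 Delta_cvg tau_cvg.
have cov k l T w : diff_err g h mu tm mk k l T (Delta T) (tau T) 0 w =
    realized_cov (Delta T) T (if l then S1 else S2) (time_shift (tau T) (if k then S1 else S2)) w
    - cov_lim g h mu (Delta T) l k (tau T).
  by rewrite realized_covE /diff_err subr0 S1E S2E; case: k l => -[].
split.
- move: (lim true true); congr (cvg0_L2 P _); apply/funext => T; apply/funext => w.
  by rewrite cov C11_cov_lim.
- move: (lim false true); congr (cvg0_L2 P _); apply/funext => T; apply/funext => w.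
  by rewrite cov C12_cov_lim.
- move: (lim true false); congr (cvg0_L2 P _); apply/funext => T; apply/funext => w.
  by rewrite cov C12_cov_lim_opp.
Qed.
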